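(* Let $X$ be a second countable compact totally disconnected Abelian group and let $n\geq 2$ be an integer. The following two conditions are equivalent: (i) For all independent random variables $\xi_1,\ldots,\xi_n$ with values in $X$ and with distributions $\mu_1,\ldots,\mu_n$ respectively, and for all $\alpha_{ij}\in \mathrm{Aut}(X)$, $i,j=1,2,\ldots,n$, the independence of the linear forms $L_j=\sum_{i=1}^{n}\alpha_{ij}\xi_i$, $j=1,2,\ldots,n$, implies that $\mu_i\in\Gamma(X)\ast I(X)$ for all $i=1,2,\ldots,n$. (ii) $X$ is topologically isomorphic to a group of the form $$\prod_{p \in \mathfrak{P}}\left(\Delta_p^{n_p}\times G_p\right),$$ where $\mathfrak{P}$ is the set of all prime numbers, $n_p$ are non-negative integers, and each $G_p$ is a finite $p$-primary Abelian group.
   Context: $\Delta_p$ is the compact group of $p$-adic integers, and $\Delta_p^{n_p}$ is the direct product of $n_p$ copies of it. An Abelian group is called $p$-primary if every nonzero element of it has order $p^k$ for some natural number $k$ (the trivial group is allowed). The direct product over all primes carries the product topology. $\mathrm{Aut}(X)$ is the group of topological automorphisms of $X$. A distribution on $X$ is a Borel probability measure on $X$, and $\ast$ denotes convolution. For $x\in X$, $E_x$ is the degenerate distribution concentrated at $x$; for a compact subgroup $H$ of $X$, $m_H$ is the Haar distribution on $H$ (normalized Haar measure of $H$, regarded as a distribution on $X$). $I(X)$ is the set of all distributions of the form $m_H\ast E_x$, where $H$ is a compact subgroup of $X$ and $x\in X$. Let $Y$ be the character group of $X$, with $(x,y)$ the value of the character $y\in Y$ at $x\in X$; the characteristic function of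 a distribution $\mu$ is $\hat\mu(y)=\int_X (x,y)\,d\mu(x)$, $y\in Y$. A distribution $\mu$ on $X$ is called Gaussian if its characteristic function can be represented in the form $\hat\mu(y)=(x,y)\exp\{-\phi(y)\}$, $y\in Y$, for some fixed $x\in X$ and some continuous non-negative real-valued function $\phi$ on $Y$ satisfying $\phi(u+v)+\phi(u-v)=2\phi(u)+2\phi(v)$ for all $u,v\in Y$ (degenerate distributions are included, with $\phi=0$). $\Gamma(X)$ is the set of all Gaussian distributions on $X$. $\Gamma(X)\ast I(X)$ is the set of all convolutions $\gamma\ast\nu$ with $\gamma\in\Gamma(X)$ and $\nu\in I(X)$. Independence of a finite family of random variables means mutual independence. *)

(* Defs.v *)
From HB Require Import structures.
From mathcomp Require Import all_boot all_order all_algebra.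
From mathcomp Require Import fingroup.
From mathcomp Require Import all_classical all_reals all_analysis.
From mathcomp Require Import complex.

Set Implicit Arguments.
Unset Strict Implicit.
Unset Printing Implicit Defensive.

Import Order.TTheory GRing.Theory Num.Theory.
Import numFieldNormedType.Exports.

Local Open Scope classical_set_scope.
Local Open Scope ring_scope.

Definition top_isomorphism (X Y : topologicalZmodType) (f : X -> Y) : Prop :=
  [/\ zmod_morphism f, continuous f
    & exists g : Y -> X, [/\ cancel f g, cancel g f & continuous g]].

Definition top_automorphism (X : topologicalZmodType) (f : X -> X) : Prop :=
  top_isomorphism f.

Definition top_isomorphic (X Y : topologicalZmodType) : Prop :=
  exists f : X -> Y, top_isomorphism f.

Section DiscreteGroup.
Variable G : zmodType.

HB.instance Definition _ := GRing.Zmodule.on (discrete_topology G).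

Let discrete_sub_continuous : continuous
  (fun x : discrete_topology G * discrete_topology G => x.1 - x.2).
Proof.
move=> [x y] /= A Axy; exists ([set x], [set y]); first by split.
by move=> [a b] [/= -> ->]; exact: nbhs_singleton.
Qed.

HB.instance Definition _ := PreTopologicalNmodule_isTopologicalZmodule.Build
  (discrete_topology G) discrete_sub_continuous.

End DiscreteGroup.

Lemma prod_topology_continuous (S : topologicalType) (I : Type)
    (T : I -> topologicalType) (f : S -> prod_topology T) :
  (forall i, continuous (fun s => f s i)) -> continuous f.
Proof.
move=> fc s; apply/cvg_sup => i A /= [_ [[B oB <-] /= Bfs sBA]].
by apply: (filterS sBA); apply: fc; exact: open_nbhs_nbhs.
Qed.

Lemma prod_topology_proj_continuous (I : Type) (T : I -> topologicalType)
    (i : I) : continuous (fun x : prod_topology T => x i).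
Proof. exact: (@proj_continuous {classic I} T i). Qed.

Section DirectProduct.
Variables (I : Type) (T : I -> topologicalZmodType).

Definition direct_product : Type := prod_topology T.

HB.instance Definition _ := Topological.on direct_product.

Let addp (x y : direct_product) : direct_product := fun i => x i + y i.
Let oppp (x : direct_product) : direct_product := fun i => - x i.
Let zerop : direct_product := fun=> 0.

Let addpA : associative addp.
Proof.
by move=> x y z; apply: functional_extensionality_dep => i; exact: addrA.
Qed.
Let addpC : commutative addp.
Proof. by move=> x y; apply: functional_extensionality_dep => i; exact: addrC. Qed.
Let add0p : left_id zerop addp.
Proof. by move=> x; apply: functional_extensionality_dep => i; exact: add0r. Qed.
Let addNp : left_inverse zerop oppp addp.
Proof. by move=> x; apply: functional_extensionality_dep => i; exact: addNr. Qed.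

HB.instance Definition _ :=
  GRing.isZmodule.Build direct_product addpA addpC add0p addNp.

Let direct_product_sub_continuous :
  continuous (fun x : direct_product * direct_product => x.1 - x.2).
Proof.
apply: prod_topology_continuous => i /= x.
apply: (@continuous_comp _ _ _ (fun x : direct_product * direct_product =>
  (x.1 i, x.2 i)) (fun y : T i * T i => y.1 - y.2)); last exact: sub_continuous.
apply: cvg_pair => /=.
  apply: (@continuous_comp _ _ _ fst (fun z : direct_product => z i)).
    exact: cvg_fst.
  exact: prod_topology_proj_continuous.
apply: (@continuous_comp _ _ _ snd (fun z : direct_product => z i)).
  exact: cvg_snd.
exact: prod_topology_proj_continuous.
Qed.

HB.instance Definition _ := PreTopologicalNmodule_isTopologicalZmodule.Build
  direct_product direct_product_sub_continuous.

End DirectProduct.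

(* A wrapper is needed: on [A * B] the library only registers the topological
   group structure for topological vector spaces. *)
Section DirectProduct2.
Variables A B : topologicalZmodType.

Definition direct_product2 : Type := (A * B)%type.

HB.instance Definition _ := Topological.on direct_product2.
HB.instance Definition _ := GRing.Zmodule.on direct_product2.

Let direct_product2_sub_continuous :
  continuous (fun x : direct_product2 * direct_product2 => x.1 - x.2).
Proof.
move=> x; apply: (@cvg_pair _ _ _ (nbhs x) (nbhs (x.1.1 - x.2.1))
  (nbhs (x.1.2 - x.2.2)) _ _ _ (fun x => x.1.1 - x.2.1)
  (fun x => x.1.2 - x.2.2)).
  apply: (@continuous_comp _ _ _ (fun x : direct_product2 * direct_product2 =>
    (x.1.1, x.2.1)) (fun y : A * A => y.1 - y.2)); last exact: sub_continuous.
  apply: cvg_pair => /=; apply: (@continuous_comp _ _ _ _ fst); by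
    [exact: cvg_fst|exact: cvg_snd].
apply: (@continuous_comp _ _ _ (fun x : direct_product2 * direct_product2 =>
  (x.1.2, x.2.2)) (fun y : B * B => y.1 - y.2)); last exact: sub_continuous.
apply: cvg_pair => /=; apply: (@continuous_comp _ _ _ _ snd); by
  [exact: cvg_fst|exact: cvg_snd].
Qed.

HB.instance Definition _ := PreTopologicalNmodule_isTopologicalZmodule.Build
  direct_product2 direct_product2_sub_continuous.

End DirectProduct2.

Definition prime_number : Type := {p : nat | prime p}.

Lemma modn_sub_coherent (q r r' a a' b b' : nat) :
  r = r' -> (r %| q -> b <= q -> b' <= r' ->
    a = a' %[mod r] -> b = b' %[mod r] ->
  (a + (q - b) %% q) %% q = (a' + (r' - b') %% r') %% r' %[mod r])%N.
Proof.
move=> <- rq bq b'r aa' bb'.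
rewrite modn_mod (modn_dvdm _ rq) modnDmr -modnDmr (modn_dvdm _ rq) modnDmr.
apply/eqP; rewrite -(eqn_modDr b); apply/eqP.
rewrite -addnA subnK// -modnDmr (eqP (rq : _ == _)) addn0 aa'.
by rewrite -modnDmr bb' modnDmr -addnA subnK// modnDr.
Qed.

Lemma continuous_to_set_type (S Y : topologicalType) (A : set Y)
    (f : S -> set_type A) :
  continuous (fun s => val (f s)) -> continuous f.
Proof.
move=> fc s U [_ [[W oW <-] /= Wfs]] /filterS; apply.
have E : set_val \o f = (fun s => val (f s)).
  by apply/funext => z; rewrite set_valE.
suff: nbhs s ((set_val \o f) @^-1` W) by [].
by rewrite E; apply: fc; exact: open_nbhs_nbhs.
Qed.

Section PadicIntegers.
Variable p : prime_number.

(* The p-adic integers as the inverse limit of the discrete groups Z/p^(k+1):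
   the levels start at p^1 because ['Z_1] denotes Z/2, not the trivial group. *)
Definition padic_tower : Type :=
  direct_product (fun k => discrete_topology 'Z_(val p ^ k.+1)).

HB.instance Definition _ := TopologicalZmodule.on padic_tower.

Definition padic_coherent : set padic_tower :=
  [set x | forall k : nat,
     (x k.+1 : nat) = (x k : nat) %[mod val p ^ k.+1]].

Definition padic : Type := set_type padic_coherent.

HB.instance Definition _ := SubChoice.on padic.
HB.instance Definition _ := Topological.on padic.

Let Zp_truncE k : (Zp_trunc (val p ^ k.+1)).+2 = (val p ^ k.+1)%N.
Proof.
by rewrite Zp_cast// -{1}(exp1n k.+1) ltn_exp2r// prime_gt1// (valP p).
Qed.

Let padic_zmod_closed : zmod_closed (mem padic_coherent).
Proof.
split=> [|x y]; first by rewrite inE.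
rewrite !inE => xc yc k.
have yle j : (y j <= (Zp_trunc (val p ^ j.+1)).+2)%N by rewrite ltnW// ltn_ord.
apply: modn_sub_coherent; [| |exact: yle|exact: yle|exact: xc|exact: yc].
  by rewrite [RHS]Zp_truncE.
by rewrite [X in (_ %| X)%N]Zp_truncE dvdn_exp2l.
Qed.

HB.instance Definition _ :=
  GRing.SubChoice_isSubZmodule.Build _ _ padic padic_zmod_closed.

Let padic_val_continuous : continuous (val : padic -> padic_tower).
Proof. exact: initial_continuous. Qed.

Let padic_sub_continuous : continuous (fun x : padic * padic => x.1 - x.2).
Proof.
have H := @continuous_to_set_type (padic * padic)%type padic_tower
  padic_coherent (fun x => x.1 - x.2).
refine (H _) => {H}.
have -> : (fun x : padic * padic => val (x.1 - x.2)) =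
    (fun y : padic_tower * padic_tower => y.1 - y.2) \o
    (fun x : padic * padic => (val x.1, val x.2)).
  by apply/funext => z; exact: (raddfB (val : padic -> padic_tower)).
move=> x.
apply: (@continuous_comp _ _ _ (fun x : padic * padic => (val x.1, val x.2))
  (fun y : padic_tower * padic_tower => y.1 - y.2)); last exact: sub_continuous.
apply: (@cvg_pair _ _ _ (nbhs x) (nbhs (val x.1)) (nbhs (val x.2)) _ _ _
  (fun x => val x.1) (fun x => val x.2)).
  apply: (@continuous_comp _ _ _ fst (val : padic -> padic_tower)).
    exact: cvg_fst.
  exact: padic_val_continuous.
apply: (@continuous_comp _ _ _ snd (val : padic -> padic_tower)).
  exact: cvg_snd.
exact: padic_val_continuous.
Qed.

HB.instance Definition _ := PreTopologicalNmodule_isTopologicalZmodule.Build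
  padic padic_sub_continuous.

End PadicIntegers.

Definition p_primary (p : nat) (G : finZmodType) : Prop :=
  forall x : G, x != 0 -> exists k : nat, #[x]%g = (p ^ k)%N.

(* The character group, with the compact-open topology. Its law is the
   pointwise product of characters, written additively. *)
Section CharacterGroup.
Variables (R : realType) (X : topologicalZmodType).

Definition is_character : set {compact-open, X -> R[i]^o} :=
  [set f | [/\ continuous (f : X -> R[i]^o), forall x, `|f x| = 1
             & forall x y, f (x + y) = f x * f y]].

Definition char_group : Type := set_type is_character.

HB.instance Definition _ := Choice.on char_group.
HB.instance Definition _ := Topological.on char_group.

Definition pairing (x : X) (y : char_group) : R[i] := val y x.

Let charP (y : char_group) : is_character (val y).
Proof. exact: set_mem (valP y). Qed.

Let char_neq0 (y : char_group) x : val y x != 0.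
Proof.
by case: (charP y) => _ /(_ x) y1 _; rewrite -normr_eq0 y1 oner_neq0.
Qed.

Let char1_subproof : is_character (fun=> 1).
Proof.
by split=> [x|x|x y]; [exact: cvg_cst|exact: normr1|rewrite mulr1].
Qed.

Let charM_subproof (u v : char_group) :
  is_character (fun x => val u x * val v x).
Proof.
have [uc u1 uM] := charP u; have [vc v1 vM] := charP v; split=> [x|x|x y].
- exact: (@cvgM R[i] X (nbhs x) _ (val u) (val v) _ _ (uc x) (vc x)).
- by rewrite normrM u1 v1 mulr1.
- by rewrite uM vM mulrACA.
Qed.

Let charV_subproof (u : char_group) : is_character (fun x => (val u x)^-1).
Proof.
have [uc u1 uM] := charP u; split=> [x|x|x y].
- exact: (@cvgV R[i] X (nbhs x) _ (val u) _ (char_neq0 u x) (uc x)).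
- by rewrite normfV u1 invr1.
- by rewrite uM invfM.
Qed.

Let char_zero : char_group := exist (fun f => f \in is_character) _ (mem_set char1_subproof).
Let char_add (u v : char_group) : char_group :=
  exist (fun f => f \in is_character) _ (mem_set (charM_subproof u v)).
Let char_opp (u : char_group) : char_group :=
  exist (fun f => f \in is_character) _ (mem_set (charV_subproof u)).

Let char_addA : associative char_add.
Proof. by move=> u v w; apply/val_inj/funext => x /=; exact: mulrA. Qed.
Let char_addC : commutative char_add.
Proof. by move=> u v; apply/val_inj/funext => x /=; exact: mulrC. Qed.
Let char_add0 : left_id char_zero char_add.
Proof. by move=> u; apply/val_inj/funext => x /=; exact: mul1r. Qed.
Let char_addN : left_inverse char_zero char_opp char_add.
Proof. by move=> u; apply/val_inj/funext => x /=; exact: (mulVf (char_neq0 u x)). Qed.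

HB.instance Definition _ :=
  GRing.isZmodule.Build char_group char_addA char_addC char_add0 char_addN.

End CharacterGroup.

(* The Borel sigma-algebra is attached to an alias of [X]. *)
Definition borel (X : topologicalZmodType) : Type := X.

HB.instance Definition _ (X : topologicalZmodType) :=
  TopologicalZmodule.on (borel X).
HB.instance Definition _ (X : topologicalZmodType) :=
  isPointed.Build (borel X) 0.
HB.instance Definition _ (X : topologicalZmodType) :=
  @isMeasurable.Build (sigma_display (@open X)) (borel X) <<s @open X >>
    (@sigma_algebra0 _ setT _) (@sigma_algebraC (borel X) (@open X))
    (@sigma_algebra_bigcup _ setT _).

Section Distributions.
Variables (R : realType) (X : topologicalZmodType).
Implicit Types mu nu : probability (borel X) R.

(* [pushforward] is applied without a measurability proof; addition is
   measurable for the product sigma-algebra when [X] is second countable.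
   Unfolding, the value at [A] is the integral of [nu (A - x)] in [mu(dx)]. *)
Definition convolution mu nu : set (borel X) -> \bar R :=
  pushforward (mu \x nu)%E (fun z : borel X * borel X => z.1 + z.2).

Definition char_function mu (y : char_group R X) : R[i] :=
  Complex (\int[mu]_x complex.Re (@pairing R X x y))
          (\int[mu]_x complex.Im (@pairing R X x y)).

Definition Gaussian : set (probability (borel X) R) :=
  [set mu | exists (x : X) (phi : char_group R X -> R),
    [/\ continuous phi, forall y, 0 <= phi y,
        forall u v, phi (u + v) + phi (u - v) = 2 * phi u + 2 * phi v
      & forall y, char_function mu y = pairing x y * (expR (- phi y))%:C%C]].

(* The normalized Haar measure of the compact subgroup [H], viewed on [X]: it
   is carried by [H] and invariant under the translations of [H]. *)
Definition is_haar (H : set X) (m : probability (borel X) R) : Prop :=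
  m H = 1%E /\
  forall (h : X) (A : set X), H h -> A `<=` H ->
    measurable (A : set (borel X)) -> m ((fun x => h + x) @` A) = m A.

(* I(X): the convolutions of m_H and E_x. *)
Definition shifted_haar : set (probability (borel X) R) :=
  [set nu | exists (H : set X) (m : probability (borel X) R) (x : borel X),
    [/\ compact H, H 0 /\ (forall a b, H a -> H b -> H (a - b)), is_haar H m
      & forall A, measurable A -> nu A = convolution m (dirac x) A]].

Definition Gaussian_conv_shifted_haar : set (probability (borel X) R) :=
  [set mu | exists2 gamma, Gaussian gamma & exists2 nu, shifted_haar nu &
    forall A, measurable A -> mu A = convolution gamma nu A].

End Distributions.

Definition mutually_independent d d' (T : measurableType d)
    (U : measurableType d') (R : realType) (P : probability T R) (n : nat)
    (xi : 'I_n -> T -> U) : Prop :=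
  forall (J : {set 'I_n}) (A : 'I_n -> set U), (forall i, measurable (A i)) ->
    P (\bigcap_(i in [set` J]) (xi i @^-1` A i)) =
    (\prod_(i in J) P (xi i @^-1` A i))%E.

(* Main.v *)
Require Import Defs.
From HB Require Import structures.
From mathcomp Require Import all_boot all_order all_algebra.
From mathcomp Require Import fingroup cyclic generic_quotient ring_quotient.
From mathcomp Require Import all_classical all_reals all_analysis.
From mathcomp Require Import complex ring lra.

Set Implicit Arguments.
Unset Strict Implicit.
Unset Printing Implicit Defensive.

Import Order.TTheory GRing.Theory Num.Theory.
Import numFieldNormedType.Exports.

Local Open Scope classical_set_scope.
Local Open Scope ring_scope.

(** A compact totally disconnected abelian group [X] with a countable basis has a
    decreasing sequence of open subgroups that is a neighbourhood basis at zero
    ([van_dantzig], [exists_open_chain]). The quotients by these subgroups are finite,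
    so that homomorphisms, closed sets and laws on [X] are controlled by finite data
    and limits.

    From the characterization to the product form. Fix a prime [p]. A closed direct
    factor of [X] that is not divisible by [p] has a direct factor of its own that is
    cyclic of order [p ^ k] or isomorphic to the [p]-adic integers
    ([free_cyclic_factor]). Either finitely many such steps reach a factor that [p]
    divides, or there are infinitely many independent cyclic factors with
    non-decreasing exponents ([splitting_dichotomy]). If the first case holds for all
    primes, the parts split off at the single primes give a homomorphism from [X] to a
    product of the required form. It is injective, since an element divisible by all
    prime powers is zero in every finite quotient, and surjective, since every element
    has a [p]-component ([finite_rank_structure]).

    In the second case the characterization fails. The generators of the factors can be
    replaced by generators [d i] that tend to zero ([free_cyclic_system_null]). Moving
    each [d i.+1] to [d i] is then a continuous operation, and it yields an
    automorphism [alpha] for which [id - alpha] maps the closed subgroup generated by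
    the [d i] with [0 < i] onto the one generated by all of them, although [d 0] is
    fixed by [alpha] ([shift_data_exists]). Consider independent variables, all uniform
    on the large subgroup except for the first one, which is uniform on the small
    subgroup up to a shift by [d 0] that occurs with probability [p ^ -2]. With
    coefficients [alpha] on the diagonal outside of the first variable and the identity
    elsewhere, every shift of a single form by the large subgroup comes from a shift of
    the variables. Hence the forms are independent ([shift_independent]). A Gaussian law
    is degenerate on characters of finite order ([gaussian_degenerate]), so a law of the
    class gives mass 0, 1 or [1 / p] to the fibres of a character of order [p], whereas
    the first variable is shifted with probability [p ^ -2] ([counterexample]).

    From the product form to the characterization. In the product all subgroups of
    multiples of a positive integer are open ([mulrn_open]). The multiples of factorials
    are thus a chain of open subgroups that every automorphism preserves, and the problem
    descends to finite quotients. There every form has point masses bounded by the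
    maximal mass of each single variable, because the variable absorbs the value of the
    form. Independence compares the product of the masses of the variables with the product
    of those of the forms, so the bound is attained. The case of equality forces all
    variables to be uniform on cosets ([uniform_support]). In the limit the variables are
    translates of Haar laws ([coset_uniform_law]), with a point mass as the Gaussian
    factor. *)

(** * Equalities in abelian groups *)

(** Decision of equalities in abelian groups: both sides are compared through
    their integer coefficients. *)
Inductive zexp := ZVar of nat | ZZero | ZAdd of zexp & zexp | ZOpp of zexp.

Fixpoint zcoef (e : zexp) (i : nat) : int :=
  match e with
  | ZVar j => (i == j)%:Z
  | ZZero => 0
  | ZAdd a b => zcoef a i + zcoef b i
  | ZOpp a => - zcoef a i
  end.

Fixpoint zeval (X : zmodType) (env : seq X) (e : zexp) : X :=
  match e with
  | ZVar j => env`_j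
  | ZZero => 0
  | ZAdd a b => zeval env a + zeval env b
  | ZOpp a => - zeval env a
  end.

Lemma zevalE (X : zmodType) (env : seq X) e :
  zeval env e = \sum_(i < size env) env`_i *~ zcoef e i.
Proof.
elim: e => [j||a IHa b IHb|a IHa] /=.
- have [jn|nj] := ltnP j (size env); last first.
    rewrite nth_default// big1// => i _.
    by rewrite (_ : (i == j :> nat) = false)// ltn_eqF// (leq_trans (ltn_ord i)).
  rewrite (bigD1 (Ordinal jn))//= eqxx big1 ?addr0// => i ij.
  by rewrite (_ : (i == j :> nat) = false)//; apply/negbTE.
- by rewrite big1// => i _; rewrite mulr0z.
- by rewrite IHa IHb -big_split; apply: eq_bigr => i _; rewrite mulrzDr.
- by rewrite IHa -sumrN; apply: eq_bigr => i _; rewrite mulrNz.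
Qed.

Lemma zexp_eq (X : zmodType) (env : seq X) e1 e2 :
  all (fun i => zcoef e1 i == zcoef e2 i) (iota 0 (size env)) ->
  zeval env e1 = zeval env e2.
Proof.
move=> /allP h; rewrite !zevalE; apply: eq_bigr => i _; congr (_ *~ _).
by apply/eqP/h; rewrite mem_iota/=.
Qed.

Ltac zlookup x env :=
  lazymatch env with
  | x :: _ => constr:(0%N)
  | _ :: ?e => let n := zlookup x e in constr:(S n)
  end.

Ltac zinsert x env :=
  match env with
  | _ => let n := zlookup x env in env
  | _ => constr:(x :: env)
  end.

Ltac zatoms t env :=
  lazymatch t with
  | @Algebra.add _ ?a ?b => let e := zatoms a env in zatoms b e
  | @Algebra.opp _ ?a => zatoms a env
  | @Algebra.zero _ => env
  | _ => zinsert t env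
  end.

Ltac zreify t env :=
  lazymatch t with
  | @Algebra.add _ ?a ?b =>
    let x := zreify a env in let y := zreify b env in constr:(ZAdd x y)
  | @Algebra.opp _ ?a => let x := zreify a env in constr:(ZOpp x)
  | @Algebra.zero _ => constr:(ZZero)
  | _ => let n := zlookup t env in constr:(ZVar n)
  end.

Ltac zmod :=
  lazymatch goal with
  | |- @eq ?T ?a ?b =>
    let env := zatoms a (@nil T) in
    let env := zatoms b env in
    let x := zreify a env in
    let y := zreify b env in
    exact: (@zexp_eq _ env x y isT)
  end.

(** * Totally disconnected compact spaces *)

Lemma normal_separation (T : topologicalType) (A B : set T) :
  hausdorff_space T -> compact [set: T] -> closed A -> closed B ->
  A `&` B = set0 ->
  exists U V, [/\ open U, open V, A `<=` U, B `<=` V & U `&` V = set0].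
Proof.
move=> hT cT cA cB AB.
have /(_ A cA (~` B)) [] := @compact_normal T hT cT.
  move=> x Ax; apply: open_nbhs_nbhs; split; first exact: closed_openC.
  by move=> Bx; suff : set0 x by []; rewrite -AB.
move=> C AC CB; exists C°, (~` closure C); split.
- exact: open_interior.
- by apply: closed_openC; exact: closed_closure.
- by move=> x Ax; exact: AC.
- by move=> x Bx /CB.
- by rewrite -subset0 => x [/interior_subset/subset_closure].
Qed.

(** Compactness makes the intersection [Q] of the clopen neighbourhoods of a point
    connected: a separation of [Q] extends to disjoint open sets by normality,
    some clopen neighbourhood already lies in their union, and the half of it
    that contains the point is again clopen. Hence [Q] is a singleton. *)
Lemma totally_disconnected_zero_dimensional (T : topologicalType) :
  hausdorff_space T -> compact [set: T] -> totally_disconnected [set: T] ->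
  zero_dimensional T.
Proof.
move=> hT cT tT x y xy; apply: contrapT => nsep.
pose C := [set D : set T | D x /\ clopen D].
pose Q := \bigcap_(D in C) D.
have Qy : Q y.
  by move=> D [Dx cD]; apply: contrapT => Dy; apply: nsep; exists D.
have Qx : Q x by move=> D [].
have Qcl : closed Q by apply: closed_bigI => D [_ []].
suff Qc : connected Q.
  have : connected_component [set: T] x y by exists Q.
  by rewrite tT // => /esym/eqP; apply/negP.
apply: contrapT => /connectedPn[E [En QE [s1 s2]]].
have EQ b : E b `<=` Q by move=> z Ez; rewrite QE; case: b Ez; [right|left].
have Ecl b : closed (E b).
  move=> z zc; have : Q z by apply: Qcl; apply: closureS zc; exact: EQ.
  rewrite QE => -[] Ez.
  - case: b zc => // zc; suff : set0 z by [].
    by rewrite -s2; split.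
  - case: b zc => // zc; suff : set0 z by [].
    by rewrite -s1; split.
have E0 : E false `&` E true = set0.
  by rewrite -subset0 -s2 => z [a b]; split=> //; exact: subset_closure.
have [U [V [oU oV EU EV UV]]] := normal_separation hT cT (Ecl false) (Ecl true) E0.
(* Otherwise the traces of the clopen neighbourhoods outside [U `|` V] have a
   cluster point, and it lies in [Q]. *)
have [D [CD DUV]] : exists D, C D /\ D `<=` U `|` V.
  apply: contrapT => nD.
  pose F := filter_from C (fun D => D `\` (U `|` V)).
  have FF : ProperFilter F.
    apply: filter_from_proper; last first.
      move=> D CD; apply: contrapT => Dn; apply: nD; exists D; split=> // z Dz.
      by apply: contrapT => nz; apply: Dn; exists z.
    apply: filter_from_filter; first by exists setT; split=> //; exact: clopenT.
    move=> A B [Ax cA] [Bx cB]; exists (A `&` B).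
      by split; [split|exact: clopenI].
    by move=> z [[Az Bz] nz]; split; split.
  have [z [_ zF]] := cT F FF filterT.
  have zn : ~ (U `|` V) z.
    move=> zUV; have [] := zF (~` (U `|` V)) (U `|` V).
    - by exists setT; [split=> //; exact: clopenT|move=> w []].
    - by apply: open_nbhs_nbhs; split=> //; exact: openU.
    - by move=> w [].
  apply: zn; have : Q z.
    move=> D [Dx [oD cD]]; apply: (cD) => B Bz.
    apply: (zF D B) => //; exists D; last by move=> w [].
    by split; [|split].
  by rewrite QE => -[/EU|/EV]; [left|right].
have [Dx [oD cD]] := CD.
have main W W' b : open W -> open W' -> E b `<=` W -> E (~~ b) `<=` W' ->
    W `&` W' = set0 -> D `<=` W `|` W' -> W x -> False.
  move=> oW oW' EW EW' WW' DW Wx; have [z Ez] := En (~~ b).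
  have CDW : C (D `&` W).
    split; first by [].
    split; first by exact: openI.
    rewrite (_ : D `&` W = D `&` ~` W').
      by apply: closedI => //; exact: open_closedC.
    apply/seteqP; split=> w [Dw Ww]; split=> //.
      by move=> Ww'; suff : set0 w by []; rewrite -WW'.
    by case: (DW _ Dw).
  have /(_ _ CDW)[_ Wz] := EQ _ _ Ez.
  by suff : set0 z by []; rewrite -WW'; split=> //; exact: EW'.
have : (U `|` V) x by exact: DUV.
case=> Wx; first exact: (main U V false).
by apply: (main V U true) => //; rewrite 1?setIC 1?setUC.
Qed.

(** * Subgroups of topological abelian groups *)

Section Group.
Variable X : topologicalZmodType.
Implicit Types (x y : X) (A H V : set X).

Definition subgroup H := H 0 /\ forall a b, H a -> H b -> H (a - b).

Lemma subgroupN H a : subgroup H -> H a -> H (- a).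
Proof. by move=> [H0 HB] Ha; rewrite -sub0r; exact: HB. Qed.

Lemma subgroupD H a b : subgroup H -> H a -> H b -> H (a + b).
Proof.
by move=> sH Ha Hb; rewrite -[b]opprK; apply: sH.2 => //; exact: subgroupN.
Qed.

Lemma subgroupMn H a k : subgroup H -> H a -> H (a *+ k).
Proof.
move=> sH Ha; elim: k => [|k IH]; first by rewrite mulr0n; exact: sH.1.
by rewrite mulrS; exact: subgroupD.
Qed.

Lemma subgroupMz H a (k : int) : subgroup H -> H a -> H (a *~ k).
Proof.
by move=> sH Ha; case: k => k; [|apply: subgroupN => //]; exact: subgroupMn.
Qed.

Lemma subgroup_sum H I (r : seq I) (P : pred I) F :
  subgroup H -> (forall i, P i -> H (F i)) -> H (\sum_(i <- r | P i) F i).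
Proof.
by move=> sH HF; elim/big_rec: _ => [|i x Pi Hx]; [exact: sH.1|apply: subgroupD => //; exact: HF].
Qed.

Lemma add_continuousl x : continuous (fun y => x + y).
Proof.
move=> y; apply: (@continuous_comp _ _ _ (fun y => (x, y)) (fun z => z.1 + z.2)).
  by apply: cvg_pair => /=; [exact: cvg_cst|exact: cvg_id].
exact: add_continuous.
Qed.

Lemma nbhs_translate x A : nbhs x A <-> nbhs 0 [set u | A (x + u)].
Proof.
split=> [nA|n0].
  have : nbhs (x + 0) A by rewrite addr0.
  exact: (@add_continuousl x 0 A).
have : nbhs (- x + x) [set u | A (x + u)] by rewrite addrC subrr.
move/(@add_continuousl (- x) x) => h.
apply: (@filterS _ (nbhs x) _ _ _ _ h) => y /=.
by rewrite addrA subrr add0r.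
Qed.

Lemma open_subgroup V : subgroup V -> nbhs 0 V -> open V.
Proof.
move=> sV nV; rewrite openE => x Vx; apply/nbhs_translate.
by apply: filterS nV => u Vu; exact: subgroupD.
Qed.

Lemma open_subgroup_nbhs V x : subgroup V -> open V -> nbhs x [set y | V (y - x)].
Proof.
move=> sV oV; apply/nbhs_translate; rewrite /= (_ : mkset _ = V).
  by apply: open_nbhs_nbhs; split=> //; exact: sV.1.
by apply/seteqP; split=> u /=; rewrite addrAC subrr add0r.
Qed.

Lemma open_subgroup_closed V : subgroup V -> open V -> closed V.
Proof.
move=> sV oV x /(_ _ (open_subgroup_nbhs x sV oV))[y [Vy Vyx]].
by rewrite -(subKr y x); exact: sV.2.
Qed.

Lemma coset_clopen V x : subgroup V -> open V -> clopen [set y | V (y - x)].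
Proof.
move=> sV oV.
have c : continuous (fun y => y - x).
  by move=> y; under eq_fun do rewrite addrC; exact: add_continuousl.
apply: (@preimage_clopen X X (fun y => y - x)) => //.
by split=> //; exact: open_subgroup_closed.
Qed.

Lemma totally_disconnected_hausdorff :
  totally_disconnected [set: X] -> hausdorff_space X.
Proof.
move=> tX x y xy; apply: contrapT => /eqP nxy.
have c0 : closed [set (0 : X)].
  by rewrite -(tX 0)//; apply: component_closed; exact: closedT.
have : nbhs (x - y) (~` [set (0 : X)]).
  apply: open_nbhs_nbhs; split; first exact: closed_openC.
  by move=> /= /eqP; rewrite subr_eq0; exact/negP.
move=> /(@sub_continuous X (x, y)) [[A B] /= [nA nB] AB].
by have [z [Az Bz]] := xy A B nA nB; apply: (AB (z, z)) => //=; rewrite subrr.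
Qed.

(** A clopen neighbourhood [W] of zero is a union of cosets of its stabilizer
    [V], which is an open subgroup: compactness of [W] turns the continuity of
    addition at the points of [W] into one neighbourhood of zero that
    translates [W] into itself. *)
Lemma van_dantzig O : compact [set: X] -> totally_disconnected [set: X] ->
  nbhs 0 O -> exists V, [/\ subgroup V, open V & V `<=` O].
Proof.
move=> cX tX nO; have hX := totally_disconnected_hausdorff tX.
have zX := totally_disconnected_zero_dimensional hX cX tX.
have [W [W0 [oW cW]] WO] := zero_dimensional_cvg hX zX cX nO.
pose V := [set v | forall w, W w <-> W (w + v)].
have sV : subgroup V.
  split=> [w|a b Va Vb w]; first by rewrite addr0.
  rewrite addrA; split=> [/Va Wa|Ww]; first by apply: (Vb _).2; rewrite subrK.
  by apply: (Va _).2; rewrite -(subrK b (w + a)); exact: (Vb _).1.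
have nV : nbhs 0 V.
  have H (B : set X) : open B -> compact B -> nbhs 0 [set v | forall w, B w -> B (w + v)].
    move=> oB /compact_near_coveringP; apply => w Bw.
    have : nbhs (w + 0) B by rewrite addr0; apply: open_nbhs_nbhs.
    move/(@add_continuous X (w, 0)) => [[C D] /= [nC nD] CD].
    by exists (C, D) => // -[a b] /= ab u; exact: (CD (a, b)).
  have := H _ oW (subclosed_compact cW cX (@subsetT _ W)).
  have oW' : open (~` W) by exact: closed_openC.
  have cW' : closed (~` W) by exact: open_closedC.
  have := H _ oW' (subclosed_compact cW' cX (@subsetT _ _)).
  apply: filterS2 => v h1 h2 w; split; first exact: h2.
  by move=> Wv; apply: contrapT => nW; exact: (h1 w nW).
exists V; split=> //; first exact: open_subgroup.
by move=> v Vv; apply: WO; have /Vv := W0; rewrite add0r.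
Qed.

End Group.

(** * Finite quotients *)

Lemma nested_closed (T : topologicalType) (F : nat -> set T) :
  compact [set: T] -> (forall k, closed (F k)) -> (forall k, F k !=set0) ->
  (forall j k, (j <= k)%N -> F k `<=` F j) -> exists x, forall k, F k x.
Proof.
move=> cT cF nF sF.
pose G := filter_from setT F.
have GF : ProperFilter G.
  apply: filter_from_proper => [|k _]; last exact: nF.
  apply: filter_from_filter; first by exists 0%N.
  move=> i j _ _; exists (maxn i j) => // x Fx; split.
    exact: sF (leq_maxl i j) _ Fx.
  exact: sF (leq_maxr i j) _ Fx.
have [x [_ Gx]] := cT G GF filterT.
exists x => k; apply: cF => B Bx; apply: Gx => //; by exists k.
Qed.

(** Cosets of an open subgroup form an open cover. *)
Lemma finite_cosets (X : topologicalZmodType) (V : set X) :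
  compact [set: X] -> subgroup V -> open V ->
  exists s : seq X, forall x, exists2 y, y \in s & V (x - y).
Proof.
move=> cX sV oV.
have : cover_compact [set: borel X].
  by have := cX; rewrite -(@compact_cover (borel X)).
move=> /(_ X setT (fun y => [set x | V (x - y)])) [].
- by move=> y _; case: (@coset_clopen X V y sV oV).
- by move=> x _; exists x => //=; rewrite subrr; exact: sV.1.
- move=> D _ cD; exists (finmap.enum_fset D) => x; have [y /= Dy Vxy] := cD x I.
  by exists y.
Qed.

Section FiniteQuotient.
Local Open Scope quotient_scope.
Variables (X : zmodType) (V : set X).
Let P : {pred X} := fun x => x \in V.
Hypothesis V_closed : zmod_closed P.
Let VC : zmodClosed X := HB.pack P (GRing.isZmodClosed.Build X P V_closed).
Let Q := Quotient.quot VC.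
Variable s : seq X.
Hypothesis sP : forall x, exists2 y, y \in s & V (x - y).

Let q (x : X) : Q := \pi_(Q) x.

Let Q_enum (x : Q) : x \in [seq q y | y <- s].
Proof.
rewrite -[x]reprK; have [y ys Vxy] := sP (repr x).
apply/mapP; exists y => //; apply/eqP.
by rewrite /q -(@Quotient.idealrBE X VC); apply/mem_set.
Qed.

Let enumQ := undup [seq q y | y <- s].
Let Q_axiom : Finite.axiom enumQ.
Proof. by apply: Finite.uniq_enumP; [exact: undup_uniq|move=> x; rewrite mem_undup Q_enum]. Qed.

Let pickle (x : Q) := index x enumQ.
Let unpickle n : option Q := ohead (drop n enumQ).
Let pickleK : pcancel pickle unpickle.
Proof.
move=> x; rewrite /pickle /unpickle.
have xe : x \in enumQ by rewrite mem_undup Q_enum.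
by rewrite (drop_nth x) ?index_mem //= nth_index.
Qed.

(** The classes of representatives of the cosets enumerate the quotient. *)
Lemma finite_quotient_subproof : exists (G : finZmodType) (f : X -> G),
  [/\ zmod_morphism f, forall g, exists x, f x = g & forall x, f x = 0 <-> V x].
Proof.
pose G : finZmodType := HB.pack_for finZmodType Q
  (GRing.Zmodule.class (Quotient.quot VC))
  (isCountable.Build Q pickleK) (fintype.isFinite.Build Q Q_axiom).
exists G, q; split.
- by move=> x y; rewrite /q !piE.
- by move=> g; exists (repr g); rewrite /q reprK.
- move=> x; rewrite (_ : (0 : G) = q 0); last by rewrite /q !piE.
  split=> [/eqP|Vx]; first by rewrite /q -(@Quotient.idealrBE X VC) subr0 => /set_mem.
  by apply/eqP; rewrite /q -(@Quotient.idealrBE X VC) subr0; apply/mem_set.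
Qed.

End FiniteQuotient.

Lemma finite_quotient (X : topologicalZmodType) (V : set X) :
  compact [set: X] -> subgroup V -> open V ->
  exists (G : finZmodType) (f : X -> G),
  [/\ zmod_morphism f, forall g, exists x, f x = g & forall x, f x = 0 <-> V x].
Proof.
move=> cX sV oV; have [s sP] := finite_cosets cX sV oV.
apply: (finite_quotient_subproof _ sP); split.
  by apply/mem_set; exact: sV.1.
by move=> a b /set_mem Va /set_mem Vb; apply/mem_set; exact: sV.2.
Qed.

(** * Chains of open subgroups and homomorphisms *)

Section Chains.
Variable X : topologicalZmodType.
Implicit Types (x y : X) (V : nat -> set X).

(** A countable neighbourhood basis at zero made of a decreasing sequence of open
    subgroups. Limits, closures and measures on [X] are controlled through it. *)
Definition open_chain V := [/\ forall k, subgroup (V k), forall k, open (V k),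
  forall j k, (j <= k)%N -> V k `<=` V j
  & forall O : set X, nbhs 0 O -> exists k, V k `<=` O].

Lemma open_chain_meet (W : nat -> set X) :
  (forall k, subgroup (W k)) -> (forall k, open (W k)) ->
  (forall O : set X, nbhs 0 O -> exists k, W k `<=` O) ->
  open_chain (fun k => [set x | forall i, (i <= k)%N -> W i x]).
Proof.
move=> sW oW bW.
have sV k : subgroup [set x | forall i, (i <= k)%N -> W i x].
  split=> [i _|a b Ha Hb i ik]; first exact: (sW i).1.
  by apply: (sW i).2; [exact: Ha|exact: Hb].
split=> //.
- move=> k; apply: open_subgroup => //; elim: k => [|k IH].
    have : nbhs 0 (W 0%N) by apply: open_nbhs_nbhs; split=> //; exact: (sW _).1.
    by apply: filterS => x Wx i; rewrite leqn0 => /eqP ->.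
  have : nbhs 0 (W k.+1) by apply: open_nbhs_nbhs; split=> //; exact: (sW _).1.
  move: IH; apply: filterS2 => x /= IH Wx i.
  by rewrite leq_eqVlt => /orP[/eqP -> //|]; exact: IH.
- by move=> j k jk x /= Wx i ij; apply: Wx; exact: leq_trans jk.
- by move=> O /bW[k WO]; exists k => x /= Wx; apply: WO; exact: Wx.
Qed.

(** Each member of a countable basis that contains zero contains an open subgroup;
    finite intersections of these make the sequence decreasing. *)
Lemma exists_open_chain : @second_countable X -> compact [set: X] ->
  totally_disconnected [set: X] -> exists V, open_chain V.
Proof.
move=> [B /countable_injP[f fI] [oB bB]] cX tX.
have /choice[W WP] i : exists W : set X, [/\ subgroup W, open W
    & forall b, B b -> f b = i -> b 0 -> W `<=` b].
  have [[b [Bb fb b0]]|nb] := pselect (exists b, [/\ B b, f b = i & b 0]).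
    have : nbhs 0 b by apply: open_nbhs_nbhs; split=> //; exact: oB.
    move=> /(van_dantzig cX tX)[W [sW oW Wb]]; exists W; split=> // b' Bb' fb' _.
    by have -> : b' = b by apply: fI; rewrite ?inE// fb fb'.
  exists setT; split=> //; first exact: openT.
  by move=> b Bb fb b0; exfalso; apply: nb; exists b.
exists (fun k => [set x | forall i, (i <= k)%N -> W i x]).
apply: open_chain_meet => [k|k|O]; [by case: (WP k)|by case: (WP k)|].
move=> /bB[b [Bb b0] bO]; exists (f b).
by case: (WP (f b)) => _ _ /(_ b Bb erefl b0) Wb; exact: subset_trans bO.
Qed.

Variable V : nat -> set X.
Hypothesis V_chain : open_chain V.

Let sV k : subgroup (V k). Proof. by case: V_chain. Qed.
Let oV k : open (V k). Proof. by case: V_chain. Qed.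

Lemma chain_eq0 x : hausdorff_space X -> (forall k, V k x) -> x = 0.
Proof.
move=> hX Vx; apply/esym/hX => A B nA nB; exists x; split; last exact: nbhs_singleton.
by case: V_chain => _ _ _ /(_ _ nA)[k]; exact.
Qed.

Lemma chain_closedP (F : set X) x : closed F ->
  (forall k, exists2 y, F y & V k (y - x)) -> F x.
Proof.
move=> cF Fx; apply: cF => B /nbhs_translate n0.
case: V_chain => _ _ _ /(_ _ n0)[k VB]; have [y Fy Vyx] := Fx k.
by exists y; split=> //; have := VB _ Vyx; rewrite /= addrC subrK.
Qed.

Lemma chain_closureP (F : set X) x : closure F x <->
  (forall k, exists2 y, F y & V k (y - x)).
Proof.
split=> [Fx k|Fx].
  by have [y [Fy Vy]] := Fx _ (open_subgroup_nbhs x (sV k) (oV k)); exists y.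
apply: (chain_closedP (@closed_closure _ F)) => k.
by have [y Fy Vy] := Fx k; exists y => //; exact: subset_closure.
Qed.

End Chains.

Section Homs.
Variables (X Z : zmodType) (f : X -> Z).
Hypothesis fB : zmod_morphism f.

Lemma hom0 : f 0 = 0.
Proof. by rewrite -(subrr 0) fB subrr. Qed.

Lemma homN x : f (- x) = - f x.
Proof. by rewrite -sub0r fB hom0 sub0r. Qed.

Lemma homD x y : f (x + y) = f x + f y.
Proof. by rewrite -[in LHS](opprK y) fB homN opprK. Qed.

Lemma homMn x k : f (x *+ k) = f x *+ k.
Proof. by elim: k => [|k IH]; rewrite ?mulr0n ?hom0// !mulrS homD IH. Qed.

Lemma homMz x (k : int) : f (x *~ k) = f x *~ k.
Proof. by case: k => k; rewrite /= ?homN homMn. Qed.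

Lemma hom_sum I (r : seq I) (P : pred I) F :
  f (\sum_(i <- r | P i) F i) = \sum_(i <- r | P i) f (F i).
Proof. by apply: (big_morph f homD hom0). Qed.

End Homs.

Section ContinuousHoms.
Variables (X Z : topologicalZmodType) (f : X -> Z).
Hypothesis fB : zmod_morphism f.

(** For homomorphisms continuity at zero suffices. *)
Lemma hom_continuous (W : nat -> set Z) : open_chain W ->
  (forall k, exists2 V, nbhs 0 V & forall x, V x -> W k (f x)) -> continuous f.
Proof.
move=> [_ _ _ bW] f0 x A /nbhs_translate/bW[k WA].
have [V nV Vf] := f0 k; apply/nbhs_translate; apply: filterS nV => u /Vf Wu.
by rewrite /= homD//; exact: WA.
Qed.

Lemma hom_continuous_nbhs (O : set Z) :
  continuous f -> nbhs 0 O -> nbhs 0 (f @^-1` O).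
Proof. by move=> fc; rewrite -(hom0 fB) => /fc. Qed.

End ContinuousHoms.

Lemma subgroup_image (X Z : zmodType) (f : X -> Z) (H : set X) :
  zmod_morphism f -> H 0 /\ (forall a b, H a -> H b -> H (a - b)) ->
  (f @` H) 0 /\ (forall a b, (f @` H) a -> (f @` H) b -> (f @` H) (a - b)).
Proof.
move=> fB [H0 HB]; split; first by exists 0; rewrite ?(hom0 fB).
by move=> _ _ [a Ha <-] [b Hb <-]; exists (a - b); [exact: HB|exact: fB].
Qed.

(** * Extension of homomorphisms and cyclic complements *)

Definition profinite (X : topologicalZmodType) : Prop :=
  [/\ compact [set: X], hausdorff_space X & exists V : nat -> set X, open_chain V].

Lemma bezout_subgroup (X : topologicalZmodType) (U : set X) (x : X) (a b : int) :
  subgroup U -> U (x *~ a) -> U (x *~ b) -> U (x *~ gcdz a b).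
Proof.
move=> sU Ua Ub; have [u [v <-]] := Bezoutz a b.
rewrite mulrzDr; apply: subgroupD => //.
  by rewrite mulrC mulrzA; exact: subgroupMz.
by rewrite mulrC mulrzA; exact: subgroupMz.
Qed.

Section Extension.
Variables (X Z : topologicalZmodType) (W : nat -> set Z).
Hypothesis cZ : compact [set: Z].
Hypothesis hZ : hausdorff_space Z.
Hypothesis W_chain : open_chain W.
Variables (c : X) (d : Z) (K : nat -> set X).
Hypothesis sK : forall j, subgroup (K j).
Hypothesis oK : forall j, open (K j).
Hypothesis K_dec : forall i j, (i <= j)%N -> K j `<=` K i.
Hypothesis K_gen : forall j x, exists a : int, K j (x - c *~ a).
Hypothesis K_d : forall i, exists j, forall a : int, K j (c *~ a) -> W i (d *~ a).

Let sW i : subgroup (W i). Proof. by case: W_chain. Qed.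

(** The graph of the extension: [z] is approximated by the multiples [d *~ a] for
    which [c *~ a] approximates [x]. Compactness of [Z] gives existence of [z],
    and [K_d] gives uniqueness. *)
Let rel (x : X) (z : Z) := forall i, exists j, forall a : int,
  K j (x - c *~ a) -> W i (z - d *~ a).

Let rel_ex x : exists z, rel x z.
Proof.
pose F j := closure [set d *~ a | a in [set a : int | K j (x - c *~ a)]].
have [z Fz] : exists z, forall j, F j z.
  apply: nested_closed => //.
  - by move=> j; exact: closed_closure.
  - move=> j; have [a Ka] := K_gen j x; exists (d *~ a).
    by apply: subset_closure; exists a.
  - move=> i j ij; apply: closureS => _ [a Ka <-]; exists a => //=.
    exact: K_dec Ka.
exists z => i; have [j Kd] := K_d i; exists j => a Ka.
have /(chain_closureP W_chain) /(_ i)[_ [b Kb <-] Wb] := Fz j.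
have : W i (d *~ (b - a)).
  apply: Kd; rewrite mulrzBr (_ : _ - _ = (x - c *~ a) - (x - c *~ b)); last zmod.
  exact: (sK j).2.
rewrite mulrzBr => Wba.
rewrite (_ : z - _ = (d *~ b - d *~ a) - (d *~ b - z)); last zmod.
exact: (sW i).2.
Qed.

Let relB x y z t : rel x z -> rel y t -> rel (x - y) (z - t).
Proof.
move=> rx ry i; have [j1 h1] := rx i; have [j2 h2] := ry i; have [j3 h3] := K_d i.
pose j := maxn j1 (maxn j2 j3).
have l1 : (j1 <= j)%N by rewrite leq_maxl.
have l2 : (j2 <= j)%N by rewrite !leq_max leqnn orbT.
have l3 : (j3 <= j)%N by rewrite !leq_max leqnn !orbT.
exists j => b Kb; have [a Ka] := K_gen j x; have [a' Ka'] := K_gen j y.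
have Kab : K j (c *~ (b - (a - a'))).
  rewrite (_ : _ *~ _ = ((x - c *~ a) - (y - c *~ a')) - (x - y - c *~ b)).
    by apply: (sK j).2 => //; exact: (sK j).2.
  by rewrite !mulrzBr; zmod.
have Wab := h3 _ (K_dec l3 Kab).
have Wa := h1 _ (K_dec l1 Ka); have Wa' := h2 _ (K_dec l2 Ka').
rewrite (_ : _ - _ = ((z - d *~ a) - (t - d *~ a')) - d *~ (b - (a - a'))).
  by apply: (sW i).2 => //; exact: (sW i).2.
by rewrite !mulrzBr; zmod.
Qed.

Let rel0 x z : rel x z -> (forall j, K j x) -> z = 0.
Proof.
move=> rx Kx; apply: (chain_eq0 W_chain hZ) => i; have [j h] := rx i.
by have := h 0; rewrite !mulr0z !subr0; apply.
Qed.

(** Modulo every [K j] an element of [X] is a multiple of [c]; its image is the limit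
    of the corresponding multiples of [d]. *)
Lemma extend_hom : exists T : X -> Z, [/\ zmod_morphism T, continuous T,
  T c = d, forall x, (forall j, K j x) -> T x = 0
  & forall x, closure [set d *~ a | a in [set: int]] (T x)].
Proof.
have /choice[T TP] := rel_ex.
have uniq x z : rel x z -> T x = z.
  move=> rx; apply/eqP; rewrite -subr_eq0; apply/eqP.
  apply: (rel0 (relB (TP x) rx)) => j; rewrite subrr; exact: (sK j).1.
have TB : zmod_morphism T by move=> x y; apply: uniq; exact: relB.
exists T; split=> //.
- apply: (hom_continuous TB W_chain) => i; have [j h] := K_d i.
  exists (K j); first by apply: open_nbhs_nbhs; split=> //; exact: (sK j).1.
  move=> x Kx; have [j' h'] := TP x i.
  have [a Ka] := K_gen (maxn j j') x.
  have Wa := h' _ (K_dec (leq_maxr j j') Ka).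
  have Kja := K_dec (leq_maxl j j') Ka.
  rewrite -(subrK (d *~ a) (T x)); apply: subgroupD => //; apply: h.
  by rewrite (_ : c *~ a = x - (x - c *~ a)); [exact: (sK j).2|zmod].
- apply: uniq => i; have [j h] := K_d i; exists j => a Ka.
  have := h (1 - a); rewrite !mulrzBr !mulr1z; exact.
- by move=> x Kx; apply: rel0 Kx.
- move=> x; apply/(chain_closureP W_chain) => i; have [j h] := TP x i.
  have [a Ka] := K_gen j x; exists (d *~ a); first by exists a.
  by rewrite -opprB; apply: subgroupN => //; exact: h.
Qed.

End Extension.

Section Complement.
Variables (X : topologicalZmodType) (V : nat -> set X) (V_chain : open_chain V).
Variables (p : nat) (p_prime : prime p).

(** The order of [x] modulo [U] is exactly [p ^ k.+1]. *)
Let dvdz_subgroup (U : set X) (x : X) (k : nat) (a : int) : subgroup U ->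
  U (x *+ p ^ k.+1) -> U (x *~ a) -> ~ U (x *+ p ^ k) -> ((p ^ k.+1)%:Z %| a)%Z.
Proof.
move=> sU Up Ua nU.
have [g gE gd] : exists2 g : nat, (g%:Z = gcdz a (p ^ k.+1)%:Z) & (g %| p ^ k.+1)%N.
  by exists (gcdn `|a| (p ^ k.+1)) => //; exact: dvdn_gcdr.
have Ug : U (x *~ g%:Z) by rewrite gE; exact: bezout_subgroup.
have /(dvdn_pfactor _ _ p_prime)[j jk gj] := gd.
have [jk'|kj] := leqP j k.
  exfalso; apply: nU; rewrite -(subnK jk') addnC expnD mulrnA -gj.
  exact: subgroupMn.
have jE : j = k.+1 by apply/eqP; rewrite eqn_leq jk kj.
by rewrite -jE -gj gE; exact: dvdz_gcdl.
Qed.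

(** Maximality of [U] among the subgroups that avoid [p ^ k *: c] makes every
    non-trivial subgroup of [X / U] contain the image of [p ^ k *: c], so that
    [X / U] is cyclic and generated by [c]. *)
Lemma cyclic_complement (M : set X) (c : X) (k : nat) :
  subgroup M -> closed M -> (forall x, M (x *+ p ^ k.+1)) -> ~ M (c *+ p ^ k) ->
  exists U, [/\ subgroup U, open U, M `<=` U,
    forall x, exists a : int, U (x - c *~ a)
    & forall a : int, U (c *~ a) -> ((p ^ k.+1)%:Z %| a)%Z].
Proof.
move=> sM cM pM cpM; set e := c *+ p ^ k.
(* [M] is first enlarged to an open subgroup [M0] that still avoids [e], so that
   every subgroup that contains it is open. *)
have [i ni] : exists i, forall y, M y -> ~ V i (y - e).
  apply: contrapT => /forallNP h; apply: cpM; apply: (chain_closedP V_chain cM) => i.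
  apply: contrapT => h'; apply: (h i) => y My Vy; apply: h'; by exists y.
have [sV oV _ _] := V_chain.
pose M0 := [set x | exists2 y, M y & V i (y - x)].
have sM0 : subgroup M0.
  split; first by exists 0; [exact: sM.1|rewrite subrr; exact: (sV i).1].
  move=> a b [y My Vy] [z Mz Vz]; exists (y - z); first exact: sM.2.
  by rewrite (_ : _ - _ = (y - a) - (z - b)); [exact: (sV i).2|zmod].
have nM0 : ~ M0 e by move=> [y /ni].
have MM0 : M `<=` M0 by move=> x Mx; exists x => //; rewrite subrr; exact: (sV i).1.
have VM0 : V i `<=` M0.
  by move=> x Vx; exists 0; [exact: sM.1|rewrite sub0r; exact: subgroupN].
pose P A := subgroup (A `|` M0) /\ ~ (A `|` M0) e.
(* Unions with [M0] keep the empty chain harmless in the application of Zorn. *)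
have [A [[sU nU] maxU]] : exists A, P A /\ forall B, A `<` B -> ~ P B.
  apply: Zorn_bigcup => F FP totF.
  have inF A : F A -> A `|` M0 `<=` \bigcup_(B in F) B `|` M0.
    by move=> FA x [Ax|]; [left; exists A|right].
  have UF x : (\bigcup_(B in F) B `|` M0) x -> M0 x \/ exists2 A, F A & A x.
    by move=> [[A FA Ax]|]; [right; exists A|left].
  split; last by move=> /UF[//|[A FA Ae]]; have [_] := FP A FA; apply; left.
  split; first by right; exact: sM0.1.
  move=> a b /UF ha /UF hb.
  have [|h] := pselect (exists A, [/\ F A, (A `|` M0) a & (A `|` M0) b]).
    move=> [A [FA Aa Ab]].
    by have [[_ sA] _] := FP A FA; apply: (inF A FA); exact: sA.
  case: ha hb => [Ma|[A FA Aa]] [Mb|[B FB Bb]].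
  - by right; exact: sM0.2.
  - by exfalso; apply: h; exists B; split=> //; [right|left].
  - by exfalso; apply: h; exists A; split=> //; [left|right].
  - exfalso; apply: h; case: (totF A B FA FB) => AB.
      by exists B; split=> //; left => //; exact: AB.
    by exists A; split=> //; left => //; exact: AB.
set U := A `|` M0 in sU nU.
have MU : M0 `<=` U by move=> x; right.
have max U' : subgroup U' -> U `<=` U' -> (exists2 x, U' x & ~ U x) -> U' e.
  move=> sU' UU' [x U'x nUx]; apply: contrapT => nU'e; apply: (maxU U').
    split; first by move=> z Az; apply: UU'; left.
    by move=> h; apply: nUx; left; exact: h.
  by rewrite /P (_ : U' `|` M0 = U') //; apply/setUidPl/(subset_trans MU).
have pU x : U (x *+ p ^ k.+1) by apply/MU/MM0/pM.
have dvd x a := @dvdz_subgroup U x k a sU (pU x).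
exists U; split=> //.
- apply: open_subgroup => //; apply: filterS (subset_trans VM0 MU) _.
  by apply: open_nbhs_nbhs; split=> //; exact: (sV i).1.
- exact: subset_trans MM0 MU.
- apply: contrapT => /existsNP[x0 nx0].
  pose R x := exists a : int, U (x - c *~ a).
  (* If [c] does not generate modulo [U], some [x] outside of the subgroup [R] that
   it generates has [x *+ p] in [R]. *)
have [x [nRx Rpx]] : exists x, ~ R x /\ R (x *+ p).
    have RP : R (x0 *+ p ^ k.+1) by exists 0; rewrite mulr0z subr0.
    move: (k.+1) RP => m; elim: m => [|j IH]; first by rewrite expn0.
    rewrite expnS mulnC mulrnA => Rj.
    have [/IH //|nR] := pselect (R (x0 *+ p ^ j)).
    by exists (x0 *+ p ^ j).
  have [a Ua] := Rpx.
  have pa : (p%:Z %| a)%Z.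
    have Uap : U (e *~ a).
      have : U ((x *+ p - c *~ a) *+ p ^ k) by exact: subgroupMn.
      rewrite mulrnBl -mulrnA -expnS => Uap.
      rewrite (_ : e *~ a = x *+ p ^ k.+1 - (x *+ p ^ k.+1 - c *~ a *+ p ^ k)).
        by apply: sU.2.
      by rewrite subKr /e !pmulrn -!mulrzA mulrC.
    have := @dvdz_subgroup U e 0 a sU; rewrite expn1 expn0 mulr1n; apply=> //.
    by rewrite /e -mulrnA -expnSr.
  (* Correcting [x] by a multiple of [c] gives [y] of order [p] modulo [U]; by
   maximality the group generated by [y] and [U] contains [e], hence [e] generates
   the same group, and [y] lies in [R] after all. *)
have [b ab] := dvdzP pa.
  pose y := x - c *~ b.
  have Uy : U (y *+ p).
    by rewrite mulrnBl (_ : c *~ b *+ p = c *~ a)// ab mulrzA pmulrn.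
  have nRy : ~ R y.
    move=> [f Uf]; apply: nRx; exists (b + f).
    by rewrite mulrzDr opprD addrA.
  pose U' := [set z | exists f : int, U (z - y *~ f)].
  have sU' : subgroup U'.
    split; first by exists 0; rewrite mulr0z subr0; exact: sU.1.
    move=> u v [f Uf] [g Ug]; exists (f - g).
    rewrite mulrzBr (_ : _ - _ = (u - y *~ f) - (v - y *~ g)); last zmod.
    exact: sU.2.
  have [f Uf] : U' e.
    apply: max => //; first by move=> z Uz; exists 0; rewrite mulr0z subr0.
    exists y; first by exists 1; rewrite mulr1z subrr; exact: sU.1.
    by move=> Uy1; apply: nRy; exists 0; rewrite mulr0z subr0.
  have [pf|npf] := boolP ((p%:Z %| f)%Z).
    apply: nU; have [g fg] := dvdzP pf.
    rewrite -(subrK (y *~ f) e); apply: subgroupD => //.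
    by rewrite fg mulrC mulrzA -pmulrn; exact: subgroupMz.
  apply: nRy.
  have cop : coprimez f p%:Z.
    by rewrite coprimezE coprime_sym prime_coprime.
  have [u [v uv]] := Bezoutz f p%:Z.
  rewrite (eqP cop) in uv.
  exists ((p ^ k)%:Z * u).
  rewrite (_ : y - _ = - (e - y *~ f) *~ u + y *+ p *~ v).
    by apply: subgroupD => //; apply: subgroupMz => //; apply: subgroupN.
  have yE : y = y *~ f *~ u + y *+ p *~ v.
    by rewrite pmulrn -!mulrzA [f * u]mulrC [_ * v]mulrC -mulrzDr uv mulr1z.
  have eE : c *~ ((p ^ k)%:Z * u) = e *~ u by rewrite mulrzA /e pmulrn.
  by rewrite eE mulNrz mulrzBl {1}yE; zmod.
- move=> a Ua; exact: dvd Ua nU.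
Qed.

End Complement.

(** * Pro-p elements and free cyclic modules *)

(** The multiples [x *+ p ^ j] tend to zero: [x] lies in the pro-[p] part. *)
Definition padic_element (p : nat) (X : topologicalZmodType) (x : X) : Prop :=
  forall V, subgroup V -> open V -> exists j, V (x *+ p ^ j).

Lemma open_subgroup_index (X : topologicalZmodType) (V : set X) :
  compact [set: X] -> subgroup V -> open V ->
  exists2 m, (0 < m)%N & forall x, V (x *+ m).
Proof.
move=> cX sV oV; have [G [f [fB _ f0]]] := finite_quotient cX sV oV.
exists #|G|; first by apply/card_gt0P; exists 0.
move=> x; apply/f0; rewrite (homMn fB).
have := @order_dvdG G [set: G]%G (f x); rewrite inE cardsT => /(_ isT).
by rewrite order_dvdn FinRing.zmodXgE => /eqP.
Qed.

Lemma cluster_point (X : topologicalZmodType) (V : nat -> set X) (y : nat -> X) :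
  compact [set: X] -> open_chain V ->
  exists x, forall i, exists2 j, (i <= j)%N & V i (y j - x).
Proof.
move=> cX V_chain.
pose F k := closure [set y j | j in [set j | (k <= j)%N]].
have [x Fx] : exists x, forall k, F k x.
  apply: nested_closed => //.
  - by move=> k; exact: closed_closure.
  - by move=> k; exists (y k); apply: subset_closure; exists k => /=.
  - move=> i j ij; apply: closureS => _ [k jk <-]; exists k => //=.
    exact: leq_trans jk.
exists x => i.
by have /(chain_closureP V_chain)/(_ i)[_ [j ij <-] Vj] := Fx i; exists j.
Qed.

Section Component.
Variables (X : topologicalZmodType) (V : nat -> set X).
Hypothesis cX : compact [set: X].
Hypothesis V_chain : open_chain V.
Variables (p : nat) (p_prime : prime p).

(** The [p]-component of [x] is a limit of multiples [a *: x], where [a] tends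
    to 1 [p]-adically and to 0 [q]-adically for the other primes [q]. *)
Lemma padic_component (x : X) : exists x', padic_element p x' /\
  forall i, exists a : nat, [/\ (p ^ i %| a - 1)%N, (0 < a)%N & V i (x *+ a - x')].
Proof.
have [sV oV dV bV] := V_chain.
pose p' := negn (nat_pred_of_nat p).
have cop j : coprime (p ^ j) (partn j`! p').
  by apply: (pnat_coprime (pi := p)); [rewrite pnatX pnat_id|exact: part_pnat].
pose a j := (chinese (p ^ j) (partn j`! p') 1 0 + p ^ j * partn j`! p')%N.
have a_gt0 j : (0 < a j)%N.
  apply: leq_trans (leq_addl _ _).
  by rewrite muln_gt0 part_gt0 expn_gt0 prime_gt0.
have a1 j : (p ^ j %| a j - 1)%N.
  rewrite -eqn_mod_dvd//; apply/eqP.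
  by rewrite /a -modnDmr modnMr addn0 (chinese_modl (cop j)).
have a0 j : (partn j`! p' %| a j)%N.
  by rewrite /dvdn /a -modnDmr modnMl addn0 (chinese_modr (cop j)) mod0n.
have [x' x'P] := cluster_point (fun j => x *+ a j) cX V_chain.
exists x'; split; last first.
  move=> i; have [j ij Vj] := x'P i; exists (a j); split=> //.
  exact: dvdn_trans (dvdn_exp2l p ij) (a1 j).
move=> U sU oU; have [m m_gt0 Um] := open_subgroup_index cX sU oU.
exists (logn p m).
have [i VU] := bV _ (open_nbhs_nbhs (conj oU sU.1)).
have [j ij Vj] := x'P (maxn i m).
have Uj : U (x *+ a j - x') by apply: VU; apply: dV Vj; rewrite leq_maxl.
rewrite -(subKr (x *+ a j) x') mulrnBl; apply: sU.2; last exact: subgroupMn.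
(* The part of [m] prime to [p] divides [j`!], hence [a j]. *)
have : (m %| a j * p ^ logn p m)%N.
  rewrite -{1}(partnC p m_gt0) p_part mulnC dvdn_mul//.
  apply: dvdn_trans (a0 j); apply: partn_dvd; first exact: fact_gt0.
  by apply: dvdn_fact; rewrite m_gt0 (leq_trans _ ij)// leq_maxr.
by rewrite -mulrnA => /dvdnP[q ->]; rewrite mulrnA.
Qed.

End Component.

(** The exponent [k] of a cyclic module: [Some k] stands for [p ^ k], and [None]
    for the [p]-adic integers. *)
Definition annihilated (p : nat) (X : topologicalZmodType) (k : option nat) (d : X) : Prop :=
  if k is Some k then d *+ p ^ k = 0 else padic_element p d.

Definition leo (k k' : option nat) : Prop :=
  match k, k' with _, None => True | Some a, Some b => (a <= b)%N | None, Some _ => False end.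

(** Closed direct factors are handled through their projections. *)
Record idempotent_endo (X : topologicalZmodType) (pi : X -> X) : Prop := {
  endoB : zmod_morphism pi;
  endo_cont : continuous pi;
  endoK : forall x, pi (pi x) = pi x }.

(** [c] generates a direct factor of [pi(X)] that is the free profinite module
    of rank one over [Z/p^k], or over the [p]-adic integers if [k] is [None]. *)
Definition free_cyclic (p : nat) (X : topologicalZmodType) (pi : X -> X)
    (k : option nat) (c : X) : Prop :=
  [/\ pi c = c, annihilated p k c
  & forall (Z : topologicalZmodType) (d : Z), profinite Z -> annihilated p k d ->
    exists T : X -> Z, [/\ zmod_morphism T, continuous T, T c = d,
      forall x, T (pi x) = T x & forall x, closure [set d *~ a | a in [set: int]] (T x)]].

(** * Existence of a free cyclic factor *)

Lemma mulrn_continuous (X : topologicalZmodType) n :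
  continuous (fun x : X => x *+ n).
Proof.
elim: n => [|n IH].
  by rewrite (_ : (fun x => x *+ 0) = (fun _ => 0 : X)); [move=> x; exact: cvg_cst|apply/funext => x; rewrite mulr0n].
rewrite (_ : (fun x => _) = (fun x : X => x + x *+ n)); last by apply/funext => x; rewrite mulrS.
move=> x; apply: (@continuous_comp _ _ _ (fun x => (x, x *+ n)) (fun z : X * X => z.1 + z.2)).
  by apply: cvg_pair => /=; [exact: cvg_id|exact: IH].
exact: add_continuous.
Qed.

Lemma closed_image (X Z : topologicalType) (f : X -> Z) (F : set X) :
  compact [set: X] -> hausdorff_space Z -> continuous f -> closed F ->
  closed (f @` F).
Proof.
move=> cX hZ fc cF; apply: compact_closed => //.
apply: continuous_compact; first exact: continuous_subspaceT.
exact: subclosed_compact cX _.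
Qed.

Lemma padic_element_hom p (X Z : topologicalZmodType) (f : X -> Z) x :
  zmod_morphism f -> continuous f -> padic_element p x -> padic_element p (f x).
Proof.
move=> fB fc xp V sV oV.
have [||j Vj] := xp (f @^-1` V).
- by split=> [|a b]; rewrite /preimage /= ?(hom0 fB)//; [exact: sV.1|rewrite fB; exact: sV.2].
- by apply: open_comp => // y _; exact: fc.
- by exists j; rewrite -(homMn fB).
Qed.

Section Step.
Variables (X : topologicalZmodType) (p : nat) (p_prime : prime p).
Hypothesis X_profinite : profinite X.
Variable (pi : X -> X).
Hypothesis pi_endo : idempotent_endo pi.

Let cX : compact [set: X]. Proof. by case: X_profinite. Qed.
Let hX : hausdorff_space X. Proof. by case: X_profinite. Qed.
Let piB := endoB pi_endo.
Let pic := endo_cont pi_endo.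
Let piK := endoK pi_endo.

Definition divisible_in (x : X) := exists y, x = pi y *+ p.

(** The preimage under [pi] of the [m]-th multiples of the part of [K] in the
    factor [pi(X)]. *)
Let divM K m := [set x | exists2 y, K (pi y) & pi x = pi y *+ m].

Let divM_subgroup K m : subgroup K -> subgroup (divM K m).
Proof.
move=> sK; split; first by exists 0; rewrite (hom0 piB) ?mul0rn//; exact: sK.1.
move=> a b [y Ky ya] [z Kz zb]; exists (y - z); first by rewrite piB; exact: sK.2.
by rewrite !piB mulrnBl ya zb.
Qed.

Let divM_closed K m : closed K -> closed (divM K m).
Proof.
move=> cK; have -> : divM K m = pi @^-1` ((fun y => pi y *+ m) @` (pi @^-1` K)).
  apply/seteqP; split=> x /=; first by move=> [y Ky yx]; exists y.
  by move=> [y Ky yx]; exists y.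
apply: (@preimage_closed X X pi) => //.
apply: closed_image => //; last exact: (@preimage_closed X X pi).
move=> x; apply: (@continuous_comp _ _ _ pi (fun y => y *+ m)); first exact: pic.
exact: mulrn_continuous.
Qed.

Let divM_ker K m x : subgroup K -> divM K m (x - pi x).
Proof.
move=> sK; exists 0; first by rewrite (hom0 piB); exact: sK.1.
by rewrite piB piK subrr (hom0 piB) mul0rn.
Qed.

Let T_pi (Z : topologicalZmodType) (T : X -> Z) (K : nat -> set X) x :
  zmod_morphism T -> (forall x, (forall j, K j x) -> T x = 0) ->
  (forall j x, K j (x - pi x)) -> T (pi x) = T x.
Proof.
move=> TB TK Kpi; apply/esym/eqP; rewrite -subr_eq0 -TB; apply/eqP/TK => j.
exact: Kpi.
Qed.

(** The torsion case: minimality of [k] makes [c] of order exactly [p ^ k]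
    modulo [p ^ k] times the factor. *)
Let step_torsion k c : pi c = c -> c *+ p ^ k = 0 -> ~ divisible_in c ->
  (forall k' c', pi c' = c' -> c' *+ p ^ k' = 0 -> ~ divisible_in c' -> (k <= k')%N) ->
  free_cyclic p pi (Some k) c.
Proof.
move=> pic0 ck nc kmin; split=> // Z d [cZ hZ [W W_chain]] dk.
case: k => [|k] in ck kmin dk *.
  by exfalso; apply: nc; exists 0; rewrite (hom0 piB) mul0rn -ck expn0.
have [V V_chain] : exists V : nat -> set X, open_chain V by case: X_profinite.
have sT : subgroup [set: X] by [].
have [||U [sU oU MU Ugen Udvd]] := cyclic_complement V_chain p_prime
  (@divM_subgroup setT (p ^ k.+1)%N sT) (@divM_closed setT (p ^ k.+1)%N closedT) (c := c) (k := k).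
- by move=> x; exists x => //; rewrite (homMn piB).
- move=> [y _]; rewrite (homMn piB) pic0 => cy.
  have : (k.+1 <= k)%N; last by rewrite ltnn.
  apply: (kmin k (c - pi y *+ p)).
  + by rewrite piB pic0 (homMn piB) piK.
  + by rewrite mulrnBl cy -mulrnA -expnS subrr.
  + move=> [z cz]; apply: nc; exists (y + z).
    by rewrite (homD piB) mulrnDl -cz addrC subrK.
have [||T [TB Tc Tcd TK Tcl]] := extend_hom cZ hZ W_chain (c := c) (d := d)
  (K := fun=> U) (fun=> sU) (fun=> oU) _ (fun=> Ugen).
- by move=> i j _ x Ux; exact: Ux.
- move=> i; exists 0%N => a /Udvd/dvdzP[b ->].
  rewrite mulrC mulrzA -pmulrn dk mul0rz.
  by case: W_chain => sW _ _ _; exact: (sW i).1.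
exists T; split=> // x; apply: T_pi TK _ => // j y; apply: MU; exact: divM_ker.
Qed.

(** A [p]-torsion element of the factor would be divisible by all powers of [p], and in
    a finite quotient such an element is zero. *)
Let torsion_free : (forall k c, pi c = c -> c *+ p ^ k = 0 -> divisible_in c) ->
  forall x, pi x = x -> x *+ p = 0 -> x = 0.
Proof.
move=> tors x pix xp.
have [V V_chain] : exists V : nat -> set X, open_chain V by case: X_profinite.
have xdiv j : exists y, x = pi y *+ p ^ j.
  elim: j => [|j [y xy]]; first by exists x; rewrite expn0 pix.
  have [|z yz] := tors j.+1 (pi y) (piK y).
    by rewrite expnSr mulrnA -xy.
  by exists z; rewrite xy yz -mulrnA -expnS.
apply: (chain_eq0 V_chain hX) => i.
have [sV oV _ _] := V_chain.
have [m m_gt0 Vm] := open_subgroup_index cX (sV i) (oV i).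
have [y xy] := xdiv (logn p m).
have [m' m'p mE] : exists2 m', coprime p m' & m = (p ^ logn p m * m')%N.
  by have [m' cm' mE] := pfactor_coprime p_prime m_gt0; exists m' => //; rewrite mulnC.
have := @bezout_subgroup X (V i) x m'%:Z p%:Z (sV i).
have -> : gcdz m'%:Z p%:Z = 1.
  by rewrite /gcdz /= gcdnC (eqP m'p).
rewrite mulr1z; apply; rewrite -pmulrn.
  by rewrite xy -mulrnA -mE; exact: Vm.
by rewrite xp; exact: (sV i).1.
Qed.

(** Without torsion outside of [p pi(X)], a [p]-adic element outside of it generates
    a free factor. The kernel of the projection is the intersection of open
    subgroups [K j] with [X / K j] cyclic of order [p ^ j], generated by [c]: given
    [K j], torsion-freeness shows that [c *+ p ^ j] is not a [p]-th multiple of an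
    element of [K j], so that [cyclic_complement] applies. *)
Let step_padic : (forall k c, pi c = c -> c *+ p ^ k = 0 -> divisible_in c) ->
  (exists x, ~ divisible_in (pi x)) ->
  exists2 c, free_cyclic p pi None c & ~ divisible_in c.
Proof.
move=> tors [x0 nx0]; have tf := torsion_free tors.
have [V V_chain] : exists V : nat -> set X, open_chain V by case: X_profinite.
have sT : subgroup [set: X] by [].
have [x' [x'p x'V]] := padic_component cX V_chain p_prime x0.
pose c := pi x'.
have pcc : pi c = c by exact: piK.
have nc : ~ divisible_in c.
  move=> [y cy]; apply: nx0.
  suff [z _ xz] : divM setT p x0 by exists z.
  apply: (chain_closedP V_chain (@divM_closed setT p closedT)) => i.
  have [a [pa a_gt0 Va]] := x'V i.+1.
  have /dvdnP[b ab] : (p %| a - 1)%N by apply: dvdn_trans pa; rewrite dvdn_exp.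
  exists (x' - x0 *+ (a - 1)).
    exists (y - x0 *+ b) => //.
    by rewrite !piB -/c cy mulrnBl !(homMn piB) ab mulrnA.
  rewrite mulrnBr// mulr1n.
  rewrite (_ : x' - (x0 *+ a - x0) - x0 = - (x0 *+ a - x')); last zmod.
  have [sV _ dV _] := V_chain.
  apply: subgroupN => //; exact: dV (leqnSn i) _ Va.
have cp : padic_element p c by exact: padic_element_hom.
pose inv j K := [/\ subgroup K, open K, forall x, K (x - pi x) /\ K (x *+ p ^ j),
  forall x, exists a : int, K (x - c *~ a)
  & forall a : int, K (c *~ a) -> ((p ^ j)%:Z %| a)%Z].
have inv0 : inv 0%N setT.
  split=> //; first exact: openT.
  by move=> x; exists 0.
have /choice[next nextP] (jK : nat * set X) : exists K', inv jK.1 jK.2 ->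
    inv jK.1.+1 K' /\ K' `<=` jK.2.
  case: jK => j K /=.
  have [iK|] := pselect (inv j K); last by move=> ?; exists setT.
  case: iK => sK oK Kpi Kgen Kdvd.
  have cK := open_subgroup_closed sK oK.
  have [||U [sU oU MU Ugen Udvd]] := cyclic_complement V_chain p_prime
    (@divM_subgroup K p sK) (@divM_closed K p cK) (c := c) (k := j).
  - move=> x; exists (x *+ p ^ j); last by rewrite !(homMn piB) -mulrnA -expnSr.
    by rewrite (homMn piB); case: (Kpi (pi x)).
  - move=> [y Ky]; rewrite (homMn piB) pcc => cy.
    case: j => [|j] in Kpi Kdvd cy *.
      by apply: nc; exists y; rewrite -cy expn0.
    have yE : pi y = c *+ p ^ j.
      apply/eqP; rewrite eq_sym -subr_eq0; apply/eqP/tf.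
        by rewrite piB piK (homMn piB) pcc.
      by rewrite mulrnBl -mulrnA -expnSr cy subrr.
    have := Kdvd (p ^ j)%N%:Z; rewrite -pmulrn -yE => /(_ Ky).
    move=> h; have : (p ^ j.+1 %| p ^ j)%N by exact: h.
    by rewrite dvdn_Pexp2l ?ltnn// prime_gt1.
  exists U => _; split.
    split=> // x; split; first by apply: MU; exact: divM_ker.
    apply: MU; exists (x *+ p ^ j); last by rewrite !(homMn piB) -mulrnA -expnSr.
    by rewrite (homMn piB); case: (Kpi (pi x)).
  move=> u Uu; have [a Ka] := Kgen u; set k := u - c *~ a in Ka.
  have Upk : U (k *+ p).
    apply: MU; exists k; last by rewrite (homMn piB).
    by rewrite -(subKr k (pi k)); apply: sK.2 => //; case: (Kpi k).
  have : U (c *~ (a * p%:Z)).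
    rewrite mulrzA -pmulrn (_ : c *~ a = u - k); last by rewrite /k subKr.
    by rewrite mulrnBl; apply: sU.2 => //; exact: subgroupMn.
  move/Udvd; rewrite expnSr PoszM dvdz_mul2r; last first.
    by rewrite eqz_nat -lt0n prime_gt0.
  move=> /dvdzP[b ab]; rewrite -(subrK (c *~ a) u); apply: subgroupD => //.
  rewrite ab mulrC mulrzA -pmulrn; apply: subgroupMz => //.
  by case: (Kpi c).
pose K := fix K j := if j is i.+1 then next (i, K i) else setT.
have Kinv j : inv j (K j) by elim: j => [//|j /(nextP (j, K j))[]].
have Kdec i j : (i <= j)%N -> K j `<=` K i.
  move=> /subnK <-; elim: (j - i)%N => [//|m IH].
  by apply: subset_trans IH; have [] := nextP (_, _) (Kinv (m + i)%N).
exists c => //; split=> // Z d [cZ hZ [W W_chain]] dp.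
have [sW oW _ _] := W_chain.
have [|||||T [TB Tc Tcd TK Tcl]] := extend_hom cZ hZ W_chain (c := c) (d := d) (K := K).
- by move=> j; have [] := Kinv j.
- by move=> j; have [] := Kinv j.
- exact: Kdec.
- by move=> j; have [] := Kinv j.
- move=> i; have [j Wj] := dp _ (sW i) (oW i); exists j => a.
  have [_ _ _ _ Kd] := Kinv j.
  move=> /Kd/dvdzP[b ->]; rewrite mulrC mulrzA -pmulrn.
  exact: subgroupMz.
exists T; split=> // x; apply: T_pi TK _ => // j y.
by have [_ _ /(_ y)[]] := Kinv j.
Qed.

(** A factor that is not divisible by [p] has a free cyclic factor. Torsion of least
    exponent comes first: this choice makes the exponents of successive factors
    non-decreasing. *)
Lemma free_cyclic_factor : (exists x, ~ divisible_in (pi x)) ->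
  exists k c, [/\ free_cyclic p pi k c, ~ divisible_in c
    & forall k' c', pi c' = c' -> c' *+ p ^ k' = 0 -> ~ divisible_in c' ->
        leo k (Some k')].
Proof.
move=> nd; pose P k := `[< exists c, [/\ pi c = c, c *+ p ^ k = 0 & ~ divisible_in c] >].
have [[k0 Pk0]|nP] := pselect (exists k, P k).
  have [k /asboolP[c [pcc ck nc]] kmin] := ex_minnP (ex_intro P k0 Pk0).
  have kmin' k' c' : pi c' = c' -> c' *+ p ^ k' = 0 -> ~ divisible_in c' -> (k <= k')%N.
    by move=> *; apply: kmin; apply/asboolP; exists c'.
  by exists (Some k), c; split=> //; exact: step_torsion.
have tors k c : pi c = c -> c *+ p ^ k = 0 -> divisible_in c.
  by move=> pcc ck; apply: contrapT => nc; apply: nP; exists k; apply/asboolP; exists c.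
have [c fc nc] := step_padic tors nd.
by exists None, c; split=> // k' c' pc ck' []; exact: tors ck'.
Qed.

End Step.

(** * Splitting off free cyclic factors *)

(** The closed subgroup generated by [c]. *)
Definition cyc (X : topologicalZmodType) (c : X) : set X :=
  closure [set c *~ a | a in [set: int]].

Lemma hom_eq0_closed (X Z : topologicalZmodType) (f : X -> Z) :
  hausdorff_space Z -> continuous f -> closed [set x | f x = 0].
Proof.
move=> hZ fc; rewrite (_ : [set x | _] = f @^-1` [set 0]) //.
apply: (@preimage_closed X Z f) => //.
exact/accessible_closed_set1/hausdorff_accessible.
Qed.

Lemma hom_cyc0 (X Z : topologicalZmodType) (f : X -> Z) c x :
  hausdorff_space Z -> zmod_morphism f -> continuous f -> f c = 0 ->
  cyc c x -> f x = 0.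
Proof.
move=> hZ fB fc fc0 cx; apply: (hom_eq0_closed hZ fc).
by apply: closureS cx => _ [a _ <-] /=; rewrite (homMz fB) fc0 mul0rz.
Qed.

Lemma hom_sub_continuous (X Z : topologicalZmodType) (f g : X -> Z) :
  continuous f -> continuous g -> continuous (fun x => f x - g x).
Proof.
move=> fc gc x; apply: (@continuous_comp _ _ _ (fun x => (f x, g x)) (fun z : Z * Z => z.1 - z.2)).
  by apply: cvg_pair; [exact: fc|exact: gc].
exact: sub_continuous.
Qed.

Lemma hom_sub (X Z : zmodType) (f g : X -> Z) : zmod_morphism f -> zmod_morphism g ->
  zmod_morphism (fun x => f x - g x).
Proof. by move=> fB gB x y; rewrite fB gB; zmod. Qed.

Lemma hom_cyc_fix (X : topologicalZmodType) (f : X -> X) c x :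
  hausdorff_space X -> zmod_morphism f -> continuous f -> f c = c ->
  cyc c x -> f x = x.
Proof.
move=> hX fB fc fcc cx; apply/eqP; rewrite -subr_eq0; apply/eqP.
apply: (@hom_cyc0 X X (fun x => f x - x) c x) => //.
- exact: (@hom_sub _ _ f id).
- by apply: hom_sub_continuous => // y; exact: cvg_id.
- by rewrite fcc subrr.
Qed.

Lemma leo_trans k1 k2 k3 : leo k1 k2 -> leo k2 k3 -> leo k1 k3.
Proof. by case: k1 k2 k3 => [a|] [b|] [c|] //=; exact: leq_trans. Qed.

Lemma leo_refl k : leo k k. Proof. by case: k => /=. Qed.

Lemma annihilated_leo p (X : topologicalZmodType) k k' (x : X) :
  leo k k' -> annihilated p k x -> annihilated p k' x.
Proof.
case: k k' => [k|] [k'|] //=.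
  by move=> /subnKC <- xk; rewrite expnD mulrnA xk mul0rn.
by move=> _ xk V sV _; exists k; rewrite xk; exact: sV.1.
Qed.

Lemma annihilatedB p (X : topologicalZmodType) k (x y : X) :
  annihilated p k x -> annihilated p k y -> annihilated p k (x - y).
Proof.
case: k => [k|] /=; first by rewrite mulrnBl => -> ->; rewrite subrr.
move=> xp yp V sV oV; have [i Vi] := xp V sV oV; have [j Vj] := yp V sV oV.
exists (i + j)%N; rewrite mulrnBl; apply: sV.2.
  by rewrite expnD mulrnA; exact: subgroupMn.
by rewrite addnC expnD mulrnA; exact: subgroupMn.
Qed.

Section Splitting.
Variables (X : topologicalZmodType) (p : nat) (p_prime : prime p).
Hypothesis X_profinite : profinite X.

Let cX : compact [set: X]. Proof. by case: X_profinite. Qed.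
Let hX : hausdorff_space X. Proof. by case: X_profinite. Qed.

(** [E] projects the factor of [pi] onto the closed cyclic group generated by [c]; the
    minimality of the exponent is kept for comparison with the next step. *)
Record splits (pi : X -> X) (k : option nat) (c : X) (E : X -> X) : Prop := {
  splits_free : free_cyclic p pi k c;
  splits_ndiv : ~ divisible_in p pi c;
  splits_min : forall k' c', pi c' = c' -> c' *+ p ^ k' = 0 ->
    ~ divisible_in p pi c' -> leo k (Some k');
  splitsB : zmod_morphism E;
  splits_cont : continuous E;
  splits_c : E c = c;
  splits_pi : forall x, E (pi x) = E x;
  splits_cyc : forall x, cyc c (E x) }.

Arguments splits_cyc [_ _ _ _] _ _ [_] _.

Lemma splits_exist pi : idempotent_endo pi ->
  (exists x, ~ divisible_in p pi (pi x)) -> exists k c E, splits pi k c E.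
Proof.
move=> pi_endo nd.
have [k [c [fc nc kmin]]] := free_cyclic_factor p_prime X_profinite pi_endo nd.
have [pcc ck fr] := fc; have [E [EB Ec Ecc Epi Ecyc]] := fr X c X_profinite ck.
by exists k, c, E; split.
Qed.

Lemma splits_id pi k c E x : splits pi k c E -> E (E x) = E x.
Proof.
move=> s; apply: (hom_cyc_fix hX (splitsB s) (splits_cont s) (splits_c s)).
exact: splits_cyc s _.
Qed.

Lemma splits_piE pi k c E x : idempotent_endo pi -> splits pi k c E ->
  pi (E x) = E x.
Proof.
move=> pe s; have [pcc _ _] := splits_free s.
exact: (hom_cyc_fix hX (endoB pe) (endo_cont pe) pcc (splits_cyc s x)).
Qed.

Lemma splits_next pi k c E : idempotent_endo pi -> splits pi k c E ->
  idempotent_endo (fun x => pi x - E x).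
Proof.
move=> pe s; split.
- exact: hom_sub (endoB pe) (splitsB s).
- exact: hom_sub_continuous (endo_cont pe) (splits_cont s).
- move=> x; rewrite (endoB pe) (splitsB s) (endoK pe) (splits_pi s) (splits_piE _ pe s).
  by rewrite (splits_id _ s) subrr subr0.
Qed.

(** The projections onto the complements of finitely many successive free cyclic
    factors. *)
Inductive reach : (X -> X) -> Prop :=
| reach0 : reach id
| reachS pi k c E : reach pi -> splits pi k c E -> reach (fun x => pi x - E x).

Lemma reach_endo pi : reach pi -> idempotent_endo pi.
Proof.
elim=> [|{}pi k c E _]; first by split=> // x; exact: cvg_id.
exact: splits_next.
Qed.

(** Infinitely many independent free cyclic factors. The monotonicity of the exponents
    allows a homomorphism to send each generator to an earlier one. *)
Definition free_cyclic_system (k : nat -> option nat) (c : nat -> X) : Prop :=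
  [/\ forall i j, (i <= j)%N -> leo (k i) (k j),
      forall i, annihilated p (k i) (c i), forall i, k i <> Some 0%N
    & forall i (Z : topologicalZmodType) (d : Z), profinite Z ->
      annihilated p (k i) d -> exists T : X -> Z, [/\ zmod_morphism T, continuous T,
        T (c i) = d, forall j, j <> i -> T (c j) = 0 & forall x, cyc d (T x)]].

(** A free cyclic factor is split off as long as [p] does not divide the remaining
    factor. The exponents do not decrease: a torsion element of a later factor that is
    not a multiple of [p] there is none in the earlier factor either. *)
Lemma splitting_dichotomy :
  (exists pi, reach pi /\ forall x, divisible_in p pi (pi x)) \/
  exists k c, free_cyclic_system k c.
Proof.
have [fin|inf] := pselect (exists pi, reach pi /\ forall x, divisible_in p pi (pi x)).
  by left.
right.
have nxt pi : reach pi -> exists k c E, splits pi k c E.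
  move=> rp; apply: splits_exist; first exact: reach_endo.
  by apply/existsNP => h; apply: inf; exists pi.
have /choice[F FP] pi : exists z : option nat * X * (X -> X),
    reach pi -> splits pi z.1.1 z.1.2 z.2.
  have [/nxt[k [c [E s]]]|nr] := pselect (reach pi); first by exists (k, c, E).
  by exists (None, 0, id).
have [pi [k [c [E [rpi spi piS]]]]] : exists pi k c E, [/\ forall l : nat, reach (pi l),
    forall l, splits (pi l) (k l) (c l) (E l) & forall l x, pi l.+1 x = pi l x - E l x].
  pose pi := fix pi l := if l is i.+1 then fun x => pi i x - (F (pi i)).2 x else id.
  have rpi l : reach (pi l).
    by elim: l => [|l IH]; [exact: reach0|apply: reachS => //; exact: FP].
  exists pi, (fun l => (F (pi l)).1.1), (fun l => (F (pi l)).1.2), (fun l => (F (pi l)).2).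
  by split=> // l; exact: FP.
have pe l := reach_endo (rpi l).
have pcc l : pi l (c l) = c l by case: (splits_free (spi l)).
(* Later factors lie in the kernels of earlier projections, and conversely. *)
have Epi l m x : (l < m)%N -> E l (pi m x) = 0.
  move=> lm; rewrite -(subnK lm); elim: (m - _)%N x => [|n IH] x.
    rewrite add0n piS (splitsB (spi l)) (splits_pi (spi l)) (splits_id _ (spi l)).
    by rewrite subrr.
  rewrite addSn piS (splitsB (spi l)) IH sub0r.
  set j := (n + l.+1)%N.
  rewrite (@hom_cyc0 X X (E l) (c j) (E j x)) ?oppr0//.
  - exact: splitsB (spi l).
  - exact: splits_cont (spi l).
  - by rewrite -(pcc j) IH.
  - exact: splits_cyc (spi j) _.
have Ec_gt l m : (l < m)%N -> E l (c m) = 0 by move=> lm; rewrite -(pcc m) Epi.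
have pic l m : (m < l)%N -> pi l (c m) = 0.
  move=> ml; rewrite -(subnK ml); elim: (l - _)%N => [|n IH].
    by rewrite add0n piS pcc (splits_c (spi m)) subrr.
  rewrite addSn piS IH -(splits_pi (spi _)) IH (hom0 (splitsB (spi _))).
  by rewrite subrr.
have Ec_lt l m : (m < l)%N -> E l (c m) = 0.
  by move=> ml; rewrite -(splits_pi (spi l)) pic// (hom0 (splitsB (spi l))).
exists k, c; split.
- move=> i j ij; rewrite -(subnK ij); elim: (j - i)%N => [|n IH].
    exact: leo_refl.
  rewrite addSn; apply: leo_trans IH _; set l := (n + i)%N.
  have [pc1 ck1 _] := splits_free (spi l.+1).
  move: ck1; case kE: (k l.+1) => [k1|] ck1; last by case: (k l).
  apply: (splits_min (spi l)) ck1 _.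
    rewrite -pc1 piS (endoB (pe l)) (endoK (pe l)).
    by rewrite (splits_piE _ (pe l) (spi l)).
  move=> [y cy]; apply: (splits_ndiv (spi l.+1)); exists (pi l y).
  by rewrite -[in LHS]pc1 cy (homMn (endoB (pe l.+1))).
- by move=> i; case: (splits_free (spi i)).
- move=> i k0; apply: (splits_ndiv (spi i)); exists 0.
  have [_ ck _] := splits_free (spi i).
  by move: ck; rewrite k0 /= expn0 mulr1n => ->; rewrite (hom0 (endoB (pe i))) mul0rn.
- move=> i Z d Zp dk; have [_ _ fr] := splits_free (spi i).
  have [T [TB Tc Td _ Tcyc]] := fr Z d Zp dk.
  exists (fun x => T (E i x)); split=> //.
  + by move=> x y; rewrite (splitsB (spi i)) TB.
  + move=> x; apply: (@continuous_comp _ _ _ (E i) T); last exact: Tc.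
    exact: splits_cont (spi i) _.
  + by rewrite (splits_c (spi i)).
  + move=> j /eqP; rewrite neq_ltn => /orP[ji|ij].
      by rewrite Ec_lt// (hom0 TB).
    by rewrite Ec_gt// (hom0 TB).
  + by move=> x; exact: (Tcyc (E i x)).
Qed.

(** Differences of two terms close to a cluster point tend to zero and still
    form a free system. *)
Lemma free_cyclic_system_null (V : nat -> set X) k c : open_chain V ->
  free_cyclic_system k c ->
  exists k' c', free_cyclic_system k' c' /\ forall i, V i (c' i).
Proof.
move=> V_chain [kmono ck k0 fr]; have [sV _ dV _] := V_chain.
have [x xP] := cluster_point c cX V_chain.
have /choice[nxt nxtP] (im : nat * nat) : exists j, (im.2 < j)%N /\ V im.1 (c j - x).
  have [j ij Vj] := xP (maxn im.1 im.2.+1); exists j; split.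
    by rewrite (leq_trans _ ij)// leq_maxr.
  by apply: dV Vj; rewrite leq_maxl.
have [j [jS jV]] : exists j : nat -> nat,
    (forall i, (j i < j i.+1)%N) /\ forall i, V i (c (j i) - x).
  pose j := fix j i := if i is i'.+1 then nxt (i, j i') else nxt (0%N, 0%N).
  exists j; split=> i; first by have [] := nxtP (i.+1, j i).
  by case: i => [|i]; [have [] := nxtP (0, 0)%N|have [] := nxtP (i.+1, j i)].
have jmono i i' : (i < i')%N -> (j i < j i')%N.
  by apply: (homo_ltn ltn_trans); exact: jS.
have jinj i i' : j i = j i' -> i = i'.
  move=> e; have [/jmono|/jmono|//] := ltngtP i i'; by rewrite e ltnn.
(* Disjoint pairs of indices keep the differences independent, and the larger index
   determines the exponent. *)
exists (fun i => k (j i.*2.+1)), (fun i => c (j i.*2.+1) - c (j i.*2)); split.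
  split=> //.
  - move=> i i'; rewrite leq_eqVlt => /orP[/eqP ->|ii']; first exact: leo_refl.
    by apply/kmono/ltnW/jmono; rewrite ltnS ltn_double.
  - move=> i; apply: annihilatedB; first exact: ck.
    by apply: annihilated_leo (ck _); apply/kmono/ltnW/jS.
  - move=> i Z d Zp dk; have [T [TB Tc Td T0 Tcyc]] := fr _ Z d Zp dk.
    exists T; split=> //.
    + rewrite TB Td T0 ?subr0// => /jinj/eqP.
      by rewrite eqn_leq leqnSn andbC ltnn.
    + move=> m mi; rewrite TB !T0 ?subrr// => /jinj.
        by move=> e; have := congr1 odd e; rewrite /= !odd_double.
      by move=> [] /double_inj.
move=> i; rewrite (_ : _ - _ = (c (j i.*2.+1) - x) - (c (j i.*2) - x)); last zmod.
apply: (sV i).2; apply: dV (jV _); last by rewrite -addnn leq_addr.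
by rewrite -addnn leqW// leq_addr.
Qed.

End Splitting.

(** * A shift automorphism on infinitely many factors *)

Lemma discrete_profinite (G : finZmodType) : profinite (discrete_topology G).
Proof.
split.
- apply: finite_compact; exact: (@finite_finset G setT).
- exact: discrete_hausdorff.
- exists (fun=> [set 0]); split=> //.
  + by move=> _; split=> // a b -> ->; rewrite subrr.
  + by move=> _; exact: discrete_open.
  + by move=> j k _ x.
  + by move=> O nO; exists 0%N => _ ->; exact: (nbhs_singleton nO).
Qed.

(** Every non-trivial cyclic factor maps onto the group of order [p]. *)
Lemma annihilated_Zp p k : prime p -> k <> Some 0%N ->
  annihilated p k (1 : discrete_topology 'Z_p).
Proof.
move=> p_prime k0; apply: (@annihilated_leo p _ (Some 1%N)).
  by case: k k0 => [[|k]|].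
rewrite /= expn1 -[1 *+ p]/(p%:R : 'Z_p).
by apply/val_inj; rewrite /= Zp_nat /= -[X in (X %% _)%N]Zp_cast ?prime_gt1// modnn.
Qed.

Lemma hom_add_continuous (X Z : topologicalZmodType) (f g : X -> Z) :
  continuous f -> continuous g -> continuous (fun x => f x + g x).
Proof.
move=> fc gc x; apply: (@continuous_comp _ _ _ (fun x => (f x, g x)) (fun z : Z * Z => z.1 + z.2)).
  by apply: cvg_pair; [exact: fc|exact: gc].
exact: add_continuous.
Qed.

Lemma sum_continuous (X Z : topologicalZmodType) (I : Type) (r : seq I) (T : I -> X -> Z) :
  (forall i, continuous (T i)) -> continuous (fun x => \sum_(i <- r) T i x).
Proof.
move=> Tc; elim: r => [|i r IH].
  rewrite (_ : (fun x => _) = (fun _ => 0 : Z)); first by move=> x; exact: cvg_cst.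
  by apply/funext => x; rewrite big_nil.
rewrite (_ : (fun x => _) = (fun x => T i x + \sum_(j <- r) T j x)); last first.
  by apply/funext => x; rewrite big_cons.
exact: hom_add_continuous.
Qed.

Lemma closed_preimage (T U : topologicalType) (f : T -> U) (D : set U) :
  continuous f -> closed D -> closed (f @^-1` D).
Proof. by move=> fc; apply: preimage_closed => x _; exact: fc. Qed.

Section NullSums.
Variables (X : topologicalZmodType) (V : nat -> set X).
Hypothesis cX : compact [set: X].
Hypothesis hX : hausdorff_space X.
Hypothesis V_chain : open_chain V.

Let sV i : subgroup (V i). Proof. by case: V_chain. Qed.
Let oV i : open (V i). Proof. by case: V_chain. Qed.
Let dV i j : (i <= j)%N -> V j `<=` V i. Proof. by case: V_chain => _ _ /(_ i j). Qed.

(** [S] is the sum of the series of homomorphisms [T i]; it converges uniformly since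
    [T i] takes its values in [V i]. *)
Definition null_sum (T : nat -> X -> X) (S : X -> X) : Prop :=
  [/\ zmod_morphism S, continuous S, forall i, zmod_morphism (T i),
    forall i, continuous (T i) & forall m x, V m (S x - \sum_(i < m) T i x)].

Lemma null_sum_exists (T : nat -> X -> X) :
  (forall i, zmod_morphism (T i)) -> (forall i, continuous (T i)) ->
  (forall i x, V i (T i x)) -> exists S, null_sum T S.
Proof.
move=> TB Tc TV.
have /choice[S SV] x : exists y, forall m, V m (y - \sum_(i < m) T i x).
  apply: (@nested_closed X (fun m => [set y | V m (y - \sum_(i < m) T i x)]) cX).
  - by move=> m; case: (coset_clopen (\sum_(i < m) T i x) (sV m) (oV m)).
  - by move=> m; exists (\sum_(i < m) T i x) => /=; rewrite subrr; exact: (sV m).1.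
  - move=> j k /subnK <-; elim: (k - j)%N => [|n IH]; first by rewrite add0n.
    move=> y /= Vy.
    apply: IH => /=; have {}Vy := dV (leqnSn _) Vy.
    rewrite addSn big_ord_recr /= opprD addrA in Vy.
    set z := y - _ in Vy *; rewrite -(subrK (T (n + j)%N x) z).
    by apply: subgroupD => //; exact: TV.
have uniq x y : (forall m, V m (y - \sum_(i < m) T i x)) -> S x = y.
  move=> yV; apply/eqP; rewrite -subr_eq0; apply/eqP/(chain_eq0 V_chain hX) => m.
  rewrite (_ : _ - _ = (S x - \sum_(i < m) T i x) - (y - \sum_(i < m) T i x)); last zmod.
  by apply: (sV m).2.
have SB : zmod_morphism S.
  move=> x y; apply: uniq => m.
  rewrite (_ : \sum_(i < m) _ = \sum_(i < m) T i x - \sum_(i < m) T i y); last first.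
    by rewrite -sumrB; apply: eq_bigr => i _; rewrite TB.
  rewrite (_ : _ - _ = (S x - \sum_(i < m) T i x) - (S y - \sum_(i < m) T i y)); last zmod.
  exact: (sV m).2.
exists S; split=> //; apply: (hom_continuous SB V_chain) => m.
exists [set x | V m (\sum_(i < m) T i x)].
  apply: (@sum_continuous X X _ (index_enum _) (fun (i : 'I_m) x => T i x) _ 0) => /= [i|]; first exact: Tc.
  rewrite big1 => [|i _]; last by rewrite (hom0 (TB i)).
  by apply: open_nbhs_nbhs; split; [exact: oV|exact: (sV m).1].
move=> x Vx; rewrite -(subrK (\sum_(i < m) T i x) (S x)).
exact: subgroupD.
Qed.

Section Theory.
Variables (T : nat -> X -> X) (S : X -> X).
Hypothesis TS : null_sum T S.

Lemma null_sum_closed H x : subgroup H -> closed H -> (forall i, H (T i x)) -> H (S x).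
Proof.
case: TS => _ _ _ _ SV sH cH Hx; apply: (chain_closedP V_chain cH) => m.
exists (\sum_(i < m) T i x); first exact: subgroup_sum.
by rewrite -opprB; apply: subgroupN.
Qed.

Lemma null_sum_eq x y : (forall m, V m (y - \sum_(i < m) T i x)) -> S x = y.
Proof.
case: TS => _ _ _ _ SV yV.
apply/eqP; rewrite -subr_eq0; apply/eqP/(chain_eq0 V_chain hX) => m.
rewrite (_ : _ - _ = (S x - \sum_(i < m) T i x) - (y - \sum_(i < m) T i x)); last zmod.
by apply: (sV m).2.
Qed.

Lemma null_sum0 x : (forall i, T i x = 0) -> S x = 0.
Proof.
by move=> Tx; apply: null_sum_eq => m; rewrite big1 ?subrr//; exact: (sV m).1.
Qed.

Lemma null_sum1 x j : (forall i, i <> j -> T i x = 0) -> V j (T j x) -> S x = T j x.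
Proof.
move=> Tx Vj; apply: null_sum_eq => m; have [jm|mj] := ltnP j m.
  rewrite (bigD1 (Ordinal jm))//= big1 ?addr0 ?subrr; first exact: (sV m).1.
  by move=> i /eqP ij; apply: Tx => h; apply: ij; exact: val_inj.
rewrite big1 ?subr0; first exact: dV mj _ Vj.
by move=> i _; apply: Tx => h; have := ltn_ord i; rewrite h ltnNge mj.
Qed.

Lemma null_sum_hom0 (f : X -> X) x : zmod_morphism f -> continuous f ->
  (forall i, f (T i x) = 0) -> f (S x) = 0.
Proof.
move=> fB fc fT; apply: (@null_sum_closed [set x | f x = 0]) => //.
  by split=> [|a b /= fa fb]; rewrite /= ?(hom0 fB)// fB fa fb subrr.
exact: hom_eq0_closed.
Qed.

End Theory.
End NullSums.

(** What the counterexample needs: [id - alpha] maps the subgroup [small] onto the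
    larger subgroup [big], both being images of continuous projections of [X], and
    the fixed points of [alpha] make up for the difference between the two. The
    characters [chi0] and [chi1] of order [p] are independent, and [chi0] detects
    the element [d0] of [big] modulo [small]. *)
Record shift_data (X : topologicalZmodType) (p : nat) : Type := {
  alpha : X -> X;
  big : set X;
  small : set X;
  proj_big : X -> X;
  proj_small : X -> X;
  chi0 : X -> discrete_topology 'Z_p;
  chi1 : X -> discrete_topology 'Z_p;
  d0 : X;
  d1 : X;
  alpha_aut : top_automorphism alpha;
  big_subgroup : subgroup big;
  small_subgroup : subgroup small;
  small_big : small `<=` big;
  alpha_big : forall x, big x -> big (alpha x);
  alpha_onto : forall y, big y -> exists2 x, small x & x - alpha x = y;
  alpha_adjust : forall x, big x -> exists e, [/\ big e, alpha e = e & small (x - e)];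
  proj_bigB : zmod_morphism proj_big;
  proj_big_cont : continuous proj_big;
  proj_big_in : forall x, big (proj_big x);
  proj_big_id : forall x, big x -> proj_big x = x;
  proj_smallB : zmod_morphism proj_small;
  proj_small_cont : continuous proj_small;
  proj_small_in : forall x, small (proj_small x);
  proj_small_id : forall x, small x -> proj_small x = x;
  chi0B : zmod_morphism chi0;
  chi1B : zmod_morphism chi1;
  chi0_cont : continuous chi0;
  chi1_cont : continuous chi1;
  chi0_small : forall x, small x -> chi0 x = 0;
  big_d0 : big d0;
  chi0_d0 : chi0 d0 = 1;
  chi1_d0 : chi1 d0 = 0;
  chi0_d1 : chi0 d1 = 0;
  chi1_d1 : chi1 d1 = 1
}.

Section Shift.
Variables (X : topologicalZmodType) (p : nat) (p_prime : prime p).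
Hypothesis X_profinite : profinite X.
Variables (V : nat -> set X) (k : nat -> option nat) (d : nat -> X).
Hypothesis V_chain : open_chain V.
Hypothesis d_free : free_cyclic_system p k d.
Hypothesis Vd : forall i, V i (d i).

Let cX : compact [set: X]. Proof. by case: X_profinite. Qed.
Let hX : hausdorff_space X. Proof. by case: X_profinite. Qed.

Let cyc_V i x : cyc (d i) x -> V i x.
Proof.
have [sV oV _ _] := V_chain.
move=> h; apply: (open_subgroup_closed (sV i) (oV i)); apply: closureS h.
by move=> _ [a _ <-]; exact: subgroupMz.
Qed.

(** The closed subgroup generated by the [d i] with [P i]. *)
Let hull (P : pred nat) : set X := [set x | forall H : set X, subgroup H ->
  closed H -> (forall i, P i -> H (d i)) -> H x].

Let hull_subgroup P : subgroup (hull P).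
Proof.
split=> [H sH _ _|a b Ha Hb H sH cH Hd]; first exact: sH.1.
by apply: sH.2; [exact: Ha|exact: Hb].
Qed.

Let hull_closed P : closed (hull P).
Proof.
move=> x xc H sH cH Hd; apply: (cH x); apply: closureS xc => y hy.
exact: (hy H sH cH Hd).
Qed.

Let hull_gen (P : pred nat) i : P i -> hull P (d i).
Proof. by move=> Pi H _ _ Hd; exact: Hd. Qed.

Let hull_cyc (P : pred nat) i x : P i -> cyc (d i) x -> hull P x.
Proof.
move=> Pi h; apply: (@hull_closed P x); apply: closureS h => _ [a _ <-].
exact: (subgroupMz a (hull_subgroup P) (hull_gen Pi)).
Qed.

Let hull_sub (P : pred nat) (H : set X) : subgroup H -> closed H ->
  (forall i, P i -> H (d i)) -> hull P `<=` H.
Proof. by move=> sH cH Hd x hx; exact: hx. Qed.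

(** Let [R i] send [d i.+1] to [d i] and kill the other generators. The sums [A false]
    and [A true] of the [R i] over even and odd [i] have square zero, so that
    [alpha = (id - A false) \o (id - A true)] is an automorphism; the identity minus
    the sum of all the [R i] would kill the sum of the [d i]. On generators
    [id - alpha] kills [d 0] and sends [d i.+1] to [d i] for even [i] and to
    [d i - d i.-1] for odd [i], hence it maps the closed hull of the [d i] with
    [0 < i] onto the closed hull of all the [d i]. *)
Lemma shift_data_exists : exists _ : shift_data X p, True.
Proof.
have [kmono ck k0 fr] := d_free.
have [sV oV dV bV] := V_chain.
have /choice[R RP] i : exists T : X -> X, [/\ zmod_morphism T, continuous T,
    T (d i.+1) = d i, forall j, j <> i.+1 -> T (d j) = 0 & forall x, cyc (d i) (T x)].
  apply: fr => //; apply: annihilated_leo (ck i); exact: kmono.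
have /choice[F FP] i : exists T : X -> X, [/\ zmod_morphism T, continuous T,
    T (d i) = d i, forall j, j <> i -> T (d j) = 0 & forall x, cyc (d i) (T x)].
  exact: fr.
have [x0 [x0B x0c x0d x00 _]] := fr 0%N (discrete_topology 'Z_p) (1 : 'Z_p) (discrete_profinite 'Z_p)
  (annihilated_Zp p_prime (k0 0%N)).
have [x1 [x1B x1c x1d x10 _]] := fr 1%N (discrete_topology 'Z_p) (1 : 'Z_p) (discrete_profinite 'Z_p)
  (annihilated_Zp p_prime (k0 1%N)).
pose R' (b : bool) i := if odd i == b then R i else fun _ => 0.
have R'B b i : zmod_morphism (R' b i).
  by rewrite /R'; case: ifP => _ x y; [case: (RP i)|rewrite subrr].
have R'c b i : continuous (R' b i).
  by rewrite /R'; case: ifP => _ x; [case: (RP i) => _ + _ _ _; exact|exact: cvg_cst].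
have R'V b i x : V i (R' b i x).
  rewrite /R'; case: ifP => _; last exact: (sV i).1.
  by apply: cyc_V; case: (RP i) => _ _ _ _; exact.
have /choice[A AP] b := null_sum_exists cX hX V_chain (R'B b) (R'c b) (R'V b).
have AB b : zmod_morphism (A b) by case: (AP b).
have Ac b : continuous (A b) by case: (AP b).
have RR b i j x : R' b i (R' b j x) = 0.
  have [RB Rc Rd R0 Rcyc] := RP i.
  rewrite {1}/R'; case: ifP => // /eqP oi.
  rewrite /R'; case: ifP => [/eqP oj|_]; last exact: (hom0 RB).
  apply: (@hom_cyc0 X X (R i) (d j)) => //; last by case: (RP j) => _ _ _ _; exact.
  apply: R0 => ji; have : odd i.+1 = odd i by rewrite -ji oi oj.
  by rewrite /=; case: (odd i).
have AA b x : A b (A b x) = 0.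
  apply: (null_sum0 hX V_chain (AP b)) => i.
  by apply: (null_sum_hom0 hX V_chain (AP b)) => // j; exact: RR.
have Ad0 b : A b (d 0%N) = 0.
  apply: (null_sum0 hX V_chain (AP b)) => i; rewrite /R'; case: ifP => // _.
  by case: (RP i) => _ _ _ R0 _; exact: R0.
have Ad b i : A b (d i.+1) = if odd i == b then d i else 0.
  have [_ _ Rd _ _] := RP i.
  have h j : j <> i -> R' b j (d i.+1) = 0.
    move=> ji; rewrite /R'; case: ifP => // _; case: (RP j) => _ _ _ R0 _.
    by apply: R0 => -[ij]; apply: ji.
  by rewrite (null_sum1 hX V_chain (AP b) h)// /R'; case: ifP.
have Ahull b x : hull xpredT (A b x).
  apply: (null_sum_closed V_chain (AP b)) => // i; rewrite /R'.
  case: ifP => _; last exact: (hull_subgroup _).1.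
  by apply: (@hull_cyc _ i) => //; case: (RP i) => _ _ _ _; exact.
pose f b x := x - A b x; pose g b x := x + A b x.
have fB b : zmod_morphism (f b) by apply: (@hom_sub _ _ id).
have fc b : continuous (f b) by apply: hom_sub_continuous => // x; exact: cvg_id.
have gc b : continuous (g b) by apply: hom_add_continuous => // x; exact: cvg_id.
have fg b x : f b (g b x) = x by rewrite /f /g (homD (AB b)) AA; zmod.
have gf b x : g b (f b x) = x by rewrite /f /g (AB b) AA; zmod.
pose al x := f false (f true x).
have alB : zmod_morphism al by move=> x y; rewrite /al !fB.
have alc : continuous al.
  by move=> x; apply: (@continuous_comp _ _ _ (f true) (f false)); exact: fc.
have al0 : al (d 0%N) = d 0%N by rewrite /al /f Ad0 subr0 Ad0 subr0.
have alE i : ~~ odd i -> al (d i.+1) = d i.+1 - d i.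
  by move=> oi; rewrite /al /f !Ad (negbTE oi) /= subr0 Ad (negbTE oi).
have alO i : ~~ odd i -> al (d i.+2) = d i.+2 - d i.+1 + d i.
  move=> oi; rewrite /al /f Ad /= oi /= (AB false) !Ad /= oi (negbTE oi) /=; zmod.
pose pos := [pred i | (0 < i)%N].
have cl_sub H x : subgroup H -> closed H -> (forall i, H (d i)) -> hull xpredT x -> H x.
  by move=> sH cH Hd; apply: hull_sub.
have preim_sub (h : X -> X) H : zmod_morphism h -> subgroup H -> subgroup (h @^-1` H).
  move=> hB sH; split=> [|a b]; rewrite /preimage /= ?(hom0 hB); first exact: sH.1.
  by rewrite hB; exact: sH.2.
have hullT x : hull pos x -> hull xpredT x.
  by move=> hx H sH cH Hd; apply: hx => // i _; exact: Hd.
have [E EP] : exists S, null_sum V F S.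
  apply: null_sum_exists => // i; [by case: (FP i)|by case: (FP i)|].
  by move=> x; apply: cyc_V; case: (FP i).
have EB : zmod_morphism E by case: EP.
have Ec : continuous E by case: EP.
have E_in x : hull xpredT (E x).
  apply: (null_sum_closed V_chain EP) => // i.
  by apply: (@hull_cyc _ i) => //; case: (FP i).
have Ed i : E (d i) = d i.
  have [FB Fc Fd F0 Fcyc] := FP i.
  rewrite (null_sum1 hX V_chain EP (j := i)) ?Fd// => j ji.
  by case: (FP j) => _ _ _ + _; apply => /esym.
have fix_closed (h : X -> X) : continuous h -> closed [set x | h x = x].
  move=> hc; rewrite (_ : [set x | _] = [set x | h x - x = 0]).
    apply: hom_eq0_closed => //; apply: hom_sub_continuous => // x; exact: cvg_id.
  by apply/seteqP; split=> x /=; [move=> ->; rewrite subrr|move/eqP; rewrite subr_eq0 => /eqP].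
have E_id x : hull xpredT x -> E x = x.
  apply: (cl_sub [set x | E x = x]) => //; last exact: fix_closed.
  by split=> [|a b /= Ea Eb]; rewrite /= ?(hom0 EB)// EB Ea Eb.
have [F0B F0c F0d F00 F0cyc] := FP 0%N.
have F0pos x : hull pos x -> F 0%N x = 0.
  apply: (@hull_sub pos [set x | F 0%N x = 0]).
  - by split=> [|a b /= Ea Eb]; rewrite /= ?(hom0 F0B)// F0B Ea Eb subrr.
  - exact: hom_eq0_closed.
  - by move=> i /= i0; apply: F00 => ii; rewrite ii in i0.
have adj x : hull xpredT x -> hull pos (x - F 0%N x).
  apply: (cl_sub [set x | hull pos (x - F 0%N x)]).
  - apply: (preim_sub (fun x => x - F 0%N x)); last exact: hull_subgroup.
    exact: (@hom_sub _ _ id).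
  - have hc : continuous (fun x => x - F 0%N x).
      by apply: hom_sub_continuous => // y; exact: cvg_id.
    exact: (closed_preimage hc (@hull_closed pos)).
  - move=> [|i] /=; first by rewrite F0d subrr; exact: (hull_subgroup _).1.
    by rewrite F00// subr0; exact: hull_gen.
have al_cyc0 x : cyc (d 0%N) x -> al x = x by exact: hom_cyc_fix.
pose G x := E x - F 0%N (E x).
have N_in i : hull xpredT (d i - al (d i)).
  apply: (hull_subgroup _).2; first exact: hull_gen.
  rewrite /al /f.
  by repeat (apply: (hull_subgroup _).2; last by apply: Ahull); exact: hull_gen.
unshelve eexists; last by [].
apply: (@Build_shift_data X p al (hull xpredT) (hull pos) E G x0 x1 (d 0%N) (d 1%N)) => //.
- split=> //; exists (fun x => g true (g false x)); split.
  + by move=> x; rewrite /al gf gf.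
  + by move=> x; rewrite /al fg fg.
  + by move=> x; apply: (@continuous_comp _ _ _ (g false) (g true)); exact: gc.
- move=> x; apply: (cl_sub (al @^-1` hull xpredT)).
  + by apply: preim_sub => //; exact: hull_subgroup.
  + exact: (closed_preimage alc (@hull_closed xpredT)).
  + move=> i; rewrite /= -(subKr (d i) (al (d i))).
    by apply: (hull_subgroup _).2; [exact: hull_gen|exact: N_in].
- move=> y hy; suff : [set x - al x | x in hull pos] y by case=> x; exists x.
  have NB : zmod_morphism (fun x => x - al x) by exact: (@hom_sub _ _ id).
  apply: (cl_sub [set x - al x | x in hull pos]) hy.
  + exact: (subgroup_image NB (hull_subgroup _)).
  + have Nc : continuous (fun x => x - al x).
      by apply: hom_sub_continuous => // x; exact: cvg_id.
    exact: closed_image cX hX Nc (@hull_closed pos).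
  + move=> i; have [oi|oi] := boolP (odd i); last first.
      exists (d i.+1); first exact: hull_gen.
      by rewrite alE// subKr.
    case: i oi => // i /= oi.
    exists (d i.+2 + d i.+1).
      by apply: (subgroupD (hull_subgroup pos)); exact: (@hull_gen pos).
    rewrite (homD alB) (alO i oi) (alE i oi); zmod.
- move=> x hx; exists (F 0%N x); split; last exact: adj.
    exact: (@hull_cyc xpredT 0%N _ isT (F0cyc x)).
  exact: (al_cyc0 _ (F0cyc x)).
- by apply: (@hom_sub _ _ E (fun x => F 0%N (E x))) => // x y; rewrite EB F0B.
- apply: (@hom_sub_continuous _ _ E (fun x => F 0%N (E x))) => // x.
  by apply: (@continuous_comp _ _ _ E (F 0%N)); [exact: Ec|exact: F0c].
- by move=> x; apply: adj; exact: E_in.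
- by move=> x hx; rewrite /G E_id ?F0pos ?subr0//; exact: hullT.
- move=> x hx; apply: (@hull_sub pos [set x | x0 x = 0]) hx.
  + by split=> [|a b /= Ea Eb]; rewrite /= ?(hom0 x0B)// x0B Ea Eb subrr.
  + by apply: hom_eq0_closed => //; exact: discrete_hausdorff.
  + by move=> i /= i0; apply: x00 => ii; rewrite ii in i0.
- exact: hull_gen.
- exact: x10.
- exact: x00.
Qed.

End Shift.

(** * The p-adic integers as a profinite group *)

Section Criterion.
Variables (Z : topologicalZmodType) (W : nat -> set Z).
Hypothesis sW : forall k, subgroup (W k).
Hypothesis oW : forall k, open (W k).
Hypothesis W0 : forall x, (forall k, W k x) -> x = 0.

Lemma separating_hausdorff : hausdorff_space Z.
Proof.
move=> x y xy; apply/eqP; rewrite -subr_eq0; apply/eqP/W0 => k.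
have [z [Wx Wy]] := xy _ _ (open_subgroup_nbhs x (sW k) (oW k))
  (open_subgroup_nbhs y (sW k) (oW k)).
rewrite (_ : x - y = (z - y) - (z - x)); first exact: (sW k).2.
by zmod.
Qed.

(** In a compact group a decreasing sequence of open subgroups that separates points
    is a neighbourhood basis: the traces of its members outside an open
    neighbourhood of zero are compact with empty intersection. *)
Lemma separating_chain : compact [set: Z] ->
  (forall j k, (j <= k)%N -> W k `<=` W j) -> open_chain W.
Proof.
move=> cZ dW; split=> // O; rewrite nbhsE => -[B [oB B0] BO].
apply: contrapT => /forallNP nW.
have [x Wx] : exists x, forall k, (W k `&` ~` B) x.
  apply: nested_closed => //.
  - move=> k; apply: closedI; last exact: open_closedC.
    exact: open_subgroup_closed.
  - move=> k; apply: contrapT => h; apply: (nW k) => x Wx; apply: contrapT => nO.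
    by apply: h; exists x; split=> // /BO.
  - by move=> j k jk x [Wx nB]; split=> //; exact: dW jk _ Wx.
have x0 : x = 0 by apply: W0 => k; case: (Wx k).
by case: (Wx 0%N) => _; rewrite x0.
Qed.

Lemma separating_profinite : compact [set: Z] ->
  (forall j k, (j <= k)%N -> W k `<=` W j) -> profinite Z.
Proof.
move=> cZ dW; split=> //; first exact: separating_hausdorff.
by exists W; exact: separating_chain.
Qed.

End Criterion.

Lemma separated_hausdorff (T : topologicalType) :
  (forall x y : T, x <> y -> exists (U : topologicalType) (f : T -> U),
    [/\ hausdorff_space U, continuous f & f x <> f y]) -> hausdorff_space T.
Proof.
move=> sep x y xy; apply: contrapT => /sep[U [f [hU fc fxy]]]; apply: fxy.
apply: hU => A B /fc nA /fc nB.
by have [z [Az Bz]] := xy _ _ nA nB; exists (f z).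
Qed.

Lemma compact_set_type (T : topologicalType) (A : set T) :
  compact A -> compact [set: set_type A].
Proof.
move=> cA F FF _.
have FA : ((@set_val T A) @ F) A.
  by apply: (@filterS _ F _ setT) => [z _|]; [exact: set_valP|exact: filterT].
have [x [Ax Fx]] := cA _ _ FA.
pose z : set_type A := exist (fun f => f \in A) x (mem_set Ax).
exists z; split=> // B C FB [_ [[D oD <-] Dz DC]].
have nD : nbhs x D by apply: open_nbhs_nbhs.
have FB' : (@set_val T A @ F) (@set_val T A @` B).
  by apply: (@filterS _ F _ B) => // w Bw; exists w.
have [y [[w Bw wy] Dy]] := Fx _ D FB' nD.
by exists w; split=> //; apply: DC; rewrite /preimage/= wy.
Qed.

Section Padic.
Variable p : prime_number.
Let pp : prime (val p). Proof. exact: valP p. Qed.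

(** The residue modulo [p ^ k.+1]; the tower starts at exponent one. *)
Definition level (k : nat) (x : padic p) : 'Z_(val p ^ k.+1) := val x k.

Lemma levelB k : zmod_morphism (level k).
Proof. by []. Qed.

Lemma pexp_gt1 k : (1 < val p ^ k.+1)%N.
Proof. by rewrite -{1}(exp1n k.+1) ltn_exp2r// prime_gt1. Qed.

Lemma level_continuous k : continuous (fun x => level k x : discrete_topology 'Z_(val p ^ k.+1)).
Proof.
move=> x; apply: (@continuous_comp _ _ _ (val : padic p -> padic_tower p) (fun z => z k)).
  exact: initial_continuous.
exact: prod_topology_proj_continuous.
Qed.

Lemma Zp_mod n (x : 'Z_n) : (1 < n)%N -> (x %% n)%N = x.
Proof. by move=> n1; rewrite -{2}(Zp_cast n1) modn_small. Qed.

Lemma level_dec j k x : (j <= k)%N -> level k x = 0 -> level j x = 0.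
Proof.
move=> /subnK <-; elim: (k - j)%N => [//|n IH] xk; apply: IH; move: xk.
rewrite addSn; set i := (n + j)%N => xk.
have := set_mem (valP x) i; rewrite -/(level i x) -/(level i.+1 x) xk /= mod0n.
by rewrite Zp_mod ?pexp_gt1// => h; apply/val_inj.
Qed.

Lemma level_eq0 x : (forall k, level k x = 0) -> x = 0.
Proof.
by move=> xk; apply/val_inj/functional_extensionality_dep => k; exact: xk.
Qed.

Definition padic_ker k : set (padic p) := [set x | level k x = 0].

Lemma padic_ker_subgroup k : subgroup (padic_ker k).
Proof. by split=> // a b; rewrite /padic_ker /= => ak bk; rewrite levelB ak bk subrr. Qed.

Lemma padic_ker_open k : open (padic_ker k).
Proof.
apply: (open_comp (f := fun x => level k x : discrete_topology 'Z_(val p ^ k.+1)) (D := [set 0])).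
  by move=> x _; exact: level_continuous.
exact: discrete_open.
Qed.

Lemma padic_compact : compact [set: padic p].
Proof.
have cT : compact [set: padic_tower p].
  have := @tychonoff nat (fun k => discrete_topology 'Z_(val p ^ k.+1)) (fun=> setT).
  rewrite (_ : [set f | _] = setT); last by apply/seteqP.
  apply=> k; apply: finite_compact; exact: (@finite_finset 'Z_(val p ^ k.+1) setT).
apply: compact_set_type; apply: (subclosed_compact _ cT) => //.
rewrite (_ : padic_coherent (p:=p) = \bigcap_k [set x : padic_tower p |
     (x k.+1 : nat) = (x k : nat) %[mod val p ^ k.+1]]); last first.
  by apply/seteqP; split=> [x xc k _|x xc k]; [exact: xc|exact: (xc k I)].
apply: closed_bigI => k _.
pose Q := (discrete_topology 'Z_(val p ^ k.+2) * discrete_topology 'Z_(val p ^ k.+1))%type.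
pose D : set Q := [set z : Q | nat_of_ord (z.1 : 'Z_(val p ^ k.+2)) =
  nat_of_ord (z.2 : 'Z_(val p ^ k.+1)) %[mod val p ^ k.+1]].
apply: (@closed_preimage (padic_tower p) Q (fun x => (x k.+1, x k)) D).
  move=> x; apply: (@cvg_pair _ _ _ (nbhs x) (nbhs (x k.+1)) (nbhs (x k)) _ _ _
    (fun x : padic_tower p => x k.+1) (fun x : padic_tower p => x k)).
    exact: (@prod_topology_proj_continuous _ (fun k => discrete_topology 'Z_(val p ^ k.+1)) k.+1 x).
  exact: (@prod_topology_proj_continuous _ (fun k => discrete_topology 'Z_(val p ^ k.+1)) k x).
move=> [a b] /(_ [set (a, b)]) [].
  by exists ([set a], [set b]) => [|[u v] /= [-> ->]//]; split.
by move=> z [Dz <-].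
Qed.

Lemma padic_chain : open_chain padic_ker.
Proof.
apply: separating_chain; [exact: padic_ker_subgroup|exact: padic_ker_open| |exact: padic_compact|].
  exact: level_eq0.
by move=> j k jk x; exact: level_dec.
Qed.

Lemma padic_profinite : profinite (padic p).
Proof.
split; first exact: padic_compact.
  apply: separating_hausdorff padic_ker_open _ ; first exact: padic_ker_subgroup.
  exact: level_eq0.
by exists padic_ker; exact: padic_chain.
Qed.

Lemma level_Mn k (x : padic p) n : level k (x *+ n) = level k x *+ n.
Proof. exact: homMn (@levelB k) x n. Qed.

Lemma Zp_mulrn n (x : 'Z_n) : (1 < n)%N -> x *+ n = 0.
Proof.
move=> n1; apply/val_inj; rewrite Zp_mulrn /=; apply/eqP/dvdn_mull.
by rewrite [X in (X %| _)%N]Zp_cast.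
Qed.

Lemma Zp_intr_eq0 n (a : int) : (1 < n)%N -> (1 : 'Z_n) *~ a = 0 -> (n%:Z %| a)%Z.
Proof.
move=> n1; have nat_eq0 m : (1 : 'Z_n) *+ m = 0 -> (n %| m)%N.
  move=> /(congr1 (fun x : 'Z_n => nat_of_ord x)); rewrite Zp_nat /=.
  by rewrite -[X in (_ %% X)%N]/(Zp_trunc n).+2 Zp_cast// => /eqP.
case: a => m /=; first exact: nat_eq0.
by move=> /eqP; rewrite oppr_eq0 => /eqP /nat_eq0.
Qed.

Lemma padic_ker_Mn k (x : padic p) : padic_ker k (x *+ val p ^ k.+1).
Proof. by rewrite /padic_ker /= level_Mn Zp_mulrn// pexp_gt1. Qed.

Lemma padic_padic_element (x : padic p) : padic_element (val p) x.
Proof.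
move=> V sV oV; have [_ _ _ bV] := padic_chain.
have [k kV] := bV _ (open_nbhs_nbhs (conj oV sV.1)).
by exists k.+1; apply: kV; exact: padic_ker_Mn.
Qed.

Lemma padic_one_coherent : padic_coherent (p:=p) (fun k => 1 : 'Z_(val p ^ k.+1)).
Proof. by []. Qed.

Definition padic_one : padic p := exist (fun f => f \in padic_coherent (p:=p)) _ (mem_set padic_one_coherent).

Lemma level_one k : level k padic_one = 1. Proof. by []. Qed.

Lemma padic_one_gen k (x : padic p) : padic_ker k (padic_one *+ (level k x : nat) - x).
Proof. by rewrite /padic_ker /= levelB level_Mn level_one natr_Zp subrr. Qed.

Lemma padic_ker_one k (a : int) : padic_ker k (padic_one *~ a) -> ((val p ^ k.+1)%:Z %| a)%Z.
Proof.
rewrite /padic_ker /= (homMz (@levelB k)) level_one.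
by apply: Zp_intr_eq0; exact: pexp_gt1.
Qed.

End Padic.

(** * The part split off at one prime *)

(** A homomorphism is injective on a closed cyclic group as soon as small images of
    multiples of the generator come from small multiples. *)
Lemma cyc_injective (X Z : topologicalZmodType) (V : nat -> set X) (T : X -> Z) (c : X) y :
  hausdorff_space X -> open_chain V -> zmod_morphism T -> continuous T ->
  (forall i, exists O : set Z, [/\ subgroup O, open O
    & forall a : int, O (T c *~ a) -> V i (c *~ a)]) ->
  cyc c y -> T y = 0 -> y = 0.
Proof.
move=> hX V_chain TB Tc inj cy Ty; have [sV oV dV bV] := V_chain.
apply: (chain_eq0 V_chain hX) => i; have [U [sO oO OV]] := inj i.
have [j jO] := bV _ (hom_continuous_nbhs TB Tc (open_nbhs_nbhs (conj oO sO.1))).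
set m := maxn i j.
have [_ [a _ <-] Va] := (chain_closureP V_chain _ _).1 cy m.
have Vca : V i (c *~ a).
  apply: OV; rewrite -(homMz TB).
  have := jO _ (dV _ _ (leq_maxr i j) _ Va).
  by rewrite /preimage /= TB Ty subr0.
rewrite -(subKr (c *~ a) y); apply: (sV i).2 => //.
exact: dV (leq_maxl i j) _ Va.
Qed.

(** The image is closed, so approximate surjectivity is enough. *)
Lemma hom_surjective (X Z : topologicalZmodType) (W : nat -> set Z) (T : X -> Z) :
  compact [set: X] -> hausdorff_space Z -> open_chain W -> zmod_morphism T ->
  continuous T -> (forall z k, exists x, W k (T x - z)) -> forall z, exists x, T x = z.
Proof.
move=> cX hZ W_chain TB Tc dense z.
have cT : closed (T @` setT) by exact: closed_image cX hZ Tc closedT.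
have [x _ xz] : (T @` setT) z.
  apply: (chain_closedP W_chain cT) => k; have [x Wx] := dense z k.
  by exists (T x) => //; exists x.
by exists x.
Qed.

Lemma direct_product_hausdorff (I : Type) (T : I -> topologicalZmodType) :
  (forall i, hausdorff_space (T i)) -> hausdorff_space (direct_product T).
Proof.
move=> hT; apply: separated_hausdorff => x y xy.
have [i xyi] : exists i, x i <> y i.
  by apply/existsNP => h; apply: xy; apply: functional_extensionality_dep.
exists (T i), (fun z => z i); split=> //.
exact: (@prod_topology_proj_continuous I T i).
Qed.

Definition finite_product (A B : finZmodType) : finZmodType :=
  HB.pack_for finZmodType (A * B)%type
    (Finite.class (A * B)%type) (GRing.Zmodule.class (A * B)%type).

Section PadicPart.
Variables (X : topologicalZmodType) (V : nat -> set X) (p : prime_number).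
Hypothesis X_profinite : profinite X.
Hypothesis V_chain : open_chain V.
Let pp : prime (val p). Proof. exact: valP p. Qed.
Let cX : compact [set: X]. Proof. by case: X_profinite. Qed.
Let hX : hausdorff_space X. Proof. by case: X_profinite. Qed.

Definition padic_part (n : nat) (G : finZmodType) : topologicalZmodType :=
  direct_product2 (direct_product (fun _ : 'I_n => padic p)) (discrete_topology G).

(** The elements of the [p]-part that are trivial in the finite factor and modulo
    [p ^ k.+1] in the [p]-adic ones. *)
Definition part_ker n (G : finZmodType) k : set (padic_part n G) :=
  [set z | (forall i, padic_ker k (z.1 i)) /\ z.2 = 0].

Lemma part_ker_subgroup n (G : finZmodType) k : subgroup (@part_ker n G k).
Proof.
split=> [|a b [a1 a2] [b1 b2]]; first by split=> // i; exact: (padic_ker_subgroup p k).1.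
split; last by rewrite /= a2 b2 subrr.
by move=> i; exact: (padic_ker_subgroup p k).2 _ _ (a1 i) (b1 i).
Qed.

Lemma part_proj_continuous n (G : finZmodType) i :
  continuous (fun z : padic_part n G => z.1 i).
Proof.
move=> z; apply: (@continuous_comp _ _ _ fst (fun f : direct_product (fun _ : 'I_n => padic p) => f i)).
  exact: cvg_fst.
exact: (@prod_topology_proj_continuous _ (fun _ : 'I_n => padic p) i).
Qed.

Lemma part_snd_continuous n (G : finZmodType) :
  continuous (fun z : padic_part n G => z.2).
Proof. by move=> z; exact: cvg_snd. Qed.

Lemma part_ker_open n (G : finZmodType) k : open (@part_ker n G k).
Proof.
apply: open_subgroup; first exact: part_ker_subgroup.
have h2 : nbhs (0 : padic_part n G) [set z : padic_part n G | z.2 = 0].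
  apply: (@part_snd_continuous n G 0 [set 0]).
  by apply: open_nbhs_nbhs; split=> //; exact: discrete_open.
have h1 : nbhs (0 : padic_part n G) [set z : padic_part n G | forall i, padic_ker k (z.1 i)].
  have := @filter_forall (padic_part n G) 'I_n
    (fun i => [set z : padic_part n G | padic_ker k (z.1 i)]) (nbhs (0 : padic_part n G)) _.
  apply=> i; apply: (@part_proj_continuous n G i 0 (padic_ker k)).
  by apply: open_nbhs_nbhs; split; [exact: padic_ker_open|exact: (padic_ker_subgroup p k).1].
by move: h1 h2; apply: filterS2 => z h1 h2; split.
Qed.

Lemma part_ker_eq0 n (G : finZmodType) (z : padic_part n G) :
  (forall k, part_ker k z) -> z = 0.
Proof.
move=> zk; case: z zk => f g zk; congr (_, _); last by case: (zk 0%N).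
apply: functional_extensionality_dep => i; apply: level_eq0 => k.
by case: (zk k) => /(_ i).
Qed.

Lemma part_hausdorff n (G : finZmodType) : hausdorff_space (padic_part n G).
Proof.
exact: separating_hausdorff (@part_ker_subgroup n G) (@part_ker_open n G) (@part_ker_eq0 n G).
Qed.

(** [Phi] identifies the factors split off so far, whose complement is the image of
    [pi], with a product of [p]-adic and finite cyclic groups. *)
Definition split_off (pi : X -> X) n (G : finZmodType) (Phi : X -> padic_part n G) :=
  [/\ zmod_morphism Phi, continuous Phi, forall z, exists x, Phi x = z
    & forall x, Phi x = 0 <-> pi x = x].

(** Each free cyclic factor adds one coordinate: a finite cyclic group if its exponent
    is finite, and otherwise a copy of the [p]-adic integers. *)
Lemma reach_split_off pi : reach (val p) pi -> exists n (G : finZmodType) N (Phi : X -> padic_part n G),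
  (forall g : G, g *+ val p ^ N = 0) /\ split_off pi Phi.
Proof.
elim=> [|{}pi k c E rpi [n [G [N [Phi [GN [PB Pc Ps Pk]]]]]] s].
  exists 0%N, 'I_1, 0%N, (fun _ => 0); split.
    by move=> g; apply: val_inj; case: (_ *+ _) => -[].
  split=> //; first by move=> x y; rewrite subrr.
  - by move=> x; exact: cvg_cst.
  - move=> [f g]; exists 0; congr (_, _); last by rewrite [RHS]ord1.
    by apply: functional_extensionality_dep => -[].
have pe := reach_endo X_profinite rpi.
have EB := splitsB s; have Ec := splits_cont s.
have piE x : pi (E x) = E x by apply: splits_piE s.
have EE x : E (E x) = E x by apply: splits_id s.
have next_ker x : pi x - E x = x <-> (pi x = x /\ E x = 0).
  split=> [h|[-> ->]]; last by rewrite subr0.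
  have pix : pi x = x by rewrite -{1}h (endoB pe) (endoK pe) piE.
  by split=> //; rewrite -(subKr x (E x)); move: h; rewrite pix => ->; rewrite subrr.
have [pcc ck fr] := splits_free s.
have [V' V'_chain] : exists V : nat -> set X, open_chain V by case: X_profinite.
have [sV oV dV bV] := V_chain.
have surj (Z : topologicalZmodType) (T : X -> Z) t z :
    zmod_morphism T -> (forall z, exists x, T x = z) ->
    (forall x, T (E x) = T x) -> exists x, Phi x = t /\ T x = z.
  move=> TB Ts TE; have [x1 x1t] := Ps t; have [y yz] := Ts (z - T x1).
  exists (x1 + E y); rewrite (homD PB) (homD TB) TE yz x1t.
  by rewrite (Pk _).2// addr0 [T x1 + _]addrC subrK.
have T0 (Z : topologicalZmodType) (T : X -> Z) : zmod_morphism T ->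
    (forall x, T (E x) = T x) -> (forall y, cyc c y -> T y = 0 -> y = 0) ->
    forall x, T x = 0 <-> E x = 0.
  move=> TB TE inj x; split=> [Tx|Ex]; last by rewrite -TE Ex (hom0 TB).
  by apply: (inj (E x)); [exact: (@splits_cyc _ _ _ _ _ _ s x)|rewrite TE].
case: k => [k|] in s ck fr *.
  have k_gt0 : (0 < k)%N.
    case: k ck {fr} s => // ck s; exfalso; apply: (splits_ndiv s).
    by exists 0; rewrite (hom0 (endoB pe)) mul0rn -ck /= expn0.
  pose m := (val p ^ k)%N.
  have m1 : (1 < m)%N by rewrite /m; case: k k_gt0 {ck fr s m} => // k _; exact: pexp_gt1.
  have [T [TB Tc Td Tpi _]] := fr (discrete_topology 'Z_m) (1 : 'Z_m) (discrete_profinite 'Z_m)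
    (Zp_mulrn 1 m1).
  pose T' x : discrete_topology 'Z_m := T (E x).
  have T'B : zmod_morphism T' by move=> x y; rewrite /T' EB TB.
  have T'c : continuous T'.
    by move=> x; apply: (@continuous_comp _ _ _ E T); [exact: Ec|exact: Tc].
  have T'd : T' c = (1 : 'Z_m) by rewrite /T' (splits_c s).
  have TE x : T' (E x) = T' x by rewrite /T' EE.
  have T's z : exists x, T' x = z.
    exists (c *+ (z : 'Z_m)); rewrite (homMn T'B) T'd; exact: natr_Zp.
  have inj y : cyc c y -> T' y = 0 -> y = 0.
    apply: (cyc_injective hX V_chain T'B T'c) => i; exists [set 0]; split.
    - by split=> // u v -> ->; rewrite subrr.
    - exact: discrete_open.
    - move=> a /=; rewrite T'd => /(Zp_intr_eq0 m1)/dvdzP[b ->].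
      by rewrite mulrC mulrzA -pmulrn ck mul0rz; exact: (sV i).1.
  exists n, (finite_product G 'Z_m), (N + k)%N, (fun x => ((Phi x).1, ((Phi x).2, T' x))); split.
    move=> [g z]; rewrite (_ : (g, z) *+ _ = (g *+ val p ^ (N + k), z *+ val p ^ (N + k))); last first.
      by elim: (_ ^ _)%N => [//|q IH]; rewrite !mulrS IH.
    congr (_, _); first by rewrite expnD mulrnA GN mul0rn.
    by rewrite addnC expnD mulrnA (Zp_mulrn z m1) mul0rn.
  have PB' : zmod_morphism (fun x => ((Phi x).1, ((Phi x).2, T' x)) : padic_part n (finite_product G 'Z_m)).
    by move=> x y; rewrite PB T'B.
  split=> //.
  - move=> x; apply: (@cvg_pair _ _ _ (nbhs x) (nbhs (Phi x).1)
      (nbhs (((Phi x).2, T' x) : discrete_topology (finite_product G 'Z_m))) _ _ _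
      (fun x => (Phi x).1) (fun x => ((Phi x).2, T' x))).
      apply: (@continuous_comp _ _ _ Phi fst); [exact: Pc|exact: cvg_fst].
    have hB : zmod_morphism (fun x => ((Phi x).2, T' x) : discrete_topology (finite_product G 'Z_m)).
      by move=> y z; rewrite PB T'B.
    have [_ _ [D D_chain]] := discrete_profinite (finite_product G 'Z_m).
    apply: (hom_continuous hB D_chain) => q.
    exists ((fun x => (Phi x).2) @^-1` [set 0] `&` T' @^-1` [set 0]).
      apply: filterI.
        apply: (@hom_continuous_nbhs X (discrete_topology G)).
        + by move=> y z; rewrite PB.
        + move=> y; apply: (@continuous_comp _ _ _ Phi snd); [exact: Pc|exact: cvg_snd].
        + by apply: open_nbhs_nbhs; split=> //; exact: discrete_open.
      apply: (@hom_continuous_nbhs X (discrete_topology 'Z_m)) => //.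
    move=> y [/= -> ->]; case: D_chain => sD _ _ _; exact: (sD q).1.
  - move=> [f [g z]]; have [x [x1 x2]] := surj _ T' (f, g) z T'B T's TE.
    by exists x; rewrite x1 x2.
  - move=> x; rewrite next_ker -Pk -(T0 _ T' T'B TE inj); split.
      by move=> [h1 h2 ->]; split=> //; rewrite [Phi x]surjective_pairing h1 h2.
    by move=> [-> ->].
have [T [TB Tc Td Tpi _]] := fr (padic p) (padic_one p) (padic_profinite p)
  (padic_padic_element (padic_one p)).
pose T' x : padic p := T (E x).
have T'B : zmod_morphism T' by move=> x y; rewrite /T' EB TB.
have T'c : continuous T'.
  by move=> x; apply: (@continuous_comp _ _ _ E T); [exact: Ec|exact: Tc].
have T'd : T' c = padic_one p by rewrite /T' (splits_c s).
have TE x : T' (E x) = T' x by rewrite /T' EE.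
have [_ hP _] := padic_profinite p.
have T's z : exists x, T' x = z.
  apply: (hom_surjective cX hP (padic_chain p) T'B T'c) => {}z q.
  exists (c *+ (level q z : nat)); rewrite (homMn T'B) T'd; exact: padic_one_gen.
have inj y : cyc c y -> T' y = 0 -> y = 0.
  apply: (cyc_injective hX V_chain T'B T'c) => i.
  have [j Vj] := ck _ (sV i) (oV i).
  exists (padic_ker j); split; [exact: padic_ker_subgroup|exact: padic_ker_open|].
  move=> a; rewrite T'd => /padic_ker_one/dvdzP[b ->].
  rewrite mulrC mulrzA -pmulrn expnSr mulrnA.
  by apply/(subgroupMz _ (sV i))/(subgroupMn _ (sV i)).
pose Psi x : padic_part n.+1 G :=
  (fun i : 'I_n.+1 => if unlift ord0 i is Some j then (Phi x).1 j else T' x, (Phi x).2).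
exists n.+1, G, N, Psi; split=> //.
have PB' : zmod_morphism Psi.
  move=> x y; rewrite /Psi PB T'B; congr (_, _).
  apply: functional_extensionality_dep => i.
  rewrite -[RHS]/((if unlift ord0 i is Some j then (Phi x).1 j else T' x) -
    (if unlift ord0 i is Some j then (Phi y).1 j else T' y)).
  by case: unliftP.
have Psi0 x : Psi x = 0 <-> Phi x = 0 /\ T' x = 0.
  split=> [[h1 h2]|[h1 h2]].
    have h i : (if unlift ord0 i is Some j then (Phi x).1 j else T' x) = 0.
      by rewrite -[RHS]/((0 : direct_product (fun _ : 'I_n.+1 => padic p)) i) -h1.
    split; last by have := h ord0; rewrite unlift_none.
    rewrite [Phi x]surjective_pairing h2; congr (_, _).
    by apply: functional_extensionality_dep => j; have := h (lift ord0 j); rewrite liftK.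
  rewrite /Psi h1 h2; congr (_, _).
  by apply: functional_extensionality_dep => i; case: unliftP.
split=> //.
- move=> x; apply: (@cvg_pair _ _ _ (nbhs x) (nbhs (Psi x).1) (nbhs (Psi x).2) _ _ _
    (fun x => (Psi x).1) (fun x => (Psi x).2)); last first.
    apply: (@continuous_comp _ _ _ Phi snd); [exact: Pc|exact: cvg_snd].
  apply: (@prod_topology_continuous X 'I_n.+1 (fun=> padic p)) => i {}x /=.
  case: unliftP => [j _|_]; last exact: T'c.
  apply: (@continuous_comp _ _ _ Phi (fun z : padic_part n G => z.1 j)).
    exact: Pc.
  exact: part_proj_continuous.
- move=> [f g].
  have [x [x1 x2]] := surj _ T' ((fun i : 'I_n => f (lift ord0 i)), g) (f ord0) T'B T's TE.
  exists x; rewrite /Psi x1 x2; congr (_, _).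
  by apply: functional_extensionality_dep => i; case: unliftP => [j ->|->].
- by move=> x; rewrite next_ker -Pk -(T0 _ T' T'B TE inj).
Qed.

End PadicPart.

(** * The product decomposition *)

Lemma p_power_exponent_primary (p : prime_number) (G : finZmodType) N :
  (forall g : G, g *+ val p ^ N = 0) -> p_primary (val p) G.
Proof.
move=> GN x _; have pp : prime (val p) := valP p.
have : (#[x]%g %| val p ^ N)%N by rewrite order_dvdn FinRing.zmodXgE GN.
by move=> /(dvdn_pfactor _ _ pp)[k _ ->]; exists k.
Qed.

Lemma divisible_reach (X : topologicalZmodType) p (pi : X -> X) x j :
  zmod_morphism pi -> (forall x, divisible_in p pi (pi x)) -> pi x = x ->
  exists y : X, x = y *+ p ^ j.
Proof.
move=> piB div pix; suff [y xy] : exists y, x = pi y *+ p ^ j by exists (pi y).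
elim: j => [|j [y xy]]; first by exists x; rewrite expn0 mulr1n.
by have [z yz] := div y; exists z; rewrite expnS mulrnA -yz.
Qed.

(** An element that is divisible by all powers of all primes has order prime
    to every prime in each finite quotient. *)
Lemma divisible_eq0 (X : topologicalZmodType) (V : nat -> set X) x :
  profinite X -> open_chain V ->
  (forall p, prime p -> forall j, exists y : X, x = y *+ p ^ j) -> x = 0.
Proof.
move=> [cX hX _] V_chain div; apply: (chain_eq0 V_chain hX) => i.
have [sV oV _ _] := V_chain.
have [G [f [fB _ f0]]] := finite_quotient cX (sV i) (oV i).
apply/f0/eqP; rewrite -[_ == 0]/(f x == 1%g) -order_eq1.
apply/eqP; apply: contrapT => /eqP n1.
have o_gt1 : (1 < #[f x]%g)%N by rewrite ltn_neqAle eq_sym n1 order_gt0.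
set p := pdiv #[f x]%g; have pp : prime p by exact: pdiv_prime.
have G_gt0 : (0 < #|G|)%N by apply/card_gt0P; exists 0.
have [m pm mE] := pfactor_coprime pp G_gt0.
have [y xy] := div p pp (logn p #|G|).
have : (#[f x]%g %| m)%N.
  rewrite order_dvdn FinRing.zmodXgE xy -(homMn fB) -mulrnA mulnC -mE (homMn fB).
  have := @order_dvdG G [set: G]%G (f y); rewrite inE cardsT => /(_ isT).
  by rewrite order_dvdn FinRing.zmodXgE.
move=> /(dvdn_trans (pdiv_dvd _)); rewrite -/p => pdm.
by have := pm; rewrite prime_coprime// pdm.
Qed.

Section Global.
Variables (X : topologicalZmodType) (V : nat -> set X).
Hypothesis X_profinite : profinite X.
Hypothesis V_chain : open_chain V.
Let cX : compact [set: X]. Proof. by case: X_profinite. Qed.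
Let hX : hausdorff_space X. Proof. by case: X_profinite. Qed.

Variables (np : prime_number -> nat) (G : prime_number -> finZmodType).
Variables (N : prime_number -> nat) (Phi : forall p, X -> padic_part p (np p) (G p)).
Hypothesis GN : forall p (g : G p), g *+ val p ^ N p = 0.
Hypothesis PhiB : forall p, zmod_morphism (@Phi p).
Hypothesis Phic : forall p, continuous (@Phi p).
Hypothesis Phis : forall p z, exists x, @Phi p x = z.
Hypothesis Phi0 : forall p x, @Phi p x = 0 -> forall j, exists y : X, x = y *+ val p ^ j.

(** High powers of [p] are small on the [p]-part. *)
Let part_exponent p (z : padic_part p (np p) (G p)) k :
  part_ker k (z *+ val p ^ (maxn k.+1 (N p))).
Proof.
have nat_pair m : z *+ m = (z.1 *+ m, z.2 *+ m).
  by elim: m => [|m IH]; rewrite ?mulr0n// !mulrS IH.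
rewrite nat_pair; split=> /=.
  move=> i; have -> : forall m, (z.1 *+ m) i = z.1 i *+ m.
    by elim=> [|m IH]; rewrite ?mulr0n// !mulrS -IH.
  rewrite -(subnK (leq_maxl k.+1 (N p))) addnC expnD mulrnA.
  by apply: subgroupMn; [exact: padic_ker_subgroup|exact: padic_ker_Mn].
by rewrite -(subnK (leq_maxr k.+1 (N p))) addnC expnD mulrnA GN mul0rn.
Qed.

Let part_ker_nbhs p k : exists i, V i `<=` @Phi p @^-1` part_ker k.
Proof.
have [_ _ _ bV] := V_chain; apply: bV; apply: hom_continuous_nbhs => //.
by apply: open_nbhs_nbhs; split; [exact: part_ker_open|exact: (@part_ker_subgroup p _ _ k).1].
Qed.

(** The [p]-component of a preimage has the same image in the [p]-part, and its image
    in the [q]-part is both [p]-adic and [q]-adic, hence zero. *)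
Let component p (t : padic_part p (np p) (G p)) : exists x, @Phi p x = t /\
  forall q, val q <> val p -> @Phi q x = 0.
Proof.
have [sV oV dV bV] := V_chain.
have pp : prime (val p) := valP p.
have [x0 <-] := Phis t.
have [x [xp xV]] := padic_component cX V_chain pp x0; exists x; split.
  apply/eqP; rewrite -subr_eq0; apply/eqP/part_ker_eq0 => k.
  have [i Vi] := part_ker_nbhs p k.
  have [a [pa a_gt0 Va]] := xV (maxn i (maxn k.+1 (N p))).
  have := Vi _ (dV _ _ (leq_maxl _ _) _ Va); rewrite /preimage /= PhiB (homMn (@PhiB p)) => ka.
  have /dvdnP[b ab] : (val p ^ (maxn k.+1 (N p)) %| a - 1)%N.
    by apply: dvdn_trans pa; rewrite dvdn_exp2l// leq_maxr.
  have kb : part_ker k (Phi p x0 *+ (a - 1)).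
    rewrite ab mulnC mulrnA; apply: subgroupMn; first exact: part_ker_subgroup.
    exact: part_exponent.
  rewrite mulrnBr// mulr1n in kb.
  rewrite (_ : _ - _ = (Phi p x0 *+ a - Phi p x0) - (Phi p x0 *+ a - Phi p x)); last zmod.
  exact: (@part_ker_subgroup p _ _ k).2.
move=> q qp; apply: part_ker_eq0 => k.
have qq : prime (val q) := valP q.
have xqp := padic_element_hom (@PhiB q) (@Phic q) xp.
have [j kj] := xqp _ (@part_ker_subgroup q _ _ k) (@part_ker_open q _ _ k).
have kj' := part_exponent (Phi q x) k.
rewrite !pmulrn in kj kj'.
have := bezout_subgroup (@part_ker_subgroup q _ _ k) kj kj'.
rewrite (_ : gcdz _ _ = 1) ?mulr1z// /gcdz /=.
congr Posz; apply/eqP; rewrite -/(coprime _ _) coprimeXl// coprimeXr//.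
by rewrite prime_coprime// dvdn_prime2// eq_sym; apply/eqP.
Qed.

Let target := direct_product (fun p : prime_number => padic_part p (np p) (G p)).

Let total (x : X) : target := fun p => @Phi p x.

(** Injectivity holds because an element killed by every [Phi p] is divisible by all
    prime powers. Surjectivity: preimages of the single components are summed prime by
    prime, and a cluster point of the partial sums is a preimage. *)
Lemma finite_rank_iso : top_isomorphic X target.
Proof.
have [sV oV dV bV] := V_chain.
have tB : zmod_morphism total.
  by move=> x y; apply: functional_extensionality_dep => p; exact: PhiB.
have tc : continuous total.
  by apply: prod_topology_continuous => p x; exact: Phic.
have tI : injective total.
  move=> x y xy; apply/eqP; rewrite -subr_eq0; apply/eqP.
  apply: (divisible_eq0 X_profinite V_chain) => p pp j.
  apply: (@Phi0 (exist (fun p => prime p) p pp)).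
  by rewrite PhiB -[Phi _ x]/(total x _) xy subrr.
have tS z : exists x, total x = z.
  (* Indexing by the natural numbers, with zero at those that are not prime, turns the
     sum over the primes into a series. *)
have /choice[x xP] (i : nat) : exists x : X, forall p : prime_number,
      (val p = i -> Phi p x = z p) /\ (val p <> i -> Phi p x = 0).
    have [pp|np'] := boolP (prime i); last first.
      exists 0 => p; split; last by rewrite (hom0 (@PhiB p)).
      by move=> pi; exfalso; move/negP: np'; apply; rewrite -pi; exact: valP p.
    have [x [xz x0]] := component (z (exist (fun p => prime p) i pp)).
    exists x => p; split; last by move=> h; apply: x0.
    by move=> pi; have -> : p = exist (fun p => prime p) i pp by apply/val_inj.
  have [y yP] := cluster_point (fun n => \sum_(i < n) x i) cX V_chain.
  exists y; apply: functional_extensionality_dep => p; rewrite /total.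
  apply/esym/eqP; rewrite -subr_eq0; apply/eqP/part_ker_eq0 => k.
  have [i Vi] := part_ker_nbhs p k.
  have [n in_ Vn] := yP (maxn i (val p).+1).
  have := Vi _ (dV _ _ (leq_maxl _ _) _ Vn); rewrite /preimage /= PhiB.
  rewrite (hom_sum (@PhiB p)).
  have pn : (val p < n)%N by apply: leq_trans in_; rewrite leq_maxr.
  rewrite (bigD1 (Ordinal pn))//= big1 ?addr0; first by rewrite (xP _ _).1.
  move=> j /eqP jp; apply: (xP _ _).2 => h; apply: jp; exact: val_inj.
have /choice[g gP] := tS.
have gK : cancel total g by move=> x; apply: tI; rewrite gP.
exists total; split=> //; exists g; split=> //.
have hT : hausdorff_space target.
  by apply: direct_product_hausdorff => p; exact: part_hausdorff.
apply/continuous_closedP => F cF.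
rewrite (_ : g @^-1` F = total @` F); first exact: closed_image.
apply/seteqP; split=> [z Fz|_ [x Fx <-]]; last by rewrite /preimage /= gK.
by exists (g z).
Qed.

End Global.

(** At each prime the finite group split off has bounded exponent, and the remaining
    factor is divisible by the prime: these are the data for [finite_rank_iso]. *)
Lemma finite_rank_structure (X : topologicalZmodType) : profinite X ->
  (forall p : prime_number, exists pi : X -> X, reach (val p) pi /\
     forall x, divisible_in (val p) pi (pi x)) ->
  exists (np : prime_number -> nat) (G : prime_number -> finZmodType),
    (forall p, p_primary (val p) (G p)) /\
    top_isomorphic X
      (direct_product (fun p : prime_number =>
         direct_product2 (direct_product (fun _ : 'I_(np p) => padic p))
                         (discrete_topology (G p)))).
Proof.
move=> X_profinite fin; have [_ _ [V V_chain]] := X_profinite.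
have loc p : exists nG : {n : nat & {G : finZmodType & (nat * (X -> padic_part p n G))%type}},
    let Phi := (projT2 (projT2 nG)).2 in
    [/\ (forall g : projT1 (projT2 nG), g *+ val p ^ (projT2 (projT2 nG)).1 = 0), zmod_morphism Phi,
      continuous Phi, forall z, exists x, Phi x = z
    & forall x, Phi x = 0 -> forall j, exists y : X, x = y *+ val p ^ j].
  have [pi [rpi div]] := fin p.
  have [n [G [N [Phi [GN [PB Pc Ps Pk]]]]]] := reach_split_off X_profinite V_chain rpi.
  exists (existT _ n (existT _ G (N, Phi))).
  split; [exact: GN|exact: PB|exact: Pc|exact: Ps|move=> x /Pk pix j].
  exact: divisible_reach (endoB (reach_endo X_profinite rpi)) div pix.
pose F p := projT1 (cid (loc p)); pose FP p := projT2 (cid (loc p)).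
exists (fun p => projT1 (F p)), (fun p => projT1 (projT2 (F p))); split.
  by move=> p; have [GN _ _ _ _] := FP p; apply: (p_power_exponent_primary GN).
apply: (@finite_rank_iso X V X_profinite V_chain _ _ (fun p => (projT2 (projT2 (F p))).1)
  (fun p => (projT2 (projT2 (F p))).2)) => p; by case: (FP p).
Qed.

(** * Borel sets and cosets *)

Section Borel.
Variable X : topologicalZmodType.

Lemma open_borel (A : set X) : open A -> measurable (A : set (borel X)).
Proof. by move=> oA; exact: sub_sigma_algebra. Qed.

Lemma closed_borel (A : set X) : closed A -> measurable (A : set (borel X)).
Proof. by move=> /closed_openC/open_borel/measurableC; rewrite setCK. Qed.

Lemma continuous_borel (Y : topologicalZmodType) (f : X -> Y) :
  continuous f -> measurable_fun setT (f : borel X -> borel Y).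
Proof.
move=> fc; apply: (@measurability _ _ (borel X) (borel Y) _ _ (@open Y)) => //.
move=> _ [A oA <-]; rewrite setTI; apply: open_borel.
by apply: open_comp => // x _; exact: fc.
Qed.

Lemma continuous_hom_borel (f : X -> X) A : continuous f ->
  measurable (A : set (borel X)) -> measurable (f @^-1` A : set (borel X)).
Proof. by move=> fc mA; rewrite -[_ @^-1` _]setTI; exact: continuous_borel. Qed.

Lemma translate_continuous (x : X) : continuous (fun y => y + x).
Proof. by move=> y; under eq_fun do rewrite addrC; exact: add_continuousl. Qed.

Variable V : nat -> set X.
Hypothesis cX : compact [set: X].
Hypothesis V_chain : open_chain V.
Let sV i : subgroup (V i). Proof. by case: V_chain. Qed.
Let oV i : open (V i). Proof. by case: V_chain. Qed.
Let dV i j : (i <= j)%N -> V j `<=` V i. Proof. by case: V_chain => _ _ /(_ i j). Qed.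

Definition coset k (x : X) : set X := [set y | V k (y - x)].

Definition cosets : set (set (borel X)) :=
  [set A | A = set0 \/ exists k x, A = coset k x].

Lemma coset_eq k x y : coset k x y -> coset k y = coset k x.
Proof.
rewrite /coset /= => xy; apply/seteqP; split=> z /= Vz.
  by rewrite (_ : z - x = (z - y) + (y - x)); [exact: subgroupD|zmod].
by rewrite (_ : z - y = (z - x) - (y - x)); [exact: (sV k).2|zmod].
Qed.

Lemma coset_measurable k x : measurable (coset k x : set (borel X)).
Proof. by apply: open_borel; case: (coset_clopen x (sV k) (oV k)). Qed.

Lemma cosetsI : setI_closed cosets.
Proof.
have H j k x y : (j <= k)%N -> cosets (coset j x `&` coset k y).
  move=> jk; have [[z [zx zy]]|n] := pselect ((coset j x `&` coset k y) !=set0).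
    right; exists k, y; rewrite -(coset_eq zx) -(coset_eq zy).
    by apply/setIidPr => w; exact: dV.
  by left; apply/seteqP; split=> // z zz; apply: n; exists z.
move=> A B [->|[j [x ->]]]; first by left; rewrite set0I.
move=> [->|[k [y ->]]]; first by left; rewrite setI0.
have [jk|kj] := leqP j k; first exact: H.
by rewrite setIC; apply: H; exact: ltnW.
Qed.

(** An open set is a countable union of cosets: at each level of the chain only
    finitely many cosets lie in it. *)
Lemma borel_cosets : @measurable _ (borel X) = <<s cosets >>.
Proof.
apply/seteqP; split; last first.
  apply: smallest_sub; first exact: (@sigma_algebra_measurable _ (borel X)).
  by move=> A [->|[k [x ->]]]; [exact: measurable0|exact: coset_measurable].
apply: smallest_sub; first exact: smallest_sigma_algebra.
move=> U oU; have /choice[s sP] k := finite_cosets cX (sV k) (oV k).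
have -> : U = \bigcup_k \big[setU/set0]_(x <- s k | `[< coset k x `<=` U >]) coset k x.
  apply/seteqP; split=> [x Ux|x [k _]].
    have /nbhs_translate nU : nbhs x U by apply: open_nbhs_nbhs.
    case: V_chain => _ _ _ /(_ _ nU)[k kU].
    have [y ys xy] := sP k x; exists k => //.
    rewrite -bigcup_seq_cond; exists y => //=; rewrite ys; apply/asboolP.
    move=> z; rewrite -(coset_eq (xy : coset k y x)) => /kU.
    by rewrite /= addrC subrK.
  by rewrite -bigcup_seq_cond => -[y /= /andP[_ /asboolP yU] /yU].
have : @measurable _ (g_sigma_algebraType cosets) (\bigcup_k \big[setU/set0]_(x <- s k | `[< coset k x `<=` U >]) coset k x).
  apply: bigcup_measurable => k _; apply: bigsetU_measurable => x _.
  by apply: sub_sigma_algebra; right; exists k, x.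
by [].
Qed.

(** Cosets form a generating family stable under intersection. *)
Lemma measure_eq_cosets (R : realType) (m1 m2 : {measure set (borel X) -> \bar R}) :
  (m1 setT < +oo)%E -> (forall k x, m1 (coset k x) = m2 (coset k x)) ->
  forall A, measurable A -> m1 A = m2 A.
Proof.
move=> m1T m12 A mA; have [s sP] := finite_cosets cX (sV 0%N) (oV 0%N).
apply: (@measure_unique _ R (borel X) cosets (fun i => coset 0%N (nth 0 s i))) => //.
- exact: borel_cosets.
- exact: cosetsI.
- by move=> i; right; exists 0%N, (nth 0 s i).
- apply/seteqP; split=> // x _; have [y ys xy] := sP x.
  by exists (index y s) => //=; rewrite nth_index.
- by move=> B [->|[k [x ->]]]; [rewrite !measure0|exact: m12].
- move=> i; apply: le_lt_trans m1T; apply: le_measure; rewrite ?inE//.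
  exact: coset_measurable.
Qed.

(** The sum lies in a given coset if and only if the summands lie in one of finitely
    many pairs of cosets, so that addition is measurable for the product of the Borel
    algebras. *)
Lemma borel_add_measurable :
  measurable_fun setT (fun z : borel X * borel X => z.1 + z.2 : borel X).
Proof.
apply: (@measurability _ _ _ (borel X) setT _ cosets); first exact: borel_cosets.
move=> _ [A [->|[k [x ->]]] <-].
  by rewrite preimage_set0 setI0; exact: measurable0.
have [s sP] := finite_cosets cX (sV k) (oV k).
rewrite setTI (_ : _ @^-1` _ = \big[setU/set0]_(y <- s) (coset k y `*` coset k (x - y))).
  by apply: bigsetU_measurable => y _; apply: measurableX; exact: coset_measurable.
apply/seteqP; split=> [[a b] /= ab|[a b]].
  have [y ys ay] := sP a; rewrite -bigcup_seq; exists y => //=; split=> //.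
  rewrite /coset /= in ab *.
  by rewrite (_ : b - (x - y) = (a + b - x) - (a - y)); [exact: (sV k).2|zmod].
rewrite -bigcup_seq => -[y /= ys [ay by_]]; rewrite /coset /= in ay by_ *.
by rewrite (_ : a + b - x = (a - y) + (b - (x - y))); [exact: subgroupD|zmod].
Qed.

End Borel.

Section Fibres.
Variables (d : measure_display) (T : measurableType d) (R : realType).
Variables (P : probability T R) (G : finType) (f : T -> G).
Hypothesis mf : forall g, measurable (f @^-1` [set g]).

Local Open Scope ereal_scope.
Lemma sum_fibres A : measurable A ->
  P A = \sum_(g : G) P (A `&` f @^-1` [set g]).
Proof.
move=> mA; have <- : \sum_(g in G) P (A `&` f @^-1` [set g]) = \sum_(g : G) P (A `&` f @^-1` [set g]).
  exact: eq_bigl.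
rewrite big_enum_val -measure_bigsetU_ord.
- congr (P _); apply/seteqP; split=> [x Ax|x].
    rewrite -bigcup_seq; exists (enum_rank (f x)); first by rewrite /= mem_index_enum.
    by split=> //=; rewrite enum_rankK.
  by rewrite -bigcup_seq => -[i _ []].
- by move=> i; apply: measurableI.
- by move=> i j _ _ [x [[_ /= xi] [_ xj]]]; apply: enum_val_inj; rewrite -xi -xj.
Qed.

End Fibres.

(** * A law that is uniform on cosets *)

Definition mfun_of d d' (aT : measurableType d) (rT : measurableType d')
    (f : aT -> rT) (mf : measurable_fun setT f) : {mfun aT >-> rT} :=
  HB.pack f (isMeasurableFun.Build d d' aT rT f mf).

Section Haar.
Variables (R : realType) (X : topologicalZmodType) (V : nat -> set X).
Hypothesis cX : compact [set: X].
Hypothesis V_chain : open_chain V.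
Hypothesis V0 : V 0%N = setT.

Let sV i : subgroup (V i). Proof. by case: V_chain. Qed.
Let oV i : open (V i). Proof. by case: V_chain. Qed.
Let dV i j : (i <= j)%N -> V j `<=` V i. Proof. by case: V_chain => _ _ /(_ i j). Qed.

(** A system of digits: the [q] elements [t j] represent [V k] modulo the next
    subgroup. *)
Let digits k : exists z : nat * (nat -> X), [/\ (0 < z.1)%N, forall j, V k (z.2 j)
  & forall x, V k x -> exists2 j, (j < z.1)%N &
      forall i, (i < z.1)%N -> V k.+1 (z.2 i - x) <-> i = j].
Proof.
have [G [f [fB fs f0]]] := finite_quotient cX (sV k.+1) (oV k.+1).
have fE x y : f x = f y <-> V k.+1 (x - y).
  by rewrite -f0 fB; split=> [->|/eqP]; rewrite ?subrr// subr_eq0 => /eqP.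
pose S := [set g : G | `[< exists2 x, V k x & f x = g >]]%SET.
have inS x : V k x -> f x \in S by move=> Vx; rewrite inE; apply/asboolP; exists x.
have /choice[r rP] (g : G) : exists x, g \in S -> V k x /\ f x = g.
  have [|gS] := boolP (g \in S); last by exists 0.
  by rewrite inE => /asboolP[x Vx fx]; exists x.
pose g i := nth 0 (enum S) i.
have gS i : (i < #|S|)%N -> g i \in S.
  by move=> iS; rewrite /g -mem_enum mem_nth// -cardE.
exists (#|S|, fun i => if (i < #|S|)%N then r (g i) else 0); split=> /=.
- by apply/card_gt0P; exists (f 0); apply: inS; exact: (sV k).1.
- move=> j; case: ifP => [jS|_]; last exact: (sV k).1.
  by case: (rP (g j) (gS j jS)).
- move=> x Vx; have fS := inS x Vx.
  have xe : f x \in enum S by rewrite mem_enum.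
  exists (index (f x) (enum S)); first by rewrite cardE index_mem.
  move=> i iS; rewrite iS -fE; have [_ ->] := rP _ (gS i iS).
  rewrite /g; split=> [<-|->]; last by rewrite nth_index.
  by rewrite index_uniq ?enum_uniq// -cardE.
Qed.

(** The number of digits at position [k] and the digits themselves. *)
Let q k := (projT1 (cid (digits k))).1.
Let t k := (projT1 (cid (digits k))).2.

Let q_gt0 k : (0 < q k)%N.
Proof. by rewrite /q; case: (cid (digits k)) => z []. Qed.

Let tV k j : V k (t k j).
Proof. by rewrite /t; case: (cid (digits k)) => z []. Qed.

Let tP k x : V k x -> exists2 j, (j < q k)%N &
  forall i, (i < q k)%N -> V k.+1 (t k i - x) <-> i = j.
Proof. by have [_ _ h] := projT2 (cid (digits k)) => Vx; exact: h. Qed.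

Let Q k := (\prod_(i < k) q i)%N.

Let QS k : Q k.+1 = (Q k * q k)%N. Proof. by rewrite /Q big_ord_recr. Qed.

Let Q_gt0 k : (0 < Q k)%N. Proof. by rewrite prodn_gt0. Qed.

(** The element with mixed radix expansion [n]. *)
Let Fixpoint rep k n : X :=
  if k is i.+1 then rep i (n %/ q i)%N + t i (n %% q i)%N else 0.

Let repP k x : exists2 J, (J < Q k)%N &
  forall n, (n < Q k)%N -> V k (rep k n - x) <-> n = J.
Proof.
elim: k x => [|k IH] x.
  by exists 0%N => [|n]; rewrite /Q big_ord0// V0 ltnS leqn0 => /eqP ->.
have [J JQ HJ] := IH x.
have VJ : V k (- (rep k J - x)) by apply: subgroupN => //; exact: (HJ J JQ).2.
have [j jq Hj'] := tP VJ.
have Hj i : (i < q k)%N -> V k.+1 (rep k J + t k i - x) <-> i = j.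
  by move=> iq; rewrite -Hj'// (_ : t k i - - _ = rep k J + t k i - x)//; zmod.
exists (J * q k + j)%N.
  rewrite QS; apply: (@leq_trans (J * q k + q k)); first by rewrite ltn_add2l.
  by rewrite -mulSnr leq_mul2r JQ orbT.
move=> n nQ /=.
have n1 : (n %/ q k < Q k)%N by rewrite ltn_divLR// -QS.
have n2 : (n %% q k < q k)%N by rewrite ltn_mod.
split=> [h|->].
  have nJ : (n %/ q k)%N = J.
    apply/(HJ _ n1); have h' := dV (leqnSn k) h.
    rewrite (_ : rep k (n %/ q k)%N - x =
      (rep k (n %/ q k)%N + t k (n %% q k)%N - x) - t k (n %% q k)%N); last zmod.
    by apply: (sV k).2 => //; exact: tV.
  by rewrite [n in LHS](divn_eq n (q k)) nJ; congr (_ + _)%N; apply/Hj; rewrite -?nJ.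
rewrite divnMDl// divn_small// addn0 modnMDl modn_small//.
by apply/Hj.
Qed.

(** The index of the interval of length [1 / Q k] in which [u] falls. *)
Local Notation pos k u := (Num.truncn ((Q k)%:R * u : R)).

Let pos_lt k (u : R) : 0 <= u < 1 -> (pos k u < Q k)%N.
Proof.
move=> /andP[u0 u1]; rewrite truncn_lt_nat ?mulr_ge0//.
by rewrite -[ltRHS]mulr1 ltr_pM2l// ltr0n.
Qed.

Let pos_div k (u : R) : 0 <= u < 1 -> (pos k.+1 u %/ q k)%N = pos k u.
Proof.
move=> /andP[u0 u1]; apply/esym/eqP; rewrite truncn_eq ?mulr_ge0//.
have /truncn_itv/andP[h1 h2] : 0 <= (Q k.+1)%:R * u by rewrite mulr_ge0.
set n := Num.truncn _ in h1 h2 *.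
have qk0 : (0 : R) < (q k)%:R by rewrite ltr0n.
apply/andP; split.
  rewrite -(ler_pM2r qk0) -natrM mulrAC -natrM -QS; apply: le_trans h1.
  by rewrite ler_nat leq_divM.
rewrite -(ltr_pM2r qk0) -natrM mulrAC -natrM -QS; apply: lt_le_trans h2 _.
by rewrite ler_nat ltn_ceil.
Qed.

(** The point of [X] whose successive digits are those of [u] in the mixed radix
    [q 0, q 1, ...]. *)
Let point_exists (u : R) : exists x, 0 <= u < 1 ->
  forall k, V k (x - rep k (pos k u)).
Proof.
have [u01|] := boolP (0 <= u < 1); last by exists 0.
have [x Vx] : exists x, forall k, V k (x - rep k (pos k u)).
  apply: (@nested_closed X (fun k => [set x | V k (x - rep k (pos k u))])) => //.
  - by move=> k; case: (coset_clopen (rep k (pos k u)) (sV k) (oV k)).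
  - by move=> k; exists (rep k (pos k u)) => /=; rewrite subrr; exact: (sV k).1.
  - move=> j k /subnK <-; elim: (k - j)%N => [|n IH]; first by rewrite add0n.
    apply: subset_trans IH => x; rewrite addSn /=; set i := (n + j)%N => Vx.
    have := dV (leqnSn i) Vx; rewrite pos_div// => {}Vx.
    rewrite -(subrK (t i (pos i.+1 u %% q i)%N) (x - _)); apply: subgroupD => //.
    by rewrite -addrA -opprD.
by exists x.
Qed.

Let point u := projT1 (cid (point_exists u)).

Let pointP u k : 0 <= u < 1 -> V k (point u - rep k (pos k u)).
Proof. by rewrite /point; case: cid => x /= /[apply]. Qed.

Let point' u := if 0 <= u < 1 then point u else 0.

(** The points of [`[0, 1[] that are sent to a given coset form one interval of length
    [1 / Q k]. *)
Let cell k x : exists J, (J < Q k)%N /\ forall u, 0 <= u < 1 ->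
  coset V k x (point' u) <-> J%:R / (Q k)%:R <= u < J.+1%:R / (Q k)%:R.
Proof.
have [J JQ HJ] := repP k x; exists J; split=> // u u01.
rewrite /coset /= /point' u01.
have -> : V k (point u - x) <-> V k (rep k (pos k u) - x).
  have h := pointP k u01; split=> h'.
    rewrite (_ : _ - x = (point u - x) - (point u - rep k (pos k u))); last zmod.
    exact: (sV k).2.
  rewrite (_ : _ - x = (point u - rep k (pos k u)) + (rep k (pos k u) - x)); last zmod.
  exact: subgroupD.
rewrite HJ; last exact: pos_lt.
have Q0 : (0 : R) < (Q k)%:R by rewrite ltr0n.
rewrite ler_pdivrMr// ltr_pdivlMr// [u * _]mulrC.
rewrite -truncn_eq; last by case/andP: u01 => u0 _; rewrite mulr_ge0.
by split=> /eqP.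
Qed.

Let U : probability (measurableTypeR R) R := uniform_prob (@ltr01 R).

Let U_itv (a b : R) : 0 <= a -> a < b -> b <= 1 -> U `[a, b[%classic = (b - a)%:E.
Proof.
move=> a0 ab b1; rewrite /U /= /uniform_prob.
rewrite (eq_integral (cst 1%E)); last first.
  move=> x; rewrite inE /= in_itv /= => /andP[ax xb].
  by rewrite /uniform_pdf (le_trans a0 ax) (le_trans (ltW xb) b1)/= subr0 invr1.
by rewrite integral_cst//= mul1e lebesgue_measure_itv /= lte_fin ab.
Qed.

Let U_out (A : set R) : measurable A -> (forall u, A u -> ~ (0 <= u < 1)) -> U A = 0%E.
Proof.
move=> mA nA; have m01 : measurable (`[0%R, 1%R[%classic : set R) by exact: measurable_itv.
have h : U (~` `[0%R, 1%R[%classic) = 0%E.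
  by rewrite probability_setC// U_itv// subr0 subee.
apply/eqP; rewrite eq_le measure_ge0 andbT -h; apply: le_measure; rewrite ?inE//.
- by apply: measurableC.
Qed.

Let cell_le k J : (J < Q k)%N -> J.+1%:R / (Q k)%:R <= 1 :> R.
Proof. by move=> JQ; rewrite ler_pdivrMr ?ltr0n// mul1r ler_nat. Qed.

Let preim_cell k x : exists J (B : set R), [/\ (J < Q k)%N, measurable B,
  forall u, B u -> ~ (0 <= u < 1)
  & point' @^-1` coset V k x = `[J%:R / (Q k)%:R, J.+1%:R / (Q k)%:R[%classic `|` B].
Proof.
have [J [JQ HJ]] := cell k x.
have Q0 : (0 : R) < (Q k)%:R by rewrite ltr0n.
have m01 : measurable (~` `[0%R, 1%R[%classic : set R) by apply: measurableC; exact: measurable_itv.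
have in01 (u : R) : `[J%:R / (Q k)%:R, J.+1%:R / (Q k)%:R[%classic u -> 0 <= u < 1.
  rewrite /= in_itv /= => /andP[h1 h2]; apply/andP; split.
    by apply: le_trans h1; rewrite divr_ge0.
  exact: lt_le_trans h2 (cell_le JQ).
have [x0|nx0] := pselect (coset V k x 0).
  exists J, (~` `[0%R, 1%R[%classic); split; [exact: JQ|exact: m01| |].
    by move=> u /=; rewrite in_itv /=.
  apply/seteqP; split=> u.
    rewrite /preimage /=; have [u01|u01] := boolP (0 <= u < 1); last first.
      by right; rewrite /= in_itv /=; apply/negP.
    by move=> /(HJ _ u01); left; rewrite /= in_itv.
  case=> [uJ|]; first by apply/(HJ _ (in01 _ uJ)); move: uJ; rewrite /= in_itv.
  by rewrite /= in_itv /= => /negP u01; rewrite /preimage /= /point' (negbTE u01).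
exists J, set0; split; [exact: JQ|exact: measurable0|by []|]; rewrite setU0; apply/seteqP; split=> u.
  rewrite /preimage /=; have [u01|u01] := boolP (0 <= u < 1); last first.
    by rewrite /point' (negbTE u01).
  by move=> /(HJ _ u01); rewrite in_itv.
by move=> uJ; apply/(HJ _ (in01 _ uJ)); move: uJ; rewrite /= in_itv.
Qed.

Let point_measurable : measurable_fun setT (point' : measurableTypeR R -> borel X).
Proof.
apply: (@measurability _ _ _ (borel X) setT _ (cosets V)); first exact: borel_cosets.
move=> _ [A [->|[k [x ->]]] <-]; first by rewrite preimage_set0 setI0; exact: measurable0.
have [J [B [_ mB _ ->]]] := preim_cell k x; rewrite setTI.
by apply: measurableU => //; exact: measurable_itv.
Qed.

(** The Haar law is the image of the uniform law on the unit interval under the map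
    that reads the digits of a number as digits in [X]. *)
Lemma uniform_on_cosets : exists m : probability (borel X) R,
  forall k x y, m (coset V k x) = m (coset V k y).
Proof.
exists (distribution U (mfun_of point_measurable : {RV U >-> borel X})).
suff H k x : U (point' @^-1` coset V k x) = ((Q k)%:R^-1)%:E.
  by move=> k x y; rewrite /distribution /= /pushforward !H.
have [J [B [JQ mB Bout ->]]] := preim_cell k x.
have Q0 : (0 : R) < (Q k)%:R by rewrite ltr0n.
set I := `[_, _[%classic; have -> : U (I `|` B) = (U I + U B)%E.
  apply: measureU => //; first exact: measurable_itv.
  apply/seteqP; split=> // u [uJ uB]; apply: (Bout _ uB).
  move: uJ; rewrite /I /= in_itv /= => /andP[h1 h2]; apply/andP; split.
    by apply: le_trans h1; rewrite divr_ge0.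
  exact: lt_le_trans h2 (cell_le JQ).
rewrite (U_out mB Bout) adde0 U_itv.
- by rewrite -mulrBl -natrB// subSnn mul1r.
- by rewrite divr_ge0.
- by rewrite ltr_pM2r ?invr_gt0// ltr_nat.
- exact: cell_le.
Qed.

End Haar.

(** * Haar laws and independence by translation *)

(** Translations permute the cosets at each level, and uniform masses on cosets
    determine the law. *)
Lemma haar_exists (R : realType) (X : topologicalZmodType) : profinite X ->
  exists m : probability (borel X) R, forall (h : X) (A : set (borel X)),
    measurable A -> m ((fun x => x + h) @^-1` A) = m A.
Proof.
move=> [cX hX [V V_chain]]; have [sV oV dV bV] := V_chain.
pose W k := if k is i.+1 then V i else setT.
have W_chain : open_chain W.
  split.
  - by case=> [|k] //; exact: sV.
  - by case=> [|k]; [exact: openT|exact: oV].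
  - by case=> [|j] [|k] //=; rewrite ltnS; exact: dV.
  - by move=> O /bV[k kO]; exists k.+1.
have [m mP] := uniform_on_cosets R cX W_chain erefl.
exists m => h A mA.
have tc : measurable_fun setT ((fun x => x + h) : borel X -> borel X).
  by apply: continuous_borel; exact: translate_continuous.
pose m' : {measure set (borel X) -> \bar R} :=
  distribution m (mfun_of tc : {RV m >-> borel X}).
have := @measure_eq_cosets X W cX W_chain R m m' _ _ A mA.
rewrite /m' /distribution /= /pushforward => ->//.
  by rewrite -ge0_fin_numE// fin_num_measure.
move=> k x; rewrite /distribution /= /pushforward.
rewrite (_ : _ @^-1` _ = coset W k (x - h)); first exact: mP.
apply/seteqP; split=> y; rewrite /coset /preimage /=;
  by rewrite (_ : y + h - x = y - (x - h)); last zmod.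
Qed.

Lemma finite_power_profinite (X : topologicalZmodType) n : profinite X ->
  profinite (direct_product (fun _ : 'I_n => X)).
Proof.
move=> [cX hX [V V_chain]]; have [sV oV dV bV] := V_chain.
pose Y := direct_product (fun _ : 'I_n => X).
apply: (@separating_profinite Y (fun k => [set f : Y | forall i, V k (f i)])).
- move=> k; split=> [i|f g Vf Vg i]; first exact: (sV k).1.
  exact: (sV k).2 (Vf i) (Vg i).
- move=> k; apply: open_subgroup.
    split=> [i|f g Vf Vg i]; first exact: (sV k).1.
    exact: (sV k).2 (Vf i) (Vg i).
  have := @filter_forall Y 'I_n (fun i => [set f : Y | V k (f i)]) (nbhs (0 : Y)) _.
  apply=> i; apply: (@prod_topology_proj_continuous 'I_n (fun _ => X) i (0 : Y) (V k)).
  by apply: open_nbhs_nbhs; split; [exact: oV|exact: (sV k).1].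
- move=> f Vf; apply: functional_extensionality_dep => i.
  by apply: (chain_eq0 V_chain hX) => k; exact: Vf.
- have := @tychonoff 'I_n (fun _ => X) (fun=> setT) (fun _ => cX).
  by rewrite (_ : [set f | _] = setT)//; apply/seteqP.
- by move=> j k jk f Vf i; exact: dV jk _ (Vf i).
Qed.

Section Independence.
Variables (R : realType) (X Y : topologicalZmodType) (V : nat -> set X).
Hypothesis cX : compact [set: X].
Hypothesis V_chain : open_chain V.
Variable m : probability (borel Y) R.
Hypothesis m_inv : forall (h : Y) (A : set (borel Y)),
    measurable A -> m ((fun x => x + h) @^-1` A) = m A.
Variable B : set X.
Hypothesis sB : subgroup B.

Let sV i : subgroup (V i). Proof. by case: V_chain. Qed.
Let oV i : open (V i). Proof. by case: V_chain. Qed.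

Section Peel.
Variables (xi : borel Y -> borel X) (C : set (borel Y)).
Hypothesis mxi : measurable_fun setT xi.
Hypothesis mC : measurable C.
Hypothesis xiB : forall y, B (xi y).
Hypothesis shift : forall t, B t -> exists g : Y,
  (forall y, xi (y + g) = xi y + t) /\ (forall y, C (y + g) <-> C y).

Local Open Scope ereal_scope.

Let mpre A : measurable A -> measurable (xi @^-1` A).
Proof. by move=> mA; rewrite -[_ @^-1` _]setTI; exact: mxi. Qed.

(** The two sides are measures in [A] that are invariant under [B] and carried
    by [B], so they agree on cosets up to the ratio of their total masses. *)
Let indep_coset k x : m (xi @^-1` coset V k x `&` C) = m (xi @^-1` coset V k x) * m C.
Proof.
have [G [f [fB fs f0]]] := finite_quotient cX (sV k) (oV k).
have fE x1 y1 : (f x1 = f y1)%R <-> V k (x1 - y1)%R.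
  by rewrite -f0 fB; split=> [->|/eqP]; rewrite ?subrr// subr_eq0 => /eqP.
have cE x1 : xi @^-1` coset V k x1 = (f \o xi) @^-1` [set f x1].
  by apply/seteqP; split=> y; rewrite /preimage /coset /= fE.
have mf g : measurable ((f \o xi) @^-1` [set g]).
  by have [x1 <-] := fs g; rewrite -cE; apply: mpre; exact: coset_measurable.
rewrite cE; pose F (D : set (borel Y)) g := m ((f \o xi) @^-1` [set g] `&` D).
pose S := [set g : G | `[< exists2 x, B x & f x = g >]]%SET.
have H (D : set (borel Y)) : measurable D ->
    (forall t, B t -> exists g : Y, (forall y, xi (y + g)%R = xi y + t)%R /\
       (forall y, D (y + g)%R <-> D y)) ->
    forall x1, B x1 -> m D = (fine (F D (f x1)) * #|S|%:R)%:E.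
  move=> mD sD x1 Bx1; rewrite (sum_fibres m mf mD) (bigID (mem S)) /=.
  rewrite [X in _ + X]big1 ?adde0; last first.
    move=> g; rewrite inE => /asboolP ng.
    rewrite (_ : _ `&` _ = set0) ?measure0//; apply/seteqP; split=> // y [_ /= yg].
    by apply: ng; exists (xi y).
  rewrite (eq_bigr (fun=> (fine (F D (f x1)))%:E)); last first.
    move=> g; rewrite inE => /asboolP[x2 Bx2 <-].
    have [h [h1 h2]] := sD _ (sB.2 _ _ Bx2 Bx1).
    rewrite fineK ?fin_num_measure//; last exact: measurableI.
    rewrite setIC /F -[LHS](m_inv h); last exact: measurableI.
    congr (m _); apply/seteqP; split=> y; rewrite /preimage /= h1 (homD fB) fB.
      move=> [e /h2 Dy]; split=> //.
      by apply: (@addIr _ (f x2 - f x1)%R); rewrite e addrC subrK.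
    by move=> [-> Dy]; split; [rewrite addrC subrK|apply/h2].
  by rewrite sumEFin sumr_const mulr_natr.
have sT t : B t -> exists g : Y, (forall y, xi (y + g)%R = xi y + t)%R /\
    (forall y : borel Y, setT (y + g)%R <-> setT y).
  by move=> /shift[g [g1 _]]; exists g.
have [[x1 Bx1 <-]|nx] := pselect (exists2 x1, B x1 & f x1 = f x); last first.
  have -> : (f \o xi) @^-1` [set f x] = set0.
    by apply/seteqP; split=> // y /= yx; apply: nx; exists (xi y).
  by rewrite set0I measure0 mul0e.
have HC := H C mC shift x1 Bx1; have HT := H setT measurableT sT x1 Bx1.
rewrite -/(F C (f x1)) HC -[(f \o xi) @^-1` _]setIT -/(F setT (f x1)).
have fin D : measurable D -> F D (f x1) \is a fin_num.
  by move=> mD; rewrite fin_num_measure//; exact: measurableI.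
rewrite -(fineK (fin _ mC)) -(fineK (fin _ measurableT)) /= -EFinM; congr _%:E.
move: HT; rewrite probability_setT => -[e1].
by rewrite mulrCA -e1 mulr1.
Qed.

(** The event [C] is independent of [xi] when translations of [Y] can shift [xi] by any
    element of [B] without affecting [C]. *)
Lemma indep_peel A : measurable A -> m (xi @^-1` A `&` C) = m (xi @^-1` A) * m C.
Proof.
move=> mA.
pose m1f : {measure set (borel X) -> \bar R} := pushforward (mrestr m mC) xi.
pose m1 := m1f mxi.
have mC0 : (0 <= fine (m C))%R by rewrite fine_ge0.
pose m0f : {measure set (borel X) -> \bar R} := pushforward m xi.
pose m2 : {measure set (borel X) -> \bar R} := mscale (NngNum mC0) (m0f mxi).
have E1 D : m1 D = m (xi @^-1` D `&` C) by [].
have E2 D : m2 D = m (xi @^-1` D) * m C.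
  have -> : m2 D = (fine (m C))%:E * m (xi @^-1` D) by [].
  by rewrite fineK ?fin_num_measure// muleC.
rewrite -E1 -E2; apply: (measure_eq_cosets cX V_chain) => //.
  by rewrite E1 -ge0_fin_numE// fin_num_measure//; apply: measurableI => //; exact: mpre.
by move=> k x; rewrite E1 E2; exact: indep_coset.
Qed.

End Peel.

(** Translations that shift one coordinate do not affect events that involve only the
    others, so [indep_peel] splits off the coordinates one at a time; a single
    exceptional one may come last. *)
Lemma shift_independent n (Xi : 'I_n -> borel Y -> borel X) (ok : pred 'I_n) :
  (forall j, measurable_fun setT (Xi j)) ->
  (forall j j', ~~ ok j -> ~~ ok j' -> j = j') ->
  (forall j y, ok j -> B (Xi j y)) ->
  (forall j t, ok j -> B t -> exists g : Y, (forall y, Xi j (y + g) = Xi j y + t) /\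
     forall j' y, j' != j -> Xi j' (y + g) = Xi j' y) ->
  mutually_independent m Xi.
Proof.
move=> mXi one XiB shift J A mA.
have mpre j : measurable (Xi j @^-1` A j) by rewrite -[_ @^-1` _]setTI; exact: mXi.
elim: {J}_.+1 {-2}J (ltnSn #|J|) => // k IH J Jk.
have [/existsP[j /andP[jJ okj]]|/existsPn nok] := boolP [exists j, (j \in J) && ok j].
  rewrite (big_setD1 j jJ) /=.
  have -> : \bigcap_(i in [set` J]) (Xi i @^-1` A i) =
      Xi j @^-1` A j `&` \bigcap_(i in [set` (J :\ j)%SET]) (Xi i @^-1` A i).
    apply/seteqP; split=> y.
      by move=> h; split=> [|i /=]; [exact: h|rewrite !inE => /andP[_ iJ]; exact: h].
    move=> [h1 h2] i /= iJ; have [->//|ij] := eqVneq i j.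
    by apply: h2; rewrite /= !inE ij.
  rewrite indep_peel//.
  - by rewrite IH//; move: Jk; rewrite (cardsD1 j J) jJ add1n ltnS.
  - by apply: fin_bigcap_measurable => [|i _]; [exact: finite_finset|exact: mpre].
  - by move=> y; exact: XiB.
  - move=> t Bt; have [g [g1 g2]] := shift j t okj Bt; exists g; split=> // y.
    split=> h i /= ij; move: (ij) (h i ij); rewrite !inE => /andP[ij' _].
      by rewrite /preimage /= g2.
    by rewrite /preimage /= g2.
have [J0|[j jJ]] := set_0Vmem J.
  rewrite J0 big_set0 (_ : \bigcap_(i in _) _ = setT) ?probability_setT//.
  by apply/seteqP; split=> // y _ i /=; rewrite inE.
have -> : J = [set j]%SET.
  apply/setP => i; rewrite inE; apply/idP/eqP => [iJ|->//].
  by apply: one; [have := nok i; rewrite iJ|have := nok j; rewrite jJ].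
rewrite big_set1 (_ : \bigcap_(i in _) _ = Xi j @^-1` A j)//.
apply/seteqP; split=> y; first by apply; rewrite /= inE.
by move=> h i /=; rewrite inE => /eqP ->.
Qed.

End Independence.

(** * Gaussian laws and characters of finite order *)

(** The parallelogram law gives [phi (u *+ k) = k ^+ 2 * phi u]. *)
Lemma quadratic_torsion (R : realType) (Y : zmodType) (phi : Y -> R) u p :
  (forall u v, phi (u + v) + phi (u - v) = 2 * phi u + 2 * phi v) ->
  (0 < p)%N -> u *+ p = 0 -> phi u = 0.
Proof.
move=> par p0 up.
have phi0 : phi 0 = 0 by have := par 0 0; rewrite addr0 subr0; lra.
have sq k : phi (u *+ k) = k%:R ^+ 2 * phi u /\ phi (u *+ k.+1) = k.+1%:R ^+ 2 * phi u.
  elim: k => [|k [IH1 IH2]].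
    by rewrite mulr0n mulr1n phi0 expr0n mul0r expr1n mul1r.
  split=> //; have := par (u *+ k.+1) u.
  rewrite -mulrSr [in X in _ + phi X]mulrSr addrK IH1 IH2 => h.
  have -> : phi (u *+ k.+2) = 2 * (k.+1%:R ^+ 2 * phi u) + 2 * phi u - k%:R ^+ 2 * phi u.
    by rewrite -h addrK.
  by rewrite -!natr1; ring.
have [/eqP + _] := sq p; rewrite up phi0 eq_sym mulf_eq0 expf_eq0 /= pnatr_eq0.
by rewrite eqn0Ngt p0 /= => /eqP.
Qed.

Lemma root_of_unity (R : realType) p : prime p ->
  exists z : R[i], z ^+ p = 1 /\ forall k, (0 < k < p)%N -> z ^+ k != 1.
Proof.
move=> pp; have p1 := prime_gt1 pp; have p0 := prime_gt0 pp.
pose q : {poly R[i]} := \poly_(i < p) 1.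
have /closed_rootP[z /rootP qz] : size q != 1%N.
  by rewrite /q size_poly_eq ?oner_eq0// neq_ltn p1 orbT.
have zp : z ^+ p = 1.
  apply/eqP; rewrite -subr_eq0 subrX1; move: qz; rewrite horner_poly.
  by under eq_bigr do rewrite mul1r; move=> ->; rewrite mulr0.
have z1 : z != 1.
  apply/eqP => z1; move: qz; rewrite horner_poly z1.
  under eq_bigr do rewrite mul1r expr1n.
  rewrite sumr_const card_ord => /eqP; rewrite pnatr_eq0 => /eqP h.
  by rewrite h in p0.
exists z; split=> // k /andP[k0 kp]; apply/eqP => zk; move/eqP: z1; apply.
have cop : coprime k p by rewrite coprime_sym prime_coprime// gtnNdvd.
have [u v uv _] := egcdnP p k0.
have : z ^+ (u * k) = z ^+ (v * p + 1) by rewrite uv (eqP cop).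
by rewrite mulnC exprM zk expr1n addn1 exprS mulnC exprM zp expr1n mulr1.
Qed.

Lemma cst_on_fibres_continuous (X T : topologicalType) (G : zmodType)
    (chi : X -> discrete_topology G) (g : G -> T) :
  continuous chi -> continuous (fun x => g (chi x)).
Proof.
move=> cc x A nA.
have : nbhs (chi x) [set chi x].
  by apply: open_nbhs_nbhs; split=> //; exact: discrete_open.
move/(cc x); apply: (@filterS _ (nbhs x)) => y /= ->; exact: nbhs_singleton.
Qed.

Lemma discrete_preimage_open (X : topologicalType) (G : zmodType)
    (chi : X -> discrete_topology G) (B : set G) : continuous chi -> open (chi @^-1` B).
Proof.
move=> cc; apply: (open_comp (f := chi) (D := (B : set (discrete_topology G)))).
  by move=> x _; exact: cc.
exact: discrete_open.
Qed.

Section GaussianCharacter.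
Variables (R : realType) (X : topologicalZmodType) (p : nat) (p_prime : prime p).
Variable chi : X -> discrete_topology 'Z_p.
Hypothesis chiB : zmod_morphism chi.
Hypothesis chic : continuous chi.
Let p_gt1 := prime_gt1 p_prime.

Let measurable_fibre (B : set 'Z_p) : measurable (chi @^-1` B : set (borel X)).
Proof. by apply: open_borel; exact: discrete_preimage_open. Qed.

Let measurable_on_fibres (g : 'Z_p -> R) :
  measurable_fun setT ((fun x => g (chi x)) : borel X -> R).
Proof.
move=> _ B mB; rewrite setTI.
exact: (measurable_fibre (g @^-1` B)).
Qed.

Let integrable_on_fibres (gamma : probability (borel X) R) (g : 'Z_p -> R) :
  gamma.-integrable setT (EFin \o (fun x : borel X => g (chi x))).
Proof.
apply: measurable_bounded_integrable => //; last first.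
  exists (\sum_(a : 'Z_p) `|g a|); split; first exact: num_real.
  move=> M hM x _ /=; apply: le_trans (ltW hM).
  by rewrite (bigD1 (chi x))//= lerDl sumr_ge0.
by rewrite -ge0_fin_numE// fin_num_measure.
Qed.

(** The value of the quadratic form at a character of finite order is zero, so
    the mean of that character under a Gaussian law has modulus one, and the
    character is almost surely constant. *)
Lemma gaussian_degenerate (gamma : probability (borel X) R) : Gaussian gamma ->
  exists a0 : 'Z_p, forall a, a != a0 -> gamma (chi @^-1` [set a]) = 0%E.
Proof.
move=> [x0 [phi [phic phi0 par chf]]].
have [z [zp zk]] := root_of_unity R p_prime.
have z_norm k : `|z ^+ k| = 1.
  have : `|z| ^+ p == 1 by rewrite -normrX zp normr1.
  by rewrite pexpr_eq1 ?(prime_gt0 p_prime)// => /eqP z1; rewrite normrX z1 expr1n.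
pose e (a : 'Z_p) : R[i] := z ^+ a.
have eD a b : e (a + b) = e a * e b.
  by rewrite /e -exprD /= [X in (_ %% X)%N]Zp_cast// expr_mod.
have ech : is_character (fun x => e (chi x) : R[i]^o).
  split=> [|x|x y]; [exact: cst_on_fibres_continuous|exact: z_norm|].
  by rewrite (homD chiB) eD.
pose y : char_group R X := exist (fun f => f \in is_character (R:=R) (X:=X)) _ (mem_set ech).
have yp : y *+ p = 0.
  have yE k x : val (y *+ k) x = e (chi x) ^+ k.
    elim: k => [|k IH]; first by rewrite mulr0n expr0.
    by rewrite mulrS exprS -IH.
  apply/val_inj/funext => x; rewrite yE /e -exprM mulnC exprM zp expr1n //.
have phiy : phi y = 0 by apply: quadratic_torsion yp; rewrite ?prime_gt0.
exists (chi x0) => a a0.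
have := chf y; rewrite phiy oppr0 expR0 /pairing /= mulr1 => chy.
pose w := e (chi x0).
have chRe : \int[gamma]_x complex.Re (e (chi x)) = complex.Re w.
  by have := congr1 (@complex.Re R) chy.
have chIm : \int[gamma]_x complex.Im (e (chi x)) = complex.Im w.
  by have := congr1 (@complex.Im R) chy.
(* [h b] is the cosine of the angle between [e b] and the mean [w]: it is at most 1,
   with equality only for [e b = w], and its mean is 1. *)
pose h b : R := complex.Re w * complex.Re (e b) + complex.Im w * complex.Im (e b).
have normE b : complex.Re (e b) ^+ 2 + complex.Im (e b) ^+ 2 = 1.
  have := z_norm b; rewrite -/(e b); case: (e b) => re im /= => -[] h1.
  by rewrite -(@sqr_sqrtr _ (re ^+ 2 + im ^+ 2)) ?addr_ge0 ?sqr_ge0// h1 expr1n.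
have hE b : 1 - h b = ((complex.Re w - complex.Re (e b)) ^+ 2 +
    (complex.Im w - complex.Im (e b)) ^+ 2) / 2.
  by have := normE b; have := normE (chi x0); rewrite -/w /h => h1 h2; lra.
have h_le1 b : 0 <= 1 - h b by rewrite hE divr_ge0// addr_ge0// sqr_ge0.
have e_inj b : e b = w -> b = chi x0.
  move=> eb; apply/eqP; rewrite -subr_eq0; apply/eqP.
  have w0 : w != 0 by rewrite -normr_eq0 /w z_norm oner_neq0.
  have e1 : e (b - chi x0) = 1.
    by apply: (mulIf w0); rewrite mul1r {1}/w -eD subrK.
  apply/eqP; apply: contraT => n0.
  have := zk (b - chi x0 : 'Z_p); rewrite -/(e (b - chi x0)) e1 eqxx; apply.
  rewrite lt0n; apply/andP; split.
    by apply: contra n0 => /eqP n0; apply/eqP/val_inj.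
  by rewrite -[X in (_ < X)%N]Zp_cast.
have c_gt0 : 0 < 1 - h a.
  rewrite lt_neqAle h_le1 andbT eq_sym; apply: contra a0 => /eqP ha0.
  apply/eqP/e_inj; move: ha0; rewrite hE => /eqP; rewrite mulf_eq0 invr_eq0.
  rewrite (negbTE (_ : (2 : R) != 0)) ?pnatr_eq0// orbF paddr_eq0 ?sqr_ge0//.
  rewrite !sqrf_eq0 !subr_eq0 => /andP[/eqP].
  by case: (w) (e a) => u v [r s] /= -> /eqP ->.
have int0 : \int[gamma]_x (1 - h (chi x)) = 0.
  rewrite RintegralB//; last 2 first.
  - exact: (integrable_on_fibres gamma (fun=> 1)).
  - exact: (integrable_on_fibres gamma h).
  rewrite Rintegral_cst//= probability_setT mulr1 /h RintegralD//; last 2 first.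
  - exact: (integrable_on_fibres gamma (fun b => complex.Re w * complex.Re (e b))).
  - exact: (integrable_on_fibres gamma (fun b => complex.Im w * complex.Im (e b))).
  rewrite !RintegralZl//; last 2 first.
  - exact: (integrable_on_fibres gamma (fun b => complex.Im (e b))).
  - exact: (integrable_on_fibres gamma (fun b => complex.Re (e b))).
  by rewrite chRe chIm -!expr2 normE subrr.
have mF := measurable_fibre [set a].
have intF : \int[gamma]_x ((1 - h a) * (chi x == a)%:R) =
    (1 - h a) * fine (gamma (chi @^-1` [set a])).
  rewrite RintegralZl//; last exact: (integrable_on_fibres gamma (fun b => (b == a)%:R)).
  congr (_ * _); rewrite /Rintegral; congr fine.
  rewrite -[in RHS](setIT (chi @^-1` [set a])) -integral_indic//.
  apply: eq_integral => x _; rewrite indicE; congr (_%:R)%:E.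
  by congr nat_of_bool; apply/eqP/idP => [h1|]; rewrite ?inE//; move=> /set_mem.
have : (1 - h a) * fine (gamma (chi @^-1` [set a])) <= 0.
  rewrite -int0 -intF; apply: le_Rintegral => //.
  - exact: (integrable_on_fibres gamma (fun b => (1 - h a) * (b == a)%:R)).
  - exact: (integrable_on_fibres gamma (fun b => 1 - h b)).
  - move=> x _; have [->|_] := eqVneq (chi x) a; first by rewrite mulr1.
    by rewrite mulr0.
rewrite pmulr_rle0// => le0.
have ge0 : 0 <= fine (gamma (chi @^-1` [set a])) by rewrite fine_ge0.
rewrite -[LHS]fineK ?fin_num_measure//; congr _%:E.
by apply/eqP; rewrite eq_le le0 ge0.
Qed.

End GaussianCharacter.

(** * Masses of the fibres of a character *)

Section Fibres.
Variables (R : realType) (X : topologicalZmodType) (p : nat) (p_prime : prime p).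
Hypothesis hX : hausdorff_space X.
Variable chi : X -> discrete_topology 'Z_p.
Hypothesis chiB : zmod_morphism chi.
Hypothesis chic : continuous chi.
Implicit Types mu nu m : probability (borel X) R.
Let p_gt1 := prime_gt1 p_prime.
Local Open Scope ereal_scope.

Definition fibre (a : 'Z_p) : set (borel X) := chi @^-1` [set a].

Lemma fibre_measurable a : measurable (fibre a).
Proof. by apply: open_borel; exact: discrete_preimage_open. Qed.

Lemma sum_fibre mu (A : set (borel X)) : measurable A ->
  mu A = \sum_(a : 'Z_p) mu (A `&` fibre a).
Proof. by move=> mA; apply: sum_fibres => // a; exact: fibre_measurable. Qed.

Lemma convolution_fibre mu nu b :
  convolution mu nu (fibre b) = \int[mu]_x nu (fibre (b - chi x)%R).
Proof.
rewrite /convolution /pushforward /product_measure1; apply: eq_integral => x _ /=.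
congr (nu _); apply/seteqP; split=> y; rewrite /xsection /fibre /preimage /= ?inE /=.
  by rewrite (homD chiB) => <-; rewrite addrAC subrr add0r.
by rewrite (homD chiB) => ->; rewrite addrC subrK.
Qed.

Lemma shifted_fibre mu nu x b :
  (forall A, measurable A -> nu A = convolution mu (dirac x : probability (borel X) R) A) ->
  nu (fibre b) = mu (fibre (b - chi x)%R).
Proof.
move=> E; rewrite E; last exact: fibre_measurable.
rewrite convolution_fibre -(setIT (fibre (b - chi x)%R)) -integral_indic//; last exact: fibre_measurable.
apply: eq_integral => y _; rewrite /= diracE indicE; congr (_%:R)%:E.
congr nat_of_bool; apply/idP/idP => /set_mem; rewrite /fibre /preimage /= => h; apply/mem_set.
  by rewrite /= h subKr.
by rewrite /= h subKr.
Qed.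

(** The restriction of [chi] to [H] is either trivial or onto the group of prime
    order; in the second case translations by [H] permute the fibres transitively. *)
Lemma haar_fibre (H : set X) m : compact H ->
  (H 0%R /\ (forall a b, H a -> H b -> H (a - b)%R)) -> is_haar H m ->
  (forall a, m (fibre a) = (a == 0%R)%:R%:E) \/ (forall a, m (fibre a) = (p%:R^-1)%:E).
Proof.
move=> cH sH [mH inv].
have mmH : measurable (H : set (borel X)).
  by apply: closed_borel; exact: compact_closed.
have mHa a : m (fibre a) = m (H `&` fibre a).
  have mF := fibre_measurable a.
  have nH : m (~` H) = 0 by rewrite probability_setC// mH subee.
  rewrite -{1}(setIT (fibre a)) -(setUv H) setIUr measureU//; last 3 first.
  - exact: measurableI.
  - by apply: measurableI => //; exact: measurableC.
  - by rewrite setIACA setICr setI0.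
  rewrite [X in _ + X](_ : _ = 0) ?adde0 1?setIC//.
  apply/eqP; rewrite eq_le measure_ge0 andbT -nH; apply: le_measure; rewrite ?inE//.
  - by apply: measurableI => //; exact: measurableC.
  - exact: measurableC.
have [[h [Hh ch]]|nh] := pselect (exists h, H h /\ chi h <> 0%R); last first.
  left=> a; rewrite mHa; have [->|a0] := eqVneq a 0%R.
    rewrite (_ : H `&` _ = H) ?mH//; apply/setIidPl => x Hx.
    by apply: contrapT => cx; apply: nh; exists x.
  rewrite (_ : H `&` _ = set0) ?measure0//; apply/seteqP; split=> // x [Hx xa].
  apply: nh; exists x; split=> // x0; move/eqP: a0; apply.
  by rewrite -x0 -xa.
right; have shift a : m (fibre (a + chi h)%R) = m (fibre a).
  rewrite !mHa -[RHS](inv h)//; last exact: measurableI (fibre_measurable a).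
  congr (m _); apply/seteqP; split=> x.
    move=> [Hx xa]; exists (x - h)%R; last by rewrite addrC subrK.
    split; first exact: sH.2.
    by rewrite /fibre /preimage /= chiB xa addrK.
  move=> [y [Hy ya] <-]; split; first exact: (subgroupD sH).
  by rewrite /fibre /preimage /= (homD chiB) ya addrC.
have shiftn a k : m (fibre (a + chi h *+ k)%R) = m (fibre a).
  by elim: k => [|k IH]; rewrite ?mulr0n ?addr0// mulrSr addrA shift.
pose c : 'Z_p := chi h.
have c_gt0 : (0 < c)%N by rewrite lt0n; apply/eqP => c0; apply: ch; exact/val_inj.
have cp : coprime c p.
  rewrite coprime_sym prime_coprime// gtnNdvd//.
  by rewrite -[X in (_ < X)%N](Zp_cast p_gt1).
have all0 a : m (fibre a) = m (fibre 0%R).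
  have [u v uv _] := egcdnP p c_gt0.
  have c1 : (c *+ u = 1 :> 'Z_p)%R.
    rewrite -[c in LHS]natr_Zp -mulrnA mulnC uv (eqP cp) addn1 mulrS.
    by rewrite mulnC mulrnA -[(1 *+ p)%R]/(p%:R : 'Z_p)%R char_Zp// mul0rn addr0.
  rewrite -(shiftn 0%R (u * (a : nat))%N) add0r -/c mulrnA c1.
  by congr (m (fibre _)); apply/esym; exact: natr_Zp.
have fin := fin_num_measure m _ (fibre_measurable 0%R).
have e1 : (1 = fine (m (fibre 0)) * p%:R)%R.
  have := sum_fibre m mmH; rewrite mH.
  under eq_bigr do rewrite -mHa all0 -(fineK fin).
  by rewrite sumEFin sumr_const card_ord Zp_cast// => -[e]; rewrite mulr_natr.
move=> a; rewrite all0 -(fineK fin); congr _%:E.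
have p0 : (p%:R : R) != 0%R by rewrite pnatr_eq0 -lt0n prime_gt0.
by apply: (mulIf p0); rewrite -e1 mulVf.
Qed.

(** The Gaussian factor is concentrated on one fibre and a point mass shifts the
    fibres, so the masses are those of the Haar factor up to a permutation. *)
Lemma gaussian_haar_fibre mu : Gaussian_conv_shifted_haar mu ->
  (forall a, mu (fibre a) = 0 \/ mu (fibre a) = 1) \/
  (forall a, mu (fibre a) = (p%:R^-1)%:E).
Proof.
move=> [gamma Gg [nu [H [m [x [cH sH haar nuE]]]] muE]].
have [a0 ga] := gaussian_degenerate p_prime chiB chic Gg.
have g1 : gamma (fibre a0) = 1.
  rewrite -(probability_setT gamma) (sum_fibre gamma measurableT).
  under eq_bigr do rewrite setTI.
  by rewrite (bigD1 a0)//= big1 ?adde0// => a aa0; exact: ga.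
have mu_fibre b : mu (fibre b) = \int[gamma]_y nu (fibre (b - chi y)%R).
  by rewrite muE ?convolution_fibre//; exact: fibre_measurable.
have [mp|mu'] := haar_fibre cH sH haar.
  left=> b; have -> : mu (fibre b) = gamma (fibre (b - chi x)%R).
    rewrite mu_fibre -(setIT (fibre (b - chi x)%R)) -integral_indic//; last exact: fibre_measurable.
    apply: eq_integral => y _; rewrite (shifted_fibre _ nuE) mp indicE; congr (_%:R)%:E.
    congr nat_of_bool; apply/idP/idP => [/eqP h|/set_mem h].
      apply/mem_set; rewrite /fibre /preimage /=; apply/eqP.
      by rewrite eq_sym -subr_eq0; apply/eqP; rewrite -[RHS]h; zmod.
    by rewrite h; apply/eqP; rewrite subKr subrr.
  have [<-|h] := eqVneq a0 (b - chi x)%R; first by right.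
  by left; apply: ga; rewrite eq_sym.
right=> b; rewrite mu_fibre.
rewrite (eq_integral (cst ((p%:R^-1)%:E))); last first.
  by move=> y _; rewrite (shifted_fibre _ nuE) mu'.
by rewrite integral_cst//= probability_setT mule1.
Qed.

End Fibres.

(** * Independent forms in infinite rank *)

Definition skitovich_darmois (R : realType) (X : topologicalZmodType) (n : nat) : Prop :=
  forall (d : measure_display) (Omega : measurableType d)
      (P : probability Omega R) (xi : 'I_n -> {RV P >-> borel X})
      (alpha : 'I_n -> 'I_n -> X -> X),
    (forall i j, top_automorphism (alpha i j)) ->
    mutually_independent P (fun i => xi i : Omega -> borel X) ->
    mutually_independent P
      (fun j => (fun w => \sum_(i < n) alpha i j (xi i w)) :
         Omega -> borel X) ->
    forall i, Gaussian_conv_shifted_haar (distribution P (xi i)).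

Section Counterexample.
Variables (R : realType) (X : topologicalZmodType) (n p : nat).
Hypothesis n_ge2 : (2 <= n)%N.
Hypothesis p_prime : prime p.
Hypothesis X_profinite : profinite X.
Variable D : shift_data X p.

Let cX : compact [set: X]. Proof. by case: X_profinite. Qed.
Let hX : hausdorff_space X. Proof. by case: X_profinite. Qed.

Let Y := direct_product (fun _ : 'I_n.+1 => X).

Let i0 : 'I_n := Ordinal (ltn_trans (ltnSn 0) n_ge2).
Let i1 : 'I_n := Ordinal n_ge2.
Let i10 : i1 != i0. Proof. by []. Qed.

Let c (i : 'I_n) (y : Y) : X := y (lift ord0 i).
Let c_cont i : continuous (c i).
Proof. exact: (@prod_topology_proj_continuous _ (fun _ : 'I_n.+1 => X) (lift ord0 i)). Qed.

(** An event of probability [p ^ -2], independent of the other coordinates. *)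
Let ind (y : Y) : bool := (chi0 D (y ord0) == 0) && (chi1 D (y ord0) == 0).

(** On the Haar space of the [n.+1]-st power of [X], the first variable is uniform on
    [small] apart from a shift by [d0] that occurs with probability [p ^ -2], and the
    others are uniform on [big]. *)
Let xi (i : 'I_n) (y : Y) : X :=
  if i == i0 then proj_small D (c i y) + (if ind y then d0 D else 0)
  else proj_big D (c i y).

Let Z := finite_product 'Z_p 'Z_p.
Let chi (y : Y) : discrete_topology Z := (chi0 D (y ord0), chi1 D (y ord0)).

Let chiB : zmod_morphism chi.
Proof. by move=> x y; congr (_, _); [exact: (chi0B D)|exact: (chi1B D)]. Qed.

Let chi_cont : continuous chi.
Proof.
have [_ _ [W W_chain]] := discrete_profinite Z.
apply: (hom_continuous chiB W_chain) => k.
exists ((fun y : Y => y ord0) @^-1` (chi0 D @^-1` [set 0] `&` chi1 D @^-1` [set 0])).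
  apply: open_nbhs_nbhs; split; last first.
    by split; rewrite /preimage /= ?(hom0 (@chi0B _ _ D)) ?(hom0 (@chi1B _ _ D)).
  apply: open_comp.
    by move=> y _; exact: (@prod_topology_proj_continuous _ (fun _ : 'I_n.+1 => X) ord0).
  by apply: openI; apply: discrete_preimage_open; [exact: chi0_cont|exact: chi1_cont].
move=> y [h0 h1]; rewrite (_ : chi y = 0); last by congr (_, _).
by case: W_chain => sW _ _ _; exact: (sW k).1.
Qed.

Let ind_cont : continuous (fun y => if ind y then d0 D else 0).
Proof.
exact: (@cst_on_fibres_continuous Y X Z chi (fun z : 'Z_p * 'Z_p =>
  if (z.1 == 0) && (z.2 == 0) then d0 D else 0) chi_cont).
Qed.

Let xi_cont i : continuous (xi i).
Proof.
rewrite /xi; case: (i == i0); last first.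
  move=> y; apply: (@continuous_comp _ _ _ (c i) (proj_big D)); first exact: c_cont.
  exact: proj_big_cont.
apply: hom_add_continuous; last exact: ind_cont.
move=> y; apply: (@continuous_comp _ _ _ (c i) (proj_small D)); first exact: c_cont.
exact: proj_small_cont.
Qed.

Let xi_big i y : big D (xi i y).
Proof.
rewrite /xi; case: ifP => _; last exact: proj_big_in.
apply: subgroupD; first exact: big_subgroup.
  by apply: small_big; exact: proj_small_in.
by case: ifP => _; [exact: big_d0|exact: (big_subgroup D).1].
Qed.

(** The projections are the identity on their images, and the translation leaves the
    extra coordinate, hence the event, unchanged. *)
Let translation (tau : 'I_n -> X) : small D (tau i0) -> (forall i, big D (tau i)) ->
  exists g : Y, forall i y, xi i (y + g) = xi i y + tau i.
Proof.
move=> ts tb.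
exists (fun i => if unlift ord0 i is Some j then tau j else 0) => i y.
have cE : c i (y + (fun i => if unlift ord0 i is Some j then tau j else 0) : Y) = c i y + tau i.
  by rewrite /c -[LHS]/(y (lift ord0 i) + (if unlift ord0 (lift ord0 i) is Some j then tau j else 0)) liftK.
have ind0 : ind (y + (fun i => if unlift ord0 i is Some j then tau j else 0) : Y) = ind y.
  rewrite /ind (_ : (y + _ : Y) ord0 = y ord0)//.
  by rewrite -[LHS]/(y ord0 + (if unlift ord0 ord0 is Some j then tau j else 0)) unlift_none addr0.
rewrite /xi cE ind0; case: eqP => [ii|_].
  rewrite (homD (@proj_smallB _ _ D)) (@proj_small_id _ _ D (tau i)) ?ii//; zmod.
by rewrite (homD (@proj_bigB _ _ D)) (proj_big_id (tb i)).
Qed.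

(** All coefficients are the identity, except for [alpha] on the diagonal outside of
    the first variable. *)
Let al (i j : 'I_n) : X -> X := if (i == j) && (i != i0) then alpha D else id.

Let al_aut i j : top_automorphism (al i j).
Proof.
rewrite /al; case: ifP => _; first exact: alpha_aut.
split=> //; first by move=> x; exact: cvg_id.
by exists id; split=> // x; exact: cvg_id.
Qed.

Let alB i j : zmod_morphism (al i j). Proof. by case: (al_aut i j). Qed.
Let al_cont i j : continuous (al i j). Proof. by case: (al_aut i j). Qed.

Let L (j : 'I_n) (y : Y) : X := \sum_(i < n) al i j (xi i y).

Let aB : zmod_morphism (alpha D). Proof. by case: (alpha_aut D). Qed.

(** The system of shifts is triangular: subtracting the first equation from the
    others leaves [tau j - alpha (tau j) = w i0 - w j], which is solvable in [small]. The
    first equation then determines [tau i0] in [big]; a fixed point [e] of [alpha], moved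
    from [i0] to [i1], brings it into [small]. *)
Let solve (w : 'I_n -> X) : (forall j, big D (w j)) ->
  exists tau : 'I_n -> X, [/\ small D (tau i0), forall i, big D (tau i)
  & forall j, \sum_(i < n) al i j (tau i) = w j].
Proof.
move=> wb; have sB := big_subgroup D.
have /choice[s sP] i : exists x, small D x /\ x - alpha D x = w i0 - w i.
  have [|x xs xE] := @alpha_onto _ _ D (w i0 - w i); first exact: sB.2.
  by exists x.
pose t0 := w i0 - \sum_(i < n | i != i0) s i.
have t0b : big D t0.
  apply: sB.2 => //; apply: subgroup_sum => // i _.
  by apply: small_big; case: (sP i).
have [e [eb ee es]] := alpha_adjust t0b.
pose tau i := if i == i0 then t0 - e else if i == i1 then s i + e else s i.
have tb i : big D (tau i).
  have sb : big D (s i) by apply: small_big; case: (sP i).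
  rewrite /tau; case: ifP => _; first exact: sB.2.
  by case: ifP => // _; exact: subgroupD.
have sum_tau : \sum_(i < n) tau i = w i0.
  rewrite (bigD1 i0)//= (bigD1 i1)//= /tau eqxx (negbTE i10) eqxx.
  rewrite (eq_bigr s); last by move=> i /andP[/negbTE -> /negbTE ->].
  by rewrite /t0 (bigD1 i1)//=; set S := \sum_(i < n | _) _; zmod.
have ker i : i != i0 -> tau i - alpha D (tau i) = w i0 - w i.
  move=> ii0; rewrite /tau (negbTE ii0); have [_ <-] := sP i.
  by case: ifP => // _; rewrite (homD aB) ee; zmod.
exists tau; split=> // j.
rewrite (bigD1 j)//= {1}/al eqxx /=.
rewrite (eq_bigr tau); last by move=> i /negbTE ij; rewrite /al ij.
have := sum_tau; rewrite (bigD1 j)//= => /(canRL (addKr _)) ->.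
case: ifP => [jj|/negbFE/eqP ->] /=; last zmod.
have wj := ker _ jj; rewrite (_ : w j = w i0 - (w i0 - w j)); last by zmod.
by rewrite -wj; zmod.
Qed.

Let L_big j y : big D (L j y).
Proof.
apply: subgroup_sum => [|i _]; first exact: big_subgroup.
by rewrite /al; case: ifP => _; [apply: alpha_big|]; exact: xi_big.
Qed.

(** All [p ^ 2] fibres of [chi] are translates of each other. *)
Let ind_mass (m : probability (borel Y) R) :
  (forall (h : Y) (A : set (borel Y)), measurable A -> m ((fun x => x + h) @^-1` A) = m A) ->
  (m [set y | ind y] *+ (p * p) = 1)%E.
Proof.
move=> m_inv; have p1 := prime_gt1 p_prime.
have mf z : measurable (chi @^-1` [set z] : set (borel Y)).
  by apply: open_borel; apply: discrete_preimage_open.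
have ind0 : [set y | ind y] = chi @^-1` [set 0].
  apply/seteqP; split=> y; rewrite /ind /chi /=.
    by move=> /andP[/eqP -> /eqP ->].
  by move=> [-> ->]; rewrite !eqxx.
rewrite ind0 -(probability_setT m) (sum_fibres m (f := chi : Y -> Z) mf measurableT).
rewrite (eq_bigr (fun=> m (chi @^-1` [set 0]))) => [|[a b] _].
  by rewrite sumr_const card_prod !card_ord Zp_cast.
rewrite setTI; pose g : Y := fun i => if i == ord0 then d0 D *+ (a : nat) + d1 D *+ (b : nat) else 0.
have chig : chi g = (a, b).
  rewrite /chi /g eqxx; congr (_, _).
    rewrite (homD (@chi0B _ _ D)) !(homMn (@chi0B _ _ D)) chi0_d0 chi0_d1 mul0rn addr0.
    exact: natr_Zp.
  rewrite (homD (@chi1B _ _ D)) !(homMn (@chi1B _ _ D)) chi1_d0 chi1_d1 mul0rn add0r.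
  exact: natr_Zp.
rewrite -(m_inv g _ (mf (a, b))); congr (m _); apply/seteqP; split=> y /=.
  by rewrite (homD chiB) chig -{2}[(a, b)]add0r => /addIr.
by rewrite (homD chiB) chig => ->; rewrite add0r.
Qed.

(** The forms are independent because shifts by [big] act on them one at a time. The
    first variable gives the fibre of [chi0] over 1 the mass [p ^ -2], whereas a law
    of the class gives it mass 0, 1 or [1 / p]. *)
Lemma counterexample : ~ skitovich_darmois R X n.
Proof.
move=> SD; have [m m_inv] := haar_exists R (finite_power_profinite n.+1 X_profinite).
have [_ _ [V V_chain]] := X_profinite.
have mxi i : measurable_fun setT (xi i : borel Y -> borel X) by exact: continuous_borel.
have sB := big_subgroup D.
have mL j : measurable_fun setT (L j : borel Y -> borel X).
  apply: (@continuous_borel Y X); apply: (@sum_continuous Y X) => i y.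
  by apply: (@continuous_comp _ _ _ (xi i) (al i j)); [exact: xi_cont|exact: al_cont].
have indep_xi : mutually_independent m (fun i => xi i : borel Y -> borel X).
  apply: (shift_independent cX V_chain m_inv sB mxi (ok := fun i => i != i0)).
  - by move=> j j' /negbNE/eqP -> /negbNE/eqP ->.
  - by move=> j y _; exact: xi_big.
  - move=> j t jj tb.
    have [||g gP] := translation (tau := fun i => if i == j then t else 0).
    + by rewrite eq_sym (negbTE jj); exact: (small_subgroup D).1.
    + by move=> i; case: ifP => // _; exact: sB.1.
    + exists g; split=> [y|j' y /negbTE j'j]; first by rewrite gP eqxx.
      by rewrite gP j'j addr0.
have indep_L : mutually_independent m (fun j => L j : borel Y -> borel X).
  apply: (shift_independent cX V_chain m_inv sB mL (ok := fun=> true)) => //.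
  move=> j t _ tb.
  have [|tau [ts tbig tE]] := solve (w := fun i => if i == j then t else 0).
    by move=> i; case: ifP => // _; exact: sB.1.
  have [g gP] := translation ts tbig.
  have LE i y : L i (y + g) = L i y + (if i == j then t else 0).
    rewrite -tE -big_split; apply: eq_bigr => k _; rewrite gP (homD (@alB _ _)) //.
  exists g; split=> [y|j' y /negbTE j'j]; first by rewrite LE eqxx.
  by rewrite LE j'j addr0.
have := SD _ (borel Y) m (fun i => mfun_of (mxi i) : {RV m >-> borel X}) al al_aut
  indep_xi indep_L i0.
move=> /(gaussian_haar_fibre p_prime hX (@chi0B _ _ D) (@chi0_cont _ _ D)).
set mu := distribution _ _.
have mu1 : mu (fibre (chi0 D) 1) = m [set y | ind y].
  rewrite /mu /distribution /= /pushforward; congr (m _).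
  have p10 : 0 <> 1 :> 'Z_p by apply/eqP; rewrite eq_sym oner_neq0.
  apply/seteqP; split=> y; rewrite /fibre /xi /= (homD (@chi0B _ _ D)).
    rewrite (chi0_small (proj_small_in D _)) add0r.
    by case: (ind y) => //; rewrite (hom0 (@chi0B _ _ D)).
  by move=> ->; rewrite (chi0_small (proj_small_in D _)) add0r chi0_d0.
have qpp := ind_mass m_inv.
have p1 := prime_gt1 p_prime.
have pp1 : (1 < p * p)%N by rewrite (leq_trans p1)// leq_pmulr// ltnW.
have pp0 : (p * p)%:R != 1 :> R by rewrite -[1]/(1%:R) eqr_nat neq_ltn pp1 orbT.
case=> /(_ 1).
  case=> qE; move: qpp; rewrite -(etrans (esym qE) mu1).
    by rewrite -EFin_natmul mul0rn => -[] /eqP; rewrite eq_sym oner_eq0.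
  by rewrite -EFin_natmul => -[] /eqP; rewrite (negbTE pp0).
move=> qE; move: qpp; rewrite -(etrans (esym qE) mu1) -EFin_natmul => -[].
have p0 : p%:R != 0 :> R by rewrite pnatr_eq0 -lt0n ltnW.
rewrite -[_ *+ (p * p)]mulr_natr natrM mulKf// => /eqP.
by apply/negP; rewrite -[1]/(1%:R) eqr_nat neq_ltn p1 orbT.
Qed.

End Counterexample.

(** * Openness of the multiples *)

(** The greatest common divisor of [m] and [p ^ j] is 1 if [m < p], and otherwise it
    divides [p ^ m.+1] since [m < p ^ m]. *)
Lemma mulrn_solvable p m c j : prime p -> (0 < m)%N -> (p <= m -> p ^ m.+1 %| c)%N ->
  exists a b, (m * a = b * p ^ j + c)%N.
Proof.
move=> p_prime m_gt0 pmc; set d := gcdn m (p ^ j).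
have dc : (d %| c)%N.
  have /(dvdn_pfactor _ _ p_prime)[i _ di] : (d %| p ^ j)%N by exact: dvdn_gcdr.
  have im : (p ^ i <= m)%N by rewrite -di dvdn_leq// dvdn_gcdl.
  case: i => [|i] in di im *; first by rewrite di expn0 dvd1n.
  have p_gt1 := prime_gt1 p_prime.
  rewrite di (@dvdn_trans (p ^ m.+1))//; last first.
    by apply: pmc; apply: leq_trans im; rewrite expnS leq_pmulr// expn_gt0 ltnW.
  by rewrite dvdn_exp2l// ltnW// ltnS ltnW// (leq_trans (ltn_expl i.+1 p_gt1)).
case: (egcdnP (p ^ j) m_gt0) => u v uv _.
exists (u * (c %/ d))%N, (v * (c %/ d))%N.
by rewrite mulnA [(m * u)%N]mulnC uv mulnDl -/d [(d * _)%N]mulnC divnK// mulnAC.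
Qed.

(** The multiples of [m] form a compact, hence closed subgroup, and integers
    approximate [z]. *)
Lemma padic_divisible (p : prime_number) m (z : padic p) : (0 < m)%N ->
  (val p <= m -> padic_ker m z)%N -> exists w, w *+ m = z.
Proof.
move=> m_gt0 zm; have [cP hP _] := padic_profinite p.
have cl : closed ((fun w : padic p => w *+ m) @` setT).
  by apply: closed_image closedT => //; exact: mulrn_continuous.
have [w _ wz] : ((fun w : padic p => w *+ m) @` setT) z; last by exists w.
apply: (chain_closedP (padic_chain p) cl) => k.
set j := maxn k m; set c := (level j z : nat).
have cz : padic_ker j (padic_one p *+ c - z) := padic_one_gen j z.
have kc : (val p <= m -> val p ^ m.+1 %| c)%N.
  move=> pm; have /padic_ker_one : padic_ker m (padic_one p *~ c%:Z).
    rewrite -pmulrn -(subrK z (_ *+ c)); apply: subgroupD; first exact: padic_ker_subgroup.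
      exact: level_dec (leq_maxr _ _) cz.
    exact: zm.
  by [].
have [a [b ab]] := mulrn_solvable j.+1 (valP p) m_gt0 kc.
exists (padic_one p *+ a *+ m); first by exists (padic_one p *+ a).
apply: (@level_dec p _ _ _ (leq_maxl k m)).
rewrite -mulrnA mulnC ab mulrnDr -addrA; apply: (subgroupD (padic_ker_subgroup p j)) => //.
by rewrite mulrnA; exact: padic_ker_Mn.
Qed.

Lemma primary_divisible p (G : finZmodType) m (g : G) : prime p -> p_primary p G ->
  (0 < m < p)%N -> exists h, h *+ m = g.
Proof.
move=> p_prime Gp /andP[m_gt0 mp]; have [->|g0] := eqVneq g 0.
  by exists 0; rewrite mul0rn.
have [k gk] := Gp g g0.
have gpk : g *+ p ^ k = 0.
  by apply/eqP; rewrite -FinRing.zmodXgE -[_ == 0]/(_ == 1%g) -order_dvdn gk.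
have [|a [b ab]] := @mulrn_solvable p m 1 k p_prime m_gt0.
  by rewrite leqNgt mp.
exists (g *+ a).
by rewrite -mulrnA mulnC ab mulrnDr mulnC mulrnA gpk mul0rn add0r.
Qed.

(** The multiples of [m] contain the elements whose components at the finitely many
    primes up to [m] are small. *)
Lemma mulrn_open (np : prime_number -> nat) (G : prime_number -> finZmodType) m :
  (forall p, p_primary (val p) (G p)) -> (0 < m)%N ->
  open [set z *+ m | z in [set: direct_product (fun p => padic_part p (np p) (G p))]].
Proof.
move=> Gp m_gt0; set W := direct_product _.
apply: open_subgroup.
  by apply: subgroup_image => // x y; exact: mulrnBl.
have n1 : nbhs (0 : W) [set z : W | forall (i : 'I_m.+1) (ip : prime i),
    part_ker m (z (exist (fun p => prime p) (i : nat) ip))].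
  have := @filter_forall W 'I_m.+1 (fun i => [set z : W | forall ip : prime i,
    part_ker m (z (exist (fun p => prime p) (i : nat) ip))]) (nbhs (0 : W)) _.
  apply=> i; have [ip|nip] := pselect (prime i); last by apply: filterS filterT => z _ ip; case: nip.
  pose q : prime_number := exist (fun p => prime p) (i : nat) ip.
  have n0 : nbhs (0 : padic_part q (np q) (G q)) (@part_ker q (np q) (G q) m).
    by apply: open_nbhs_nbhs; split; [exact: part_ker_open|exact: (part_ker_subgroup q (np q) (G q) m).1].
  have := @prod_topology_proj_continuous _ (fun p => padic_part p (np p) (G p)) q (0 : W) _ n0.
  move=> h; apply: (@filterS _ (nbhs (0 : W)) _ _ _ _ h) => z zq ip'; rewrite (bool_irrelevance ip' ip); exact: zq.
apply: filterS n1 => z zm.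
have wz p : exists w : padic_part p (np p) (G p), w *+ m = z p.
  have [|f fz] := @choice 'I_(np p) (padic p) (fun i y => y *+ m = (z p).1 i).
    move=> i.
    apply: padic_divisible => // pm.
    case: p pm i => p ip pm i; exact: (zm (Ordinal (pm : p < m.+1)%N) ip).1.
  have [g gz] : exists g : G p, g *+ m = (z p).2.
    have [pm|pm] := leqP (val p) m.
      exists 0; rewrite mul0rn.
      case: p pm f fz => p ip pm _ _; symmetry; exact: (zm (Ordinal (pm : p < m.+1)%N) ip).2.
    by apply: (primary_divisible _ (valP p) (Gp p)); rewrite m_gt0.
  exists (f, g).
  have E q : ((f, g) : padic_part p (np p) (G p)) *+ q = ((fun i => f i *+ q), g *+ q).
    elim: q => [//|q IH]; rewrite mulrS IH; congr (_, _); last by rewrite mulrS.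
    by apply: functional_extensionality_dep => i; rewrite mulrS.
  by rewrite E gz [RHS]surjective_pairing; congr (_, _); apply: functional_extensionality_dep.
pose w : W := fun p => projT1 (cid (wz p)).
exists w => //; apply: functional_extensionality_dep => p; rewrite -(projT2 (cid (wz p))) -/(w p).
by move: w; clear; move=> w; elim: m => [//|m IH]; rewrite !mulrS -IH.
Qed.

Lemma multiples_open (X Z : topologicalZmodType) m : top_isomorphic X Z ->
  open [set z *+ m | z in [set: Z]] -> open [set x *+ m | x in [set: X]].
Proof.
move=> [f [fB fc [g [fK gK _]]]] oZ.
rewrite (_ : [set x *+ m | x in _] = f @^-1` [set z *+ m | z in [set: Z]]).
  by apply: open_comp => // x _; exact: fc.
apply/seteqP; split=> [_ [x _ <-]|x [z _ zx]] /=.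
  by exists (f x); rewrite ?(homMn fB).
by exists (g z) => //; apply: (can_inj fK); rewrite (homMn fB) gK.
Qed.

(** An open subgroup contains the multiples of its index, so the multiples of
    factorials are a neighbourhood basis as soon as they are open. *)
Lemma factorial_chain (X : topologicalZmodType) : profinite X ->
  (forall m, (0 < m)%N -> open [set x *+ m | x in [set: X]]) ->
  open_chain (fun k => [set x *+ k.+1`! | x in [set: X]]).
Proof.
move=> [cX hX [V [sV oV _ bV]]] oM; split.
- by move=> k; apply: subgroup_image => // x y; exact: mulrnBl.
- by move=> k; apply: oM; exact: fact_gt0.
- move=> j k jk _ [x _ <-].
  have /dvdnP[c ->] : (j.+1`! %| k.+1`!)%N.
    rewrite -(subnK jk); elim: (k - j)%N => [//|d IH].
    by rewrite addSn factS dvdn_mull.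
  by exists (x *+ c) => //; rewrite -mulrnA.
- move=> O /bV[i iO]; have [m m_gt0 Vm] := open_subgroup_index cX (sV i) (oV i).
  exists m => _ [x _ <-]; apply: iO.
  have /dvdnP[c ->] : (m %| m.+1`!)%N by rewrite dvdn_fact// m_gt0 leqnSn.
  by rewrite mulrnA; exact: Vm.
Qed.

(** * Independent forms on finite groups *)

Section FiniteGroup.
Variables (R : realFieldType) (G : finZmodType) (n : nat).
Variables (a : 'I_n -> 'I_n -> G -> G) (mu : 'I_n -> G -> R).
Hypothesis n_ge2 : (2 <= n)%N.
Hypothesis aB : forall i j, zmod_morphism (a i j).
Hypothesis a_inj : forall i j, injective (a i j).
Hypothesis mu_ge0 : forall i x, 0 <= mu i x.
Hypothesis mu_sum : forall i, \sum_x mu i x = 1.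

Implicit Types x : {ffun 'I_n -> G}.

Definition lin_form j x : G := \sum_i a i j (x i).
(** The law of the form [j] when the variables are independent with laws [mu i]. *)
Definition form_law j (z : G) : R := \sum_(x | lin_form j x == z) \prod_i mu i (x i).

(** What the independence of the forms gives at single points: the event that the
    variables take the values [x] is contained in the event that the forms take the
    values at [x]. *)
Hypothesis mu_le : forall x, \prod_i mu i (x i) <= \prod_j form_law j (lin_form j x).

Let aD i j u v : a i j (u + v) = a i j u + a i j v. Proof. exact: (homD (aB i j)). Qed.

Let a_surj i j z : exists t, a i j t = z.
Proof. by have [g _ gK] := injF_bij (@a_inj i j); exists (g z). Qed.

Definition shift x k (s : G) : {ffun 'I_n -> G} :=
  [ffun l => x l + (if l == k then s else 0)].

Lemma shiftE x k s : shift x k s k = x k + s. Proof. by rewrite ffunE eqxx. Qed.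
Lemma shiftN x k s l : l != k -> shift x k s l = x l.
Proof. by move=> /negbTE lk; rewrite ffunE lk addr0. Qed.

Lemma form_shift j x k s : lin_form j (shift x k s) = lin_form j x + a k j s.
Proof.
rewrite /lin_form (bigD1 k)//= [in RHS](bigD1 k)//= shiftE aD addrAC; congr (_ + _ + _).
by apply: eq_bigr => l lk; rewrite shiftN.
Qed.

Lemma shiftK k s : cancel (fun x => shift x k s) (fun x => shift x k (- s)).
Proof.
move=> x; apply/ffunP => l; rewrite !ffunE.
by case: eqP => _; rewrite ?addrK ?addr0.
Qed.

(** Conditioning on a form leaves the other variables unconditioned: the
    remaining coordinate absorbs the condition. *)
Lemma form_condition i j z :
  \sum_(x | lin_form j x == z) \prod_(k | k != i) mu k (x k) = 1.
Proof.
pose c z := \sum_(x | lin_form j x == z) \prod_(k | k != i) mu k (x k).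
have cE z1 z2 : c z1 = c z2.
  have [t tE] := a_surj i j (z2 - z1).
  rewrite /c [RHS](reindex (fun x => shift x i t)) /=; last first.
    exists (fun x => shift x i (- t)) => x _; first exact: shiftK.
    by rewrite -{2}(opprK t) shiftK.
  apply: eq_big => [x|x _]; last by apply: eq_bigr => k ki; rewrite shiftN.
  by rewrite form_shift tE [RHS]eq_sym -subr_eq subKr eq_sym.
have : \sum_z c z = #|G|%:R.
  transitivity (\sum_(x : {ffun 'I_n -> G}) \prod_(k | k != i) mu k (x k)).
    by symmetry; exact: (partition_big (lin_form j) xpredT).
  pose F k t := if k == i then 1 else mu k t.
  rewrite (eq_bigr (fun x => \prod_k F k (x k))) => [|x _].
    rewrite -(bigA_distr_bigA F) (bigD1 i)//= /F eqxx sumr_const big1 ?mulr1//.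
    by move=> k /negbTE ->.
  rewrite [RHS](bigD1 i)//= /F eqxx mul1r.
  by apply: eq_bigr => k /negbTE ->.
rewrite (eq_bigr (fun=> c z)) => [|z' _]; last exact: cE.
rewrite sumr_const => cG.
have G0 : #|G|%:R != 0 :> R by rewrite pnatr_eq0 -lt0n; apply/card_gt0P; exists 0.
by apply: (mulIf G0); rewrite mul1r mulr_natr -[RHS]cG.
Qed.

Lemma form_law_ge0 j z : 0 <= form_law j z.
Proof. by apply: sumr_ge0 => x _; exact: prodr_ge0. Qed.

(** By [form_condition] the mass of a form at a point is a mean of values of [mu i]. *)
Lemma form_law_le i j z M : (forall t, mu i t <= M) -> form_law j z <= M.
Proof.
move=> muM; rewrite -[M]mul1r -(form_condition i j z) mulr_suml.
apply: ler_sum => x _; rewrite (bigD1 i)//= mulrC ler_wpM2l// prodr_ge0 => // k _; exact: mu_ge0.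
Qed.

(** If the bound is attained, every term of the mean of [M - mu i] vanishes. *)
Lemma form_law_max i j x M : (forall t, mu i t <= M) -> form_law j (lin_form j x) = M ->
  forall y, lin_form j y = lin_form j x -> (forall k, k != i -> mu k (y k) != 0) -> mu i (y i) = M.
Proof.
move=> muM lawM y yx yk.
have : \sum_(x' | lin_form j x' == lin_form j x) (\prod_(k | k != i) mu k (x' k)) * (M - mu i (x' i)) = 0.
  rewrite (eq_bigr (fun x' => (\prod_(k | k != i) mu k (x' k)) * M - \prod_k mu k (x' k))).
    by rewrite sumrB -mulr_suml form_condition mul1r -/(form_law j _) lawM subrr.
  by move=> x' _; rewrite mulrBr [\prod_k _](bigD1 i)//= [mu i _ * _]mulrC.
move=> /eqP; rewrite psumr_eq0 => [/allP/(_ y)|x' _]; last first.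
  by rewrite mulr_ge0 ?subr_ge0// prodr_ge0.
rewrite mem_index_enum yx eqxx /= => /(_ isT); rewrite mulf_eq0 subr_eq0.
have /negbTE -> : \prod_(k | k != i) mu k (y k) != 0 by apply/prodf_neq0.
by move=> /eqP.
Qed.

Lemma mu_max i : exists m, forall t, mu i t <= mu i m.
Proof. by exists [arg max_(t > 0) mu i t]%O; case: arg_maxP => // t _ h u; exact: h. Qed.

(** At a point where all [mu i] are maximal, [mu_le] and [form_law_le] compare the
    products of the maxima; the bound on each form by any of the maxima makes them all
    equal. *)
Lemma maximizers : exists M : R, 0 < M /\ forall i, (forall t, mu i t <= M) /\ exists t, mu i t = M.
Proof.
have /fin_all_exists[m mP] := mu_max.
pose x := [ffun i => m i].
have m_gt0 i : 0 < mu i (m i).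
  rewrite lt_def mu_ge0 andbT; apply/eqP => m0.
  have := mu_sum i; rewrite big1 => [/eqP|t _]; first by rewrite eq_sym oner_eq0.
  by apply/eqP; rewrite eq_le mu_ge0 -m0 mP.
have le i k : mu i (m i) <= mu k (m k).
  have P_gt0 : 0 < \prod_(j | j != i) mu j (m j) by apply: prodr_gt0.
  rewrite -(ler_pM2r P_gt0).
  have := mu_le x; rewrite (bigD1 i)//= [leRHS](bigD1 i)//= ffunE.
  rewrite (eq_bigr (fun j => mu j (m j))) => [h|j _]; last by rewrite ffunE.
  apply: le_trans h _; apply: ler_pM.
  - exact: form_law_ge0.
  - by apply: prodr_ge0 => j _; exact: form_law_ge0.
  - exact: form_law_le (mP k).
  - apply: ler_prod => j _; rewrite form_law_ge0 /=; exact: form_law_le (mP j).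
exists (mu (Ordinal n_ge2) (m (Ordinal n_ge2))); split=> // i.
split=> [t|]; first exact: le_trans (mP i t) (le _ _).
by exists (m i); apply/eqP; rewrite eq_le !le.
Qed.

(** At a point of maximal mass the bound on each form is attained, so [form_law_max]
    lets one variable run through its support while another one compensates: the
    supports inject into the sets of maxima, and by symmetry both coincide. Every point
    of the product of the supports is then of maximal mass, and the same compensation
    gives that each support is a coset of a subgroup. *)
Lemma uniform_support : exists M : R, forall i,
  (forall t, mu i t != 0 -> mu i t = M) /\
  (forall u v w, mu i u != 0 -> mu i v != 0 -> mu i w != 0 -> mu i (u - v + w) != 0).
Proof.
have [M [M_gt0 MP]] := maximizers.
have muM i t : mu i t <= M by case: (MP i).
have /fin_all_exists[m mM] i : exists t, mu i t = M by case: (MP i).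
pose S i : {set G} := [set t | mu i t != 0]%SET; pose T i : {set G} := [set t | mu i t == M]%SET.
have form_max x j : (forall i, mu i (x i) = M) -> form_law j (lin_form j x) = M.
  move=> xM; apply/eqP; rewrite eq_le (form_law_le _ _ (muM j)) /=.
  have P_gt0 : 0 < \prod_(k | k != j) M by apply: prodr_gt0.
  rewrite -(ler_pM2r P_gt0).
  have := mu_le x; rewrite (eq_bigr (fun=> M)) => [|k _]; last exact: xM.
  rewrite (bigD1 j)//= [leRHS](bigD1 j)//= => h; apply: le_trans h _.
  rewrite ler_wpM2l ?form_law_ge0//; apply: ler_prod => k _.
  by rewrite form_law_ge0 (form_law_le _ _ (muM k)).
pose j0 := Ordinal n_ge2.
have exchange i k : i != k -> exists b : G -> G, [/\ injective b
    & forall u v y, mu i u = M -> mu k v = M -> mu k y != 0 -> mu i (u - b (y - v)) = M].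
  move=> ik; have /fin_all_exists[b bE] s : exists t, a i j0 t = a k j0 s.
    exact: a_surj.
  exists b; split=> [s t /(congr1 (a i j0))|u v y uM vM y0].
    by rewrite !bE => /a_inj.
  pose x : {ffun 'I_n -> G} := [ffun l => if l == i then u else if l == k then v else m l].
  have xM l : mu l (x l) = M.
    by rewrite ffunE; case: eqP => [->//|_]; case: eqP => [->|_].
  have xi : x i = u by rewrite ffunE eqxx.
  have xk : x k = v by rewrite ffunE eq_sym (negbTE ik) eqxx.
  have := @form_law_max i j0 x M (muM i) (form_max x j0 xM)
    (shift (shift x k (y - v)) i (- b (y - v))).
  rewrite shiftE shiftN// xi; apply.
    by rewrite !form_shift (homN (aB i j0)) bE addrK.
  move=> l li; rewrite shiftN//; have [->|lk] := eqVneq l k.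
    by rewrite shiftE xk addrC subrK.
  by rewrite shiftN// xM lt0r_neq0.
have TS i : T i \subset S i.
  by apply/fintype.subsetP => t; rewrite !inE => /eqP ->; rewrite lt0r_neq0.
have ST i k : i != k -> (#|S k| <= #|T i|)%N.
  move=> ik; have [b [b_inj bM]] := exchange i k ik.
  have f_inj : injective (fun y => m i - b (y - m k)).
    by move=> y z /addrI/oppr_inj/b_inj/addIr.
  rewrite -(card_imset _ f_inj); apply/subset_leq_card/fintype.subsetP.
  by move=> _ /imsetP[y + ->]; rewrite !inE => y0; apply/eqP/bM.
have other (i : 'I_n) : exists k : 'I_n, i != k.
  by have [->|ij] := eqVneq i j0; [exists (Ordinal (ltnW n_ge2))|exists j0].
have STE i : T i = S i.
  have [k ik] := other i; apply/eqP; rewrite eqEcard TS /=.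
  apply: leq_trans (ST _ _ ik); apply: leq_trans (subset_leq_card (TS k)).
  by apply: ST; rewrite eq_sym.
have SM i t : mu i t != 0 -> mu i t = M.
  move=> t0; have : t \in S i by rewrite inE.
  by rewrite -STE inE => /eqP.
exists M => i; split=> [|u v w u0 v0 w0]; first exact: SM.
have [k ik] := other i; have [b [b_inj bM]] := exchange i k ik.
pose f y := v - b (y - m k).
have f_inj : injective f by move=> y z /addrI/oppr_inj/b_inj/addIr.
have fS : f @: S k = S i.
  apply/eqP; rewrite eqEcard card_imset//; apply/andP; split.
    apply/fintype.subsetP => _ /imsetP[y + ->]; rewrite -(STE i) !inE => y0.
    by apply/eqP/bM => //; exact: SM.
  by rewrite -(STE k) ST// eq_sym.
have : w \in S i by rewrite inE.
rewrite -fS => /imsetP[y + wE]; rewrite inE => y0.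
by rewrite wE /f addrA subrK (bM u (m k) y (SM _ _ u0) (mM k) y0) lt0r_neq0.
Qed.

End FiniteGroup.

(** * Laws uniform on cosets as shifted Haar laws *)

Lemma normc_ge_Im (R : rcfType) (x : R[i]) : `|complex.Im x|%:C%C <= `|x|.
Proof.
case: x => a b; simpc; rewrite -[`|_|]sqrtr_sqr; apply: ler_wsqrtr.
by rewrite lerDr sqr_ge0.
Qed.

Section DiracConvolution.
Variables (R : realType) (X : topologicalZmodType) (V : nat -> set X).
Hypothesis cX : compact [set: X].
Hypothesis V_chain : open_chain V.
Implicit Types mu nu m : probability (borel X) R.
Local Open Scope ereal_scope.

Lemma convolution_dirac mu x A : measurable (A : set (borel X)) ->
  convolution mu (dirac (x : borel X) : probability (borel X) R) A = mu ((fun y => (y + x)%R) @^-1` A).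
Proof.
move=> mA; set B := (X in _ = mu X).
have mB : measurable (B : set (borel X)).
  by apply: continuous_hom_borel mA; exact: translate_continuous.
rewrite -(setIT B) -integral_indic// /convolution /pushforward /product_measure1.
apply: eq_integral => y _; rewrite /= diracE indicE; congr (_%:R)%:E.
by congr nat_of_bool; rewrite /xsection; apply/idP/idP => /set_mem h; apply/mem_set; move: h; rewrite /= ?inE.
Qed.

Lemma dirac_convolution nu A : measurable (A : set (borel X)) ->
  convolution (dirac (0%R : borel X) : probability (borel X) R) nu A = nu A.
Proof.
move=> mA; rewrite /convolution /pushforward /product_measure1.
set B := _ @^-1` A.
have mB : measurable (B : set (borel X * borel X)).
  by rewrite -[B]setTI; apply: (borel_add_measurable cX V_chain).
rewrite integral_dirac//; last exact: measurable_fun_xsection.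
rewrite diracT mul1e /=; congr (nu _); apply/seteqP; split=> y; rewrite /xsection /B /= ?inE/= add0r //.
Qed.

(** The real and imaginary parts are continuous, being 1-Lipschitz functions of the
    character. *)
Lemma character_measurable (y : char_group R X) :
  measurable_fun setT ((fun x => complex.Re (pairing x y)) : borel X -> R) /\
  measurable_fun setT ((fun x => complex.Im (pairing x y)) : borel X -> R).
Proof.
have [yc _ _] := set_mem (valP y).
have H (g : R[i] -> R) : (forall z w, `|g z - g w|%:C%C <= `|z - w|)%R ->
    measurable_fun setT ((fun x => g (pairing x y)) : borel X -> R).
  move=> gL; apply: (@measurability _ _ (borel X) R _ _ (@measurable_realfun.RGenOpens.G R)).
    exact: measurable_realfun.RGenOpens.measurableE.
  move=> _ [_ [u [v ->]] <-]; rewrite setTI; apply: open_borel.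
  have oA : open (`]u, v[%classic : set R) by exact: interval_open.
  apply: open_comp oA => x _ B /nbhs_ballP[e /= e0 eB].
  have e0C : (0 < e%:C%C :> R[i])%R by rewrite ltcR.
  have := yc x _ (nbhsx_ballx (val y x : R[i]^o) _ e0C).
  move=> yB; apply: (@filterS X (nbhs x) _ _ _ _ yB) => t /= yt; apply: eB; rewrite /ball /= -ltcR.
  by apply: le_lt_trans (gL _ _) _.
split; apply: H => z w.
  rewrite (_ : (complex.Re z - complex.Re w)%R = complex.Re (z - w)%R); first exact: normc_ge_Re.
  by case: z w => ? ? [].
rewrite (_ : (complex.Im z - complex.Im w)%R = complex.Im (z - w)%R); first exact: normc_ge_Im.
by case: z w => ? ? [].
Qed.

Lemma dirac_gaussian : Gaussian (dirac (0%R : borel X) : probability (borel X) R).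
Proof.
exists 0%R, (fun=> 0%R); split=> //.
- by move=> y; apply: (@cst_continuous _ R).
- by move=> _ _; rewrite !mulr0 addr0.
move=> y; rewrite oppr0 expR0 mulr1; have [mre mim] := character_measurable y.
rewrite /char_function /Rintegral !integral_dirac//; [|exact/measurable_realfun.measurable_EFinP..].
by rewrite diracT !mul1e /=; case: (pairing _ y).
Qed.

Let sV i : subgroup (V i). Proof. by case: V_chain. Qed.
Let oV i : open (V i). Proof. by case: V_chain. Qed.
Let dV i j : (i <= j)%N -> V j `<=` V i. Proof. by case: V_chain => _ _ /(_ i j). Qed.

Lemma null_cosets mu k : mu [set x | mu (coset V k x) = 0] = 0.
Proof.
have [s sP] := finite_cosets cX (sV k) (oV k).
rewrite (_ : [set x | _] = \big[setU/set0]_(x <- s | `[< mu (coset V k x) = 0 >]) coset V k x).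
  elim: s {sP} => [|x s IH]; first by rewrite big_nil measure0.
  rewrite big_cons; case: ifPn => // /asboolP x0; rewrite measureU0//.
  - exact: coset_measurable.
  - by apply: bigsetU_measurable => y _; exact: coset_measurable.
apply/seteqP; split=> x /=; rewrite -bigcup_seq_cond.
  move=> x0; have [y ys yx] := sP x; exists y => //=.
  by rewrite ys; apply/asboolP; rewrite -(coset_eq V_chain (yx : coset V k y x)).
by move=> [y /= /andP[_ /asboolP y0] yx]; rewrite (coset_eq V_chain yx).
Qed.

(** By compactness some [x0] has all its cosets of positive mass, and the differences
    [x - x0] for such points [x] form a closed subgroup [K]. The shift of [mu] by [x0] is
    carried by [K] and invariant under its translations, since these permute the cosets
    of positive mass. *)
Lemma coset_uniform_law mu :
  (forall k x y, mu (coset V k x) <> 0 -> mu (coset V k y) <> 0 ->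
    mu (coset V k x) = mu (coset V k y)) ->
  (forall k x y z, mu (coset V k x) <> 0 -> mu (coset V k y) <> 0 ->
    mu (coset V k z) <> 0 -> mu (coset V k (x - y + z)%R) <> 0) ->
  Gaussian_conv_shifted_haar mu.
Proof.
move=> unif aff.
pose C k := [set x | mu (coset V k x) <> 0].
have CE k x y : coset V k x y -> C k x -> C k y.
  by rewrite /C /= => xy; rewrite (coset_eq V_chain xy).
have Cc k : closed (C k).
  move=> x /(_ (coset V k x))[|y [Cy xy]]; first exact: open_subgroup_nbhs.
  by move: Cy; rewrite /C /= (coset_eq V_chain xy).
have mC k : measurable (C k : set (borel X)) by apply: closed_borel.
have muC k : mu (~` C k) = 0.
  by rewrite -[RHS](null_cosets mu k); congr (mu _); apply/seteqP; split=> x /=; rewrite notK.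
have dC j k : (j <= k)%N -> C k `<=` C j.
  move=> jk x; apply: contra_not => xj.
  apply/eqP; rewrite -measure_le0 -xj; apply: le_measure; rewrite ?inE; try exact: coset_measurable.
  by move=> y; exact: dV.
have [x0 Cx0] : exists x, forall k, C k x.
  apply: (@nested_closed X C cX) => // k; apply: contrapT => /set0P/negP/negPn/eqP C0.
  by have := muC k; rewrite C0 setC0 probability_setT => /eqP; rewrite onee_eq0.
pose K := [set x | forall k, C k (x0 + x)%R].
have sK : subgroup K.
  split=> [k|a b Ka Kb k]; first by rewrite addr0.
  rewrite (_ : x0 + (a - b) = (x0 + a) - (x0 + b) + x0)%R; last zmod.
  by apply: aff; [exact: Ka|exact: Kb|exact: Cx0].
have cK : closed K.
  rewrite (_ : K = \bigcap_k ((fun x => (x0 + x)%R) @^-1` C k)).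
    by apply: closed_bigI => k _; apply: closed_preimage => //; exact: add_continuousl.
  by apply/seteqP; split=> [x Kx k _|x Kx k]; [exact: Kx|exact: (Kx k I)].
have mK : measurable (K : set (borel X)) by exact: closed_borel.
have tc (x : X) : measurable_fun setT ((fun y => (y + x)%R) : borel X -> borel X).
  by apply: continuous_borel; exact: translate_continuous.
have tA (x : X) (A : set (borel X)) : measurable A -> measurable ((fun y => (y + x)%R) @^-1` A : set (borel X)).
  by move=> mA; rewrite -[_ @^-1` _]setTI; exact: tc.
pose m : probability (borel X) R := distribution mu (mfun_of (tc (- x0)%R) : {RV mu >-> borel X}).
have mE A : m A = mu ((fun y => (y - x0)%R) @^-1` A) by [].
have mcoset k x : m (coset V k x) = mu (coset V k (x0 + x)%R).
  rewrite mE; congr (mu _); apply/seteqP; split=> y; rewrite /coset /preimage /= => h.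
    by rewrite (_ : y - (x0 + x) = y - x0 - x)%R//; zmod.
  by rewrite (_ : y - x0 - x = y - (x0 + x))%R//; zmod.
have mK1 : m K = 1.
  have mCK : m (~` K) = 0.
    rewrite mE (_ : _ @^-1` _ = \bigcup_k (~` C k)).
      apply: measure_negligible; first by apply: bigcupT_measurable => k; exact: measurableC.
      by apply: negligible_bigcup => k; apply/negligibleP; [exact: measurableC|exact: muC].
    apply/seteqP; split=> y; rewrite /K /preimage /=.
      by move=> /existsNP[k yk]; exists k => //; move: yk; rewrite addrC subrK.
    by move=> [k _ yk] /(_ k); rewrite addrC subrK.
  by have := probability_setC m (measurableC mK); rewrite setCK mCK sube0.
have haar : is_haar K m.
  split=> // h A Kh AK mA.
  rewrite (_ : _ @` A = (fun x => (x - h)%R) @^-1` A); last first.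
    apply/seteqP; split=> [_ [x Ax <-]|x Ax] /=; first by rewrite addrAC subrr add0r.
    by exists (x - h)%R => //; rewrite addrC subrK.
  pose m' : probability (borel X) R := distribution m (mfun_of (tc (- h)%R) : {RV m >-> borel X}).
  have m'E B : m' B = m ((fun y => (y - h)%R) @^-1` B) by [].
  rewrite -m'E; apply: (measure_eq_cosets cX V_chain) => //.
    by rewrite -ge0_fin_numE// fin_num_measure.
  move=> k x; transitivity (m ((fun y => (y - h)%R) @^-1` coset V k x)); first by [].
  rewrite (_ : _ @^-1` _ = coset V k (x + h)%R); last first.
    apply/seteqP; split=> y; rewrite /coset /preimage /= => Vy.
      by rewrite (_ : y - (x + h) = y - h - x)%R//; zmod.
    by rewrite (_ : y - h - x = y - (x + h))%R//; zmod.
  suff: mu (coset V k (x0 + (x + h))%R) = mu (coset V k (x0 + x)%R).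
    by move=> e; rewrite mcoset e; exact/esym/mcoset.
  have [n0|/contrapT z0] := pselect (C k (x0 + x)%R).
    apply: unif => //.
    rewrite (_ : x0 + (x + h) = (x0 + x) - x0 + (x0 + h))%R; last zmod.
    by apply: aff; [exact: n0|exact: Cx0|exact: Kh].
  rewrite z0; apply: contrapT => n0; suff: C k (x0 + x)%R by rewrite /C /= z0.
  rewrite (_ : x0 + x = (x0 + (x + h)) - (x0 + h) + x0)%R; last zmod.
  by apply: aff; [move=> h0; exact/n0/esym|exact: Kh|exact: Cx0].
exists (dirac (0%R : borel X)); first exact: dirac_gaussian.
exists mu; last by move=> A mA; rewrite dirac_convolution.
exists K, m, x0; split=> //.
  exact: subclosed_compact cX _.
move=> A mA; rewrite convolution_dirac// mE; congr (mu _).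
by apply/seteqP; split=> y; rewrite /preimage /= subrK.
Qed.

End DiracConvolution.

(** * The two implications *)

Section CharacteristicChain.
Variables (R : realType) (X : topologicalZmodType) (V : nat -> set X).
Hypothesis cX : compact [set: X].
Hypothesis V_chain : open_chain V.
Hypothesis V_aut : forall k (alpha : X -> X) x, top_automorphism alpha -> V k (alpha x) <-> V k x.
Variables (n : nat) (n_ge2 : (2 <= n)%N).
Variables (d : measure_display) (Omega : measurableType d) (P : probability Omega R).
Variables (xi : 'I_n -> {RV P >-> borel X}) (alpha : 'I_n -> 'I_n -> X -> X).
Hypothesis alpha_aut : forall i j, top_automorphism (alpha i j).
Hypothesis indep_xi : mutually_independent P (fun i => xi i : Omega -> borel X).
Hypothesis indep_L : mutually_independent P
  (fun j => (fun w => \sum_(i < n) alpha i j (xi i w)) : Omega -> borel X).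

Let sV i : subgroup (V i). Proof. by case: V_chain. Qed.
Let oV i : open (V i). Proof. by case: V_chain. Qed.

(** Automorphisms descend to the quotient by [V k], and the finite statement applies to
    the laws of the variables modulo [V k]. *)
Lemma coset_mass k : exists M : \bar R, forall i,
  (forall x, P (xi i @^-1` coset V k x) <> 0%E -> P (xi i @^-1` coset V k x) = M) /\
  (forall x y z, P (xi i @^-1` coset V k x) <> 0%E -> P (xi i @^-1` coset V k y) <> 0%E ->
    P (xi i @^-1` coset V k z) <> 0%E -> P (xi i @^-1` coset V k (x - y + z)) <> 0%E).
Proof.
have [G [q [qB q_onto q0]]] := finite_quotient cX (sV k) (oV k).
have /fin_all_exists[s sK] : forall g : G, exists x, q x = g by exact: q_onto.
have qE x y : q x = q y <-> V k (x - y).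
  by rewrite -q0 qB; split=> [->|/eqP]; [rewrite subrr|rewrite subr_eq0 => /eqP].
have preq x : q @^-1` [set q x] = coset V k x.
  by apply/seteqP; split=> y /=; rewrite qE.
pose a i j g := q (alpha i j (s g)).
have aE i j x : a i j (q x) = q (alpha i j x).
  have [aB _ _] := alpha_aut i j.
  by apply/qE; rewrite -aB; apply/V_aut => //; apply/qE; rewrite sK.
have aB i j : zmod_morphism (a i j).
  move=> g h; have [B _ _] := alpha_aut i j.
  by rewrite -(sK g) -(sK h) -qB !aE B qB.
have a_inj i j : injective (a i j).
  move=> g h; have [B _ _] := alpha_aut i j.
  rewrite -(sK g) -(sK h) !aE => /qE; rewrite -B => /V_aut h'.
  by apply/qE/h'.
have mq g : measurable (q @^-1` [set g] : set (borel X)).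
  by rewrite -(sK g) preq; exact: coset_measurable.
have mxi i A : measurable (A : set (borel X)) -> measurable (xi i @^-1` A).
  by move=> mA; rewrite -[_ @^-1` _]setTI; exact: measurable_funP.
pose ev i g := xi i @^-1` (q @^-1` [set g]).
have mev i g : measurable (ev i g) by apply: mxi.
pose mu i g := fine (P (ev i g)).
have muE i g : (mu i g)%:E = P (ev i g) by rewrite /mu fineK ?fin_num_measure.
have mu_ge0 i g : 0 <= mu i g by rewrite /mu fine_ge0.
have mu_sum i : \sum_g mu i g = 1.
  apply: EFin_inj; rewrite -sumEFin -(probability_setT P).
  rewrite (sum_fibres P (f := fun w => q (xi i w)) (mev i) measurableT).
  by apply: eq_bigr => g _; rewrite setTI muE.
pose f w : {ffun 'I_n -> G} := [ffun i => q (xi i w)].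
have fE x : f @^-1` [set x] = \bigcap_(i in [set` [set: 'I_n]%SET]) ev i (x i).
  apply/seteqP; split=> w /=.
    by move=> <- i _; rewrite /ev /= ffunE.
  by move=> wx; apply/ffunP => i; rewrite ffunE; apply: wx; rewrite /= inE.
have mf x : measurable (f @^-1` [set x]).
  rewrite fE; apply: fin_bigcap_measurable => // i _; exact: mev.
have Pf x : P (f @^-1` [set x]) = (\prod_i mu i (x i))%:E.
  rewrite fE indep_xi => [|i]; last exact: mq.
  rewrite -prodEFin; apply: eq_big => [i|i _]; first by rewrite inE.
  by rewrite muE.
pose L j w := \sum_(i < n) alpha i j (xi i w).
have qL j w : q (L j w) = lin_form a j (f w).
  by rewrite /L (hom_sum qB) /lin_form; apply: eq_bigr => i _; rewrite ffunE aE.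
have mL j z : measurable (L j @^-1` (q @^-1` [set z])).
  have -> : L j @^-1` (q @^-1` [set z]) = \big[setU/set0]_(x | lin_form a j x == z) f @^-1` [set x].
    apply/seteqP; split=> w; rewrite -bigcup_seq_cond.
      by move=> wz; exists (f w) => //=; rewrite mem_index_enum -qL; apply/eqP.
    by move=> [x /= /andP[_ /eqP <-] wx]; rewrite qL wx.
  by apply: bigsetU_measurable.
have PL j z : P (L j @^-1` (q @^-1` [set z])) = (form_law a mu j z)%:E.
  rewrite (sum_fibres P mf (mL j z)) /form_law -sumEFin [RHS]big_mkcond /=.
  apply: eq_bigr => x _; case: eqP => xz.
    rewrite -Pf; congr (P _); apply/setIidPr => w /= wx.
    by rewrite qL wx.
  rewrite (_ : _ `&` _ = set0) ?measure0//.
  by apply/seteqP; split=> // w [/= wz wx]; apply: xz; rewrite -wx -qL.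
have [|M MP] := @uniform_support R G n a mu n_ge2 aB a_inj mu_ge0 mu_sum.
  move=> x; rewrite -lee_fin -Pf -prodEFin.
  under eq_bigr do rewrite -PL.
  have := @indep_L [set: 'I_n]%SET (fun j => q @^-1` [set lin_form a j x]) (fun j => mq _).
  rewrite [X in _ = X](eq_bigl xpredT) => [<-|j]; last by rewrite inE.
  apply: le_measure; rewrite ?inE//.
    by apply: fin_bigcap_measurable => // j _; exact: mL.
  by move=> w /= <- j _; rewrite /= -qL.
exists M%:E => i; have [M1 M2] := MP i.
have Pq x : P (xi i @^-1` coset V k x) = (mu i (q x))%:E by rewrite muE /ev preq.
have nz x : P (xi i @^-1` coset V k x) <> 0%E <-> mu i (q x) != 0.
  by rewrite Pq; split=> [h|/eqP h [] //]; apply/eqP => h'; apply: h; rewrite h'.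
split=> [x|x y z]; rewrite !nz.
  by rewrite Pq => /M1 ->.
by rewrite (homD qB) qB; exact: M2.
Qed.

End CharacteristicChain.

(** A chain of open subgroups that all automorphisms preserve forces the
    characterization: on every finite quotient the laws are uniform on cosets. *)
Lemma characteristic_chain_characterizes (R : realType) (X : topologicalZmodType)
    (V : nat -> set X) n : (2 <= n)%N -> compact [set: X] -> open_chain V ->
  (forall k (alpha : X -> X) x, top_automorphism alpha -> V k (alpha x) <-> V k x) ->
  skitovich_darmois R X n.
Proof.
move=> n_ge2 cX V_chain V_aut d Omega P xi alpha alpha_aut indep_xi indep_L i.
have mass := coset_mass cX V_chain V_aut n_ge2 alpha_aut indep_xi indep_L.
apply: (coset_uniform_law cX V_chain) => [k x y|k x y z].
  by have [M /(_ i)[mM _]] := mass k; move=> /mM hx /mM hy; exact: etrans hx (esym hy).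
by have [M /(_ i)[_ affine]] := mass k; exact: affine.
Qed.

Lemma automorphism_multiples (X : topologicalZmodType) (alpha : X -> X) m x :
  top_automorphism alpha ->
  [set y *+ m | y in [set: X]] (alpha x) <-> [set y *+ m | y in [set: X]] x.
Proof.
move=> [aB _ [b [aK bK _]]]; split=> -[y _ yE].
  by exists (b y) => //; apply: (can_inj aK); rewrite (homMn aB) bK.
by exists (alpha y) => //; rewrite -(homMn aB) yE.
Qed.

Theorem theorem3p3 (R : realType) (X : topologicalZmodType)
    (X_second_countable : @second_countable X)
    (X_compact : compact [set: X])
    (X_totally_disconnected : totally_disconnected [set: X])
    (n : nat) (n_ge2 : (2 <= n)%N) :
  (forall (d : measure_display) (Omega : measurableType d)
      (P : probability Omega R) (xi : 'I_n -> {RV P >-> borel X})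
      (alpha : 'I_n -> 'I_n -> X -> X),
    (forall i j, top_automorphism (alpha i j)) ->
    mutually_independent P (fun i => xi i : Omega -> borel X) ->
    mutually_independent P
      (fun j => (fun w => \sum_(i < n) alpha i j (xi i w)) :
         Omega -> borel X) ->
    forall i, Gaussian_conv_shifted_haar (distribution P (xi i)))
  <->
  (exists (np : prime_number -> nat) (G : prime_number -> finZmodType),
    (forall p, p_primary (val p) (G p)) /\
    top_isomorphic X
      (direct_product (fun p : prime_number =>
         direct_product2 (direct_product (fun _ : 'I_(np p) => padic p))
                         (discrete_topology (G p))))).
Proof.
have X_profinite : profinite X.
  split=> //; last exact: exists_open_chain.
  exact: totally_disconnected_hausdorff.
split=> [SD|[np [G [Gp iso]]]].
  apply: finite_rank_structure => // p.
  have [//|[k [c free]]] := splitting_dichotomy (valP p) X_profinite.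
  have [_ _ [V V_chain]] := X_profinite.
  have [k' [d [free' Vd]]] := free_cyclic_system_null X_profinite V_chain free.
  have [D _] := shift_data_exists (valP p) X_profinite V_chain free' Vd.
  by case: (counterexample n_ge2 (valP p) X_profinite D SD).
apply: (characteristic_chain_characterizes n_ge2 X_compact).
  apply: factorial_chain => // m m_gt0.
  have oZ := mulrn_open np Gp m_gt0.
  by apply: (@multiples_open X _ m iso); exact: oZ.
by move=> k alpha x a_aut; exact: automorphism_multiples.
Qed.
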